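(* There exist universal constants $C, c, \varepsilon_0 > 0$ such that the following holds. Let $d, n$ be positive integers, let $0 < \varepsilon \le \varepsilon_0$, and suppose $n \ge C \frac{d}{\varepsilon^{2}}$. Let $\Sigma \in \mathbb{R}^{d \times d}$ be a positive definite matrix, let $u$ be a real-valued random variable, and let $x_1, \dots, x_n$ be independent samples from the elliptical distribution $E(\Sigma, u)$ with shape $\Sigma$. Then, with probability at least $1 - \exp(-c\, \varepsilon^{2} n)$, Tyler's M-estimator $\hat{\Sigma}$ for $x_1, \dots, x_n$ is well-defined and satisfies \[ \| I_{d} - \Sigma^{1/2} \hat{\Sigma}^{-1} \Sigma^{1/2} \|_{\mathrm{op}} \le \varepsilon . \]
   Context: Elliptical distribution: for a positive definite matrix $\Sigma \in \mathbb{R}^{d\times d}$ (the shape matrix) and a scalar random variable $u \in \mathbb{R}$, the random vector $X \sim E(\Sigma, u)$ is distributed as $X := \Sigma^{1/2} V \cdot u$, where $V$ is uniformly distributed on the unit sphere $S^{d-1} \subseteq \mathbb{R}^d$ and $u$ is independent of $V$. Tyler's M-estimator: given $x_1, \dots, x_n \in \mathbb{R}^d$, consider the equations \[ \frac{d}{n} \sum_{j=1}^{n} \frac{x_j x_j^T}{x_j^T \hat{\Sigma}^{-1} x_j} = \hat{\Sigma}, \qquad \operatorname{tr}[\hat{\Sigma}] = d . \] If these equations have a unique positive definite solution $\hat{\Sigma} \in \mathbb{R}^{d \times d}$, Tyler's M-estimator is defined to be that solution; otherwise it is not well-defined. $I_d$ is the $d \times d$ identity matrix and $\|\cdot\|_{\mathrm{op}}$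 is the operator (spectral) norm.
   Formalization: The formal theorem additionally assumes tr Σ = d (otherwise the bound fails, e.g. d = 1, Σ = 100, where Σ̂ = 1) and P(u = 0) = 0 (otherwise samples may vanish and Tyler's equations contain 0/0, so the estimator is not well-defined). *)

(* Defs.v *)
From HB Require Import structures.
From mathcomp Require Import all_boot all_order all_algebra.
From mathcomp Require Import all_classical all_reals all_analysis.

Set Implicit Arguments.
Unset Strict Implicit.
Unset Printing Implicit Defensive.

Import Order.TTheory GRing.Theory Num.Theory.
Import numFieldTopology.Exports.

Local Open Scope classical_set_scope.
Local Open Scope ring_scope.

Section Matrices.
Context {R : realType}.

Definition posdefmx d (A : 'M[R]_d) : Prop :=
  A^T = A /\ forall v : 'cV[R]_d, v != 0 -> 0 < (v^T *m A *m v) 0 0.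

Definition possemidefmx d (A : 'M[R]_d) : Prop :=
  A^T = A /\ forall v : 'cV[R]_d, 0 <= (v^T *m A *m v) 0 0.

(* The positive semidefinite square root of A, unique when it exists, which is
   exactly when A is positive semidefinite; otherwise the value is A (junk). *)
Definition sqrtmx d (A : 'M[R]_d) : 'M[R]_d :=
  xget A [set B | possemidefmx B /\ B *m B = A].

Definition norm2 d (v : 'cV[R]_d) : R := Num.sqrt (\sum_i v i 0 ^+ 2).

Definition opnorm d (A : 'M[R]_d) : R :=
  sup [set norm2 (A *m v) | v in [set v : 'cV[R]_d | norm2 v <= 1]].

End Matrices.

(* R^d with its Borel sigma-algebra; convertible to 'cV[R]_d. *)
Notation borel_cV R d := (g_sigma_algebraType (@open 'cV[R]_d)).

Section Probability.
Context {R : realType}.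

Definition same_law d1 d2 d' (T1 : measurableType d1) (T2 : measurableType d2)
    (U : measurableType d') (P1 : probability T1 R) (P2 : probability T2 R)
    (X : T1 -> U) (Y : T2 -> U) : Prop :=
  forall B : set U, measurable B -> P1 (X @^-1` B) = P2 (Y @^-1` B).

Definition independent2 d' d1 d2 (T : measurableType d')
    (U1 : measurableType d1) (U2 : measurableType d2) (P : probability T R)
    (X : T -> U1) (Y : T -> U2) : Prop :=
  forall (A : set U1) (B : set U2), measurable A -> measurable B ->
    P (X @^-1` A `&` Y @^-1` B) = (P (X @^-1` A) * P (Y @^-1` B))%E.

Definition mutually_independent d1 d2 (T : measurableType d1)
    (U : measurableType d2) (P : probability T R) (n : nat)
    (X : 'I_n -> T -> U) : Prop :=
  forall (J : {set 'I_n}) (B : 'I_n -> set U),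
    (forall i, measurable (B i)) ->
    P (\big[setI/setT]_(i in J) (X i @^-1` B i)) =
    (\prod_(i in J) P (X i @^-1` B i))%E.

(* The uniform distribution on the unit sphere is the rotation-invariant
   probability measure carried by the sphere. *)
Definition uniform_sphere d1 (T : measurableType d1) (P : probability T R)
    (d : nat) (V : T -> borel_cV R d) : Prop :=
  P (V @^-1` [set v : 'cV[R]_d | norm2 v = 1]) = 1%E /\
  forall Q : 'M[R]_d, Q^T *m Q = 1%:M ->
    same_law P P V (fun w => Q *m (V w : 'cV[R]_d) : borel_cV R d).

(* X ~ E(S, u). Only the law of u matters, and the probability space carrying u
   need not carry an independent uniform direction, so V and a copy of u are
   taken on some auxiliary space. *)
Definition elliptical d1 d2 (T : measurableType d1) (P : probability T R)
    (T0 : measurableType d2) (P0 : probability T0 R) (u : {RV P0 >-> R})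
    (d : nat) (S : 'M[R]_d) (X : {RV P >-> borel_cV R d}) : Prop :=
  exists (d3 : measure_display) (T1 : measurableType d3)
    (P1 : probability T1 R) (V : {RV P1 >-> borel_cV R d})
    (u1 : {RV P1 >-> R}),
  [/\ uniform_sphere P1 V, same_law P1 P0 u1 u, independent2 P1 u1 V &
      same_law P P1 X
        (fun w => u1 w *: (sqrtmx S *m (V w : 'cV[R]_d)) : borel_cV R d)].

End Probability.

Section Tyler.
Context {R : realType}.

(* If some x j = 0, the quotient 0 / 0 is undefined on paper and is 0 here;
   neither way is there a solution: multiplying the equation by S^-1 and taking
   traces gives #{j | x j != 0} = n for every solution S. *)
Definition tyler_solution n d (x : 'I_n -> 'cV[R]_d) (S : 'M[R]_d) : Prop :=
  [/\ posdefmx S,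
      (d%:R / n%:R) *: \sum_(j < n)
        (((x j)^T *m invmx S *m x j) 0 0)^-1 *: (x j *m (x j)^T) = S
    & \tr S = d%:R].

(* Tyler's M-estimator for x is well-defined and equal to S. *)
Definition tyler_estimator n d (x : 'I_n -> 'cV[R]_d) (S : 'M[R]_d) : Prop :=
  unique (tyler_solution x) S.

End Tyler.

(* Main.v *)
Require Import Defs.
From mathcomp Require Import all_boot all_order all_algebra.
From mathcomp Require Import all_classical all_reals all_analysis.
From mathcomp Require Import measurable_realfun ring lra.

(* The equation is whitened by [Sigma^(1/2)], which replaces the samples by
   independent uniform directions [v_j].  Write
   [F Y = (d / n) sum_j v_j v_j^T / (v_j^T Y^-1 v_j)], so that a solution is a
   fixed point of [F].  Two properties of the sample suffice:
   - isotropy: [F 1] is within [delta = O(eps)] of [1] in operator norm;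
   - spread: for unit [p, q], the averages of [(v_j, p)^2] and [(v_j, q)^2] share
     a constant part, [(d / n) sum_j min ((v_j, p)^2, (v_j, q)^2) >= c0].
   If [m Y <= F Y <= M Y] then [F (F Y)] is compared with [F Y] through averages of
   numbers in [[m, M]], whose weights depend on the test vector [p] but overlap by
   the spread property, so [M - m] shrinks by a constant factor (Doeblin).  Starting
   from [1], where [M - m <= 2 delta], the iterates of [F] therefore converge
   geometrically to a fixed point within [O(delta)] of [1].  Uniqueness is a
   maximum principle: two solutions touch along a vector [u], which forces every
   [v_j] not orthogonal to [u] into a proper subspace, against the spread property.
   Only quadratic forms at two vectors are involved, so that both properties follow
   from Bernstein-type bounds and a union bound over a net of [exp (O(d))] points,
   without logarithmic loss.  Their moments are computed from rotation invariance
   alone. *)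

Set Implicit Arguments.
Unset Strict Implicit.
Unset Printing Implicit Defensive.

Import Order.TTheory GRing.Theory Num.Theory.
Import numFieldTopology.Exports numFieldNormedType.Exports.

Local Open Scope classical_set_scope.
Local Open Scope ring_scope.

(** * Quadratic forms *)

Section InnerProduct.
Context {R : realType} {d : nat}.
Implicit Types (u v w : 'cV[R]_d) (A B : 'M[R]_d).

(** On positive definite matrices [F] preserves order and is homogeneous of degree one. Fixed points
    therefore come in rays and no norm is strictly contracted; what contracts is the range of the
    ratio between [F Y] and [Y]. Drift along the rays is excluded by the identity
    [tr (Y^-1 F Y) = d], which forces [m <= 1 <= M]: an increment is then bounded by [M - m], and
    the increments are summable. The trace constraint is restored only at the end, by a rescaling
    that costs another [O(delta)]. The constant [c0] is absolute, so the spread property fails with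
    probability exponentially small in [n]. Only isotropy depends on [eps]: its exponent [eps^2 n]
    has to beat the [O(d)] of the net, whence [n >= C d / eps^2]. The minimum in the spread property
    is reached through the product of [psi x = x / (1 + x)] at the two arguments, which is bounded,
    stable under moving the test vectors, and below both arguments. No integral over the sphere is
    computed: a mixed moment comes from polarisation and an exponential moment from averaging over
    sign vectors. *)

Definition dot u v : R := \sum_i u i 0 * v i 0.
Definition qf A v : R := dot v (A *m v).

Lemma dotE u v : (u^T *m v) 0 0 = dot u v.
Proof. by rewrite mxE; apply: eq_bigr => i _; rewrite mxE. Qed.

Lemma qfE A v : (v^T *m A *m v) 0 0 = qf A v.
Proof. by rewrite -mulmxA dotE. Qed.

Lemma dotC u v : dot u v = dot v u.
Proof. by apply: eq_bigr => i _; rewrite mulrC. Qed.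

Lemma dotDl u v w : dot (u + v) w = dot u w + dot v w.
Proof. by rewrite -big_split; apply: eq_bigr => i _; rewrite mxE mulrDl. Qed.

Lemma dotDr u v w : dot w (u + v) = dot w u + dot w v.
Proof. by rewrite !(dotC w) dotDl. Qed.

Lemma dotZl (t : R) u v : dot (t *: u) v = t * dot u v.
Proof. by rewrite mulr_sumr; apply: eq_bigr => i _; rewrite mxE mulrA. Qed.

Lemma dotZr (t : R) u v : dot u (t *: v) = t * dot u v.
Proof. by rewrite dotC dotZl dotC. Qed.

Lemma dotNl u v : dot (- u) v = - dot u v.
Proof. by rewrite -scaleN1r dotZl mulN1r. Qed.

Lemma dotNr u v : dot u (- v) = - dot u v.
Proof. by rewrite dotC dotNl dotC. Qed.

Lemma dotBl u v w : dot (u - v) w = dot u w - dot v w.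
Proof. by rewrite dotDl dotNl. Qed.

Lemma dotBr u v w : dot w (u - v) = dot w u - dot w v.
Proof. by rewrite dotDr dotNr. Qed.

Lemma dot0l v : dot 0 v = 0.
Proof. by rewrite -(scale0r 0) dotZl mul0r. Qed.

Lemma dot0r v : dot v 0 = 0.
Proof. by rewrite dotC dot0l. Qed.

Lemma dot_suml (I : Type) (r : seq I) (P : pred I) (F : I -> 'cV[R]_d) v :
  dot (\sum_(i <- r | P i) F i) v = \sum_(i <- r | P i) dot (F i) v.
Proof.
elim/big_rec2: _ => [|i x y _ <-]; first by rewrite dot0l.
by rewrite dotDl.
Qed.

Lemma dot_sumr (I : Type) (r : seq I) (P : pred I) (F : I -> 'cV[R]_d) v :
  dot v (\sum_(i <- r | P i) F i) = \sum_(i <- r | P i) dot v (F i).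
Proof. by rewrite dotC dot_suml; apply: eq_bigr => i _; rewrite dotC. Qed.

Lemma dot_ge0 v : 0 <= dot v v.
Proof. by apply: sumr_ge0 => i _; rewrite -expr2 sqr_ge0. Qed.

Lemma dot_eq0 v : (dot v v == 0) = (v == 0).
Proof.
apply/eqP/eqP => [/eqP|->]; last exact: dot0l.
rewrite psumr_eq0 => [|i _]; last by rewrite -expr2 sqr_ge0.
move=> /allP v0; apply/matrixP => i j; rewrite !mxE (ord1 j).
by have := v0 i (mem_index_enum _); rewrite /= -expr2 sqrf_eq0 => /eqP.
Qed.

Lemma dot_gt0 v : (0 < dot v v) = (v != 0).
Proof. by rewrite lt_neqAle dot_ge0 andbT eq_sym dot_eq0. Qed.

Lemma dot_mulmxl A u v : dot (A *m u) v = dot u (A^T *m v).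
Proof. by rewrite -!dotE trmx_mul mulmxA. Qed.

Lemma dot_delta v i : dot v (delta_mx i 0) = v i 0.
Proof.
rewrite /dot (bigD1 i)//= mxE !eqxx mulr1 big1 ?addr0// => j /negPf ji.
by rewrite mxE ji mulr0.
Qed.

Lemma norm2E v : norm2 v = Num.sqrt (dot v v).
Proof. by congr Num.sqrt; apply: eq_bigr => i _; rewrite expr2. Qed.

Lemma sqr_norm2 v : norm2 v ^+ 2 = dot v v.
Proof. by rewrite norm2E sqr_sqrtr// dot_ge0. Qed.

Lemma norm2_le1 v : (norm2 v <= 1) = (dot v v <= 1).
Proof. by rewrite norm2E -[1]sqrtr1 ler_sqrt// sqrtr1. Qed.

Lemma norm2_eq1 v : (norm2 v = 1) <-> (dot v v = 1).
Proof.
rewrite -sqr_norm2; split=> [->|/eqP]; first by rewrite expr1n.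
by rewrite sqrp_eq1 ?norm2E ?sqrtr_ge0// => /eqP.
Qed.

Lemma qfD A B v : qf (A + B) v = qf A v + qf B v.
Proof. by rewrite /qf mulmxDl dotDr. Qed.

Lemma qfN A v : qf (- A) v = - qf A v.
Proof. by rewrite /qf mulNmx dotNr. Qed.

Lemma qfB A B v : qf (A - B) v = qf A v - qf B v.
Proof. by rewrite qfD qfN. Qed.

Lemma qfZ (t : R) A v : qf (t *: A) v = t * qf A v.
Proof. by rewrite /qf -scalemxAl dotZr. Qed.

Lemma qf1 v : qf 1%:M v = dot v v.
Proof. by rewrite /qf mul1mx. Qed.

Lemma qfZv (t : R) A v : qf A (t *: v) = t ^+ 2 * qf A v.
Proof. by rewrite /qf -scalemxAr dotZl dotZr mulrA expr2. Qed.

Lemma qfNv A v : qf A (- v) = qf A v.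
Proof. by rewrite /qf mulmxN dotNl dotNr opprK. Qed.

Lemma qf0 A : qf A 0 = 0.
Proof. by rewrite /qf dot0l. Qed.

Lemma qf_sum (I : Type) (r : seq I) (P : pred I) (F : I -> 'M[R]_d) v :
  qf (\sum_(i <- r | P i) F i) v = \sum_(i <- r | P i) qf (F i) v.
Proof. by rewrite /qf mulmx_suml dot_sumr. Qed.

Lemma mul_outer (x : 'cV[R]_d) v : x *m x^T *m v = dot x v *: x.
Proof.
apply/matrixP => i j; rewrite -mulmxA !mxE big_ord1 (ord1 j) dotE.
by rewrite mulrC.
Qed.

Lemma qf_outer (x : 'cV[R]_d) v : qf (x *m x^T) v = dot x v ^+ 2.
Proof. by rewrite /qf mul_outer dotZr dotC expr2. Qed.

Lemma qf_conj A B v : qf (B^T *m A *m B) v = qf A (B *m v).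
Proof. by rewrite /qf dot_mulmxl !mulmxA. Qed.

Lemma dot_sym A u v : A^T = A -> dot u (A *m v) = dot v (A *m u).
Proof. by move=> As; rewrite dotC dot_mulmxl As. Qed.

Lemma qf_add A u v : A^T = A ->
  qf A (u + v) = qf A u + 2 * dot u (A *m v) + qf A v.
Proof.
move=> As; rewrite /qf !mulmxDr !(dotDl, dotDr) (dot_sym v u As); ring.
Qed.

Lemma qf_inj A B : A^T = A -> B^T = B -> (forall v, qf A v = qf B v) -> A = B.
Proof.
move=> As Bs AB.
have AB' u v : dot u (A *m v) = dot u (B *m v).
  by have := AB (u + v); rewrite !qf_add// !AB; lra.
apply/matrixP => i j.
have := AB' (delta_mx i 0) (delta_mx j 0).
by rewrite ![dot (delta_mx i 0) _]dotC !dot_delta -!colE !mxE.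
Qed.

(** If [z = A *m u] were nonzero, a small move from [u] along [- z] would lower the form at first
    order, below 0. *)
Lemma psd_ker A u : A^T = A -> (forall v, 0 <= qf A v) -> qf A u = 0 ->
  A *m u = 0.
Proof.
move=> As A0 Au; apply/eqP; rewrite -dot_eq0; apply/negP => /negP z0.
set z := A *m u in z0 *.
have zz : 0 < dot z z by rewrite dot_gt0 -dot_eq0.
(* The minimising step would divide by [qf A z], which may vanish; with the added 1 the denominator
   is positive and the value still negative. *)
set t := - (dot z z / (qf A z + 1)).
have qz := A0 z.
have := A0 (u + t *: z); rewrite qf_add// Au add0r qfZv -scalemxAr dotZr.
rewrite (dot_sym u z As) -/z.
have -> : 2 * (t * dot z z) + t ^+ 2 * qf A z =
   - (dot z z ^+ 2 * (qf A z + 2)) / (qf A z + 1) ^+ 2.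
  by rewrite /t; field; clear -qz; lra.
rewrite leNgt => /negP; apply; rewrite mulNr oppr_lt0.
by rewrite divr_gt0// ?mulr_gt0// ?exprn_gt0//; clear -qz; lra.
Qed.

Lemma posdefmxP A : posdefmx A <-> A^T = A /\ (forall v, v != 0 -> 0 < qf A v).
Proof.
by split=> -[As A0]; split=> // v v0; have := A0 v v0; rewrite qfE.
Qed.

Lemma possemidefmxP A : possemidefmx A <-> A^T = A /\ (forall v, 0 <= qf A v).
Proof. by split=> -[As A0]; split=> // v; have := A0 v; rewrite qfE. Qed.

Lemma pd_unitmx A : posdefmx A -> A \in unitmx.
Proof.
move=> /posdefmxP[As A0]; rewrite -row_free_unit; apply: inj_row_free => v vA.
apply/eqP/negP => /negP v0.
have v0' : v^T != 0.
  by apply: contra_neq v0 => v0; rewrite -[v]trmxK v0 trmx0.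
have := A0 _ v0'; rewrite /qf -{1}As -trmx_mul vA trmx0 dot0r.
by rewrite ltxx.
Qed.

Lemma trmx_invmx_sym A : A^T = A -> (invmx A)^T = invmx A.
Proof. by move=> As; rewrite trmx_inv As. Qed.

Lemma qf_invmx A v : A^T = A -> A \in unitmx ->
  qf (invmx A) v = qf A (invmx A *m v).
Proof.
move=> As uA; rewrite /qf mulKVmx// dot_mulmxl.
by rewrite trmx_invmx_sym.
Qed.

Lemma invmx_pd A : posdefmx A -> posdefmx (invmx A).
Proof.
move=> pA; have uA := pd_unitmx pA; move/posdefmxP: pA => [As A0].
apply/posdefmxP; split; first exact: trmx_invmx_sym.
move=> v v0; rewrite qf_invmx//; apply: A0.
by apply: contra_neq v0 => v0; rewrite -[v](mulKVmx uA) v0 mulmx0.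
Qed.

Lemma qf_pd_ge0 A v : posdefmx A -> 0 <= qf A v.
Proof.
move=> /posdefmxP[_ A0]; have [->|v0] := eqVneq v 0; first by rewrite qf0.
exact/ltW/A0.
Qed.

(* The quadratic form of [invmx A] is the Legendre transform of that of [A]. *)
Lemma qf_inv_variational A v x : posdefmx A ->
  2 * dot v x - qf A x <= qf (invmx A) v.
Proof.
move=> pA; have uA := pd_unitmx pA; have A0 := fun v => qf_pd_ge0 v pA.
case: pA => As _.
set y := invmx A *m v; have Ay : A *m y = v by rewrite /y mulKVmx.
have -> : qf (invmx A) v = dot v y by [].
have := A0 (x - y); rewrite qf_add// mulmxN Ay qfNv {2}/qf Ay.
by rewrite dotNr (dotC x) (dotC y) => h; clear - h; lra.
Qed.

(** The Legendre bound for [A] is tested at [invmx B *m v], the point where the one for [B] is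
    attained. *)
Lemma qf_inv_anti A B : posdefmx A -> posdefmx B ->
  (forall v, qf A v <= qf B v) ->
  forall v, qf (invmx B) v <= qf (invmx A) v.
Proof.
move=> pA pB AB v; have uB := pd_unitmx pB.
have := qf_inv_variational v (invmx B *m v) pA.
have := AB (invmx B *m v).
by rewrite -(qf_invmx v (proj1 pB) uB) -/(qf _ _); lra.
Qed.

Lemma invmxZ_pd (t : R) A : t != 0 -> A \in unitmx ->
  invmx (t *: A) = t^-1 *: invmx A.
Proof. by move=> t0 uA; rewrite invmxZ// unitmxZ// unitfE. Qed.

Lemma pdZ (t : R) A : 0 < t -> posdefmx A -> posdefmx (t *: A).
Proof.
move=> t0 /posdefmxP[As A0]; apply/posdefmxP; split; first by rewrite linearZ/= As.
by move=> v v0; rewrite qfZ mulr_gt0// A0.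
Qed.

Lemma qf_invZ_anti (t : R) A B : 0 < t -> posdefmx A -> posdefmx B ->
  (forall v, t * qf A v <= qf B v) ->
  forall v, t * qf (invmx B) v <= qf (invmx A) v.
Proof.
move=> t0 pA pB AB v.
have := qf_inv_anti (pdZ t0 pA) pB.
move=> /(_ (fun v => ltac:(by rewrite qfZ; exact: AB)) v).
rewrite invmxZ_pd ?gt_eqF ?pd_unitmx// qfZ => h.
by rewrite -ler_pdivlMl.
Qed.

End InnerProduct.

(** * Rayleigh quotients and square roots *)

Section Spectral.
Context {R : realType}.

(** Reflection in the hyperplane orthogonal to [u - w]. It serves twice: to split off an eigenvector
    in the square root, and to carry a test vector to another of the same norm under rotation
    invariance. *)
Lemma householder d (u w : 'cV[R]_d) : dot u u = dot w w ->
  exists Q : 'M[R]_d, [/\ Q^T = Q, Q *m Q = 1%:M & Q *m u = w].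
Proof.
move=> uw; have [->|uNw] := eqVneq u w.
  by exists 1%:M; rewrite trmx1 !mul1mx.
set z := u - w; have z0 : z != 0 by rewrite subr_eq0.
have zz : dot z z != 0 by rewrite dot_eq0.
have zu : dot z z = 2 * dot z u.
  by rewrite /z !(dotBl, dotBr) -uw (dotC w u) (dotC u w); ring.
exists (1%:M - (2 / dot z z) *: (z *m z^T)); split.
- by rewrite linearB/= linearZ/= trmx_mul trmxK trmx1.
- rewrite mulmxBl mul1mx mulmxBr mulmx1 -scalemxAl -scalemxAr.
  rewrite mulmxA mul_outer -scalemxAl scalerA.
  set W := z *m z^T; set s := 2 / dot z z.
  have -> : s *: (s * dot z z *: W) = (2 * s) *: W.
    by rewrite scalerA; congr (_ *: _); rewrite /s; field.
  by apply/matrixP => i j; rewrite !mxE; ring.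
- rewrite mulmxBl mul1mx -scalemxAl mul_outer scalerA.
  rewrite (_ : _ / _ * _ = 1); last by rewrite mulrAC -zu divff.
  by rewrite scale1r /z opprB addrC subrK.
Qed.

Lemma continuous_qf d (A : 'M[R]_d) : continuous (fun v : 'rV[R]_d => qf A v^T).
Proof.
move=> v; rewrite /qf /dot.
have -> : (fun v : 'rV[R]_d => \sum_i v^T i 0 * (A *m v^T) i 0) =
    (fun v => \sum_i v 0 i * \sum_j A i j * v 0 j).
  apply/funext => w; apply: eq_bigr => i _; rewrite !mxE; congr (_ * _).
  by apply: eq_bigr => j _; rewrite !mxE.
apply: (@continuous_big _ _ +%R 0 xpredT add_continuous) => i _ {v}v.
apply: continuousM; first exact: coord_continuous.
apply: (@continuous_big _ _ +%R 0 xpredT add_continuous) => j _ {v}v.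
by apply: continuousM; [exact: cst_continuous|exact: coord_continuous].
Qed.

(** The quotient is continuous on the compact unit sphere. That the maximum is attained matters: the
    maximisers are the touching vector of uniqueness and the test vectors of the contraction. *)
Lemma rayleigh d (A B : 'M[R]_d) : (0 < d)%N -> posdefmx B ->
  exists (u : 'cV[R]_d) lam, [/\ u != 0, forall v, qf A v <= lam * qf B v &
                qf A u = lam * qf B u].
Proof.
move=> d0 pB; have /posdefmxP[_ B0] := pB.
pose S := [set v : 'rV[R]_d | dot v^T v^T = 1].
have Sne : S !=set0.
  exists (delta_mx 0 (Ordinal d0)); rewrite /S/= trmx_delta dot_delta.
  by rewrite mxE !eqxx.
have Sc : compact S.
  apply: bounded_closed_compact.
    exists 1; split=> // M M1 v Sv.
    rewrite /Num.norm/= mx_normrE.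
    apply: (le_trans _ (ltW M1)); apply: bigmax_le => // -[i j] _ /=.
    rewrite (ord1 i) -(@expr_le1 _ 2)// real_normK ?num_real//.
    rewrite -[X in _ <= X]Sv /dot (bigD1 j)//= !mxE -expr2 lerDl.
    by apply: sumr_ge0 => k _; rewrite -expr2 sqr_ge0.
  have -> : S = (fun v : 'rV[R]_d => qf 1%:M v^T) @^-1` [set 1].
    by apply/seteqP; split=> v /=; rewrite /S/= qf1.
  by have /continuous_closedP := @continuous_qf d 1%:M; apply; exact: closed_eq.
have Snz v : S v -> v^T != 0.
  by move=> Sv; rewrite -dot_eq0 Sv oner_eq0.
have := @compact_EVT_max _ _ (fun v : 'rV[R]_d => qf A v^T / qf B v^T) S Sne Sc.
case.
  apply: continuous_in_subspaceT => v; rewrite inE => Sv.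
  apply: (@continuousM _ _ (fun v : 'rV[R]_d => qf A v^T)
    (fun v : 'rV[R]_d => (qf B v^T)^-1)); first exact: continuous_qf.
  apply: (@continuousV _ _ (fun v : 'rV[R]_d => qf B v^T)).
    by rewrite gt_eqF ?B0// Snz.
  exact: continuous_qf.
move=> c; rewrite inE => Sc' cmax.
exists c^T, (qf A c^T / qf B c^T); split; first exact: Snz.
- move=> v; have [->|v0] := eqVneq v 0; first by rewrite !qf0 mulr0.
  have vv : 0 < dot v v by rewrite dot_gt0.
  pose w := (Num.sqrt (dot v v))^-1 *: v.
  have s2 : (Num.sqrt (dot v v))^-1 ^+ 2 = (dot v v)^-1.
    by rewrite exprVn sqr_sqrtr ?ltW.
  have Sw : S w^T.
    by rewrite /S/= trmxK /w dotZl dotZr mulrA -expr2 s2 mulVf ?gt_eqF.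
  have := cmax w^T; rewrite inE => /(_ Sw); rewrite trmxK /w !qfZv s2.
  rewrite invfM invrK mulrACA mulVf ?gt_eqF// mul1r.
  by rewrite ler_pdivrMr// B0.
- by rewrite divfK// gt_eqF// B0// Snz.
Qed.

(** [lam *: B - A] is positive semidefinite and its form vanishes at the maximiser, so [psd_ker]
    gives the eigenvector equation without differentiating the quotient. *)
Lemma rayleigh_eigen d (A B : 'M[R]_d) : (0 < d)%N -> A^T = A -> posdefmx B ->
  exists (u : 'cV[R]_d) lam, [/\ u != 0, forall v, qf A v <= lam * qf B v &
                A *m u = lam *: (B *m u)].
Proof.
move=> d0 As pB; have [u [lam [u0 le ue]]] := rayleigh A d0 pB.
exists u, lam; split=> //.
have : (lam *: B - A) *m u = 0.
  apply: psd_ker => [|v|].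
  - by rewrite linearB/= linearZ/= As (proj1 pB).
  - by rewrite qfB qfZ subr_ge0.
  - by rewrite qfB qfZ ue subrr.
by rewrite mulmxBl -scalemxAl => /eqP; rewrite subr_eq0 => /eqP.
Qed.

(** Induction on the dimension: a reflection moves a unit eigenvector to the first basis vector,
    symmetry makes the conjugated matrix block diagonal, and the remaining block is again
    semidefinite. *)
Lemma psd_sqrt_exists d (A : 'M[R]_d) : possemidefmx A ->
  exists H, possemidefmx H /\ H *m H = A.
Proof.
elim: d A => [|d IH] A pA.
  by exists A; split=> //; rewrite [RHS]flatmx0 flatmx0.
have /possemidefmxP[As A0] := pA.
have p1 : posdefmx (1%:M : 'M[R]_d.+1).
  by apply/posdefmxP; split; [rewrite trmx1|move=> v; rewrite qf1 dot_gt0].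
have [u' [lam [u'0 _ Au']]] := rayleigh_eigen (ltn0Sn d) As p1.
rewrite mul1mx in Au'.
have uu' : 0 < dot u' u' by rewrite dot_gt0.
pose u := (Num.sqrt (dot u' u'))^-1 *: u'.
have uu : dot u u = 1.
  by rewrite /u dotZl dotZr mulrA -expr2 exprVn sqr_sqrtr ?ltW// mulVf ?gt_eqF.
have Au : A *m u = lam *: u by rewrite /u -scalemxAr Au' !scalerA mulrC.
pose e : 'cV[R]_(1 + d) := col_mx 1%:M 0.
have ee : dot e e = 1.
  by rewrite -dotE /e tr_col_mx mul_row_col trmx1 mul1mx trmx0 mul0mx addr0 mxE.
have [Q [Qs QQ Qu]] := @householder (1 + d) u e (etrans uu (esym ee)).
have Qe : Q *m e = u by rewrite -Qu mulmxA QQ mul1mx.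
pose A' : 'M[R]_(1 + d) := Q *m A *m Q.
have A's : A'^T = A' by rewrite /A' !trmx_mul As Qs mulmxA.
have A'0 v : 0 <= qf A' v by rewrite /A' -{1}Qs qf_conj.
have A'e : A' *m e = lam *: e by rewrite /A' -!mulmxA Qe Au -scalemxAr Qu.
have lam0 : 0 <= lam.
  by have := A0 u; rewrite /qf Au dotZr uu mulr1.
pose D := drsubmx A'.
have A'E : A' = block_mx lam%:M 0 0 D.
  have := A'e; rewrite -[in A' *m e](submxK A') /e mul_block_col !mulmx0 !addr0.
  rewrite !mulmx1 scale_col_mx scaler0 => /eq_col_mx[ul dl].
  have ur : ursubmx A' = 0 by rewrite -[LHS]trmxK trmx_ursub A's dl trmx0.
  rewrite -[LHS](submxK A') ul dl ur; congr block_mx.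
  by rewrite scalemx1.
have qD v : qf D v = qf A' (col_mx 0 v).
  rewrite A'E /qf mul_block_col !mulmx0 !mul0mx !add0r -!dotE tr_col_mx.
  by rewrite mul_row_col mulmx0 add0r.
have pD : possemidefmx D.
  apply/possemidefmxP; split; last by move=> v; rewrite qD A'0.
  by rewrite /D trmx_drsub A's.
have [K [/possemidefmxP[Ks K0] KK]] := IH D pD.
pose H' : 'M[R]_(1 + d) := block_mx (Num.sqrt lam)%:M 0 0 K.
have H'H' : H' *m H' = A'.
  rewrite /H' mulmx_block !mulmx0 !mul0mx !addr0 !add0r KK A'E.
  by rewrite -scalar_mxM -expr2 sqr_sqrtr.
have H's : H'^T = H' by rewrite /H' tr_block_mx !trmx0 tr_scalar_mx Ks.
have H'0 v : 0 <= qf H' v.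
  rewrite -[v]vsubmxK /H' /qf mul_block_col !mul0mx addr0 add0r -!dotE.
  rewrite tr_col_mx mul_row_col mxE addr_ge0//.
    by rewrite dotE mul_scalar_mx dotZr mulr_ge0 ?sqrtr_ge0 ?dot_ge0.
  by rewrite dotE K0.
exists (Q *m H' *m Q); split.
  apply/possemidefmxP; split; first by rewrite !trmx_mul H's Qs mulmxA.
  by move=> v; rewrite -{1}Qs qf_conj.
have -> : Q *m H' *m Q *m (Q *m H' *m Q) = Q *m (H' *m (Q *m Q) *m H') *m Q.
  by rewrite !mulmxA.
by rewrite QQ mulmx1 H'H' /A' !mulmxA QQ mul1mx -mulmxA QQ mulmx1.
Qed.

End Spectral.

(** * The fixed-point map of Tyler's estimator *)

Section TylerMap.
Context {R : realType} {d n : nat}.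
Implicit Types (x v : 'I_n -> 'cV[R]_d) (Y : 'M[R]_d).

Definition tyler_map v Y : 'M[R]_d :=
  (d%:R / n%:R) *: \sum_(j < n)
    (qf (invmx Y) (v j))^-1 *: (v j *m (v j)^T).

Lemma tyler_solutionE x (S : 'M[R]_d) :
  tyler_solution x S <-> [/\ posdefmx S, tyler_map x S = S & \tr S = d%:R].
Proof.
have E : tyler_map x S = (d%:R / n%:R) *: \sum_(j < n)
        (((x j)^T *m invmx S *m x j) 0 0)^-1 *: (x j *m (x j)^T).
  by congr (_ *: _); apply: eq_bigr => j _; rewrite qfE.
by rewrite /tyler_solution -E.
Qed.

Lemma qf_tyler_map v Y p : qf (tyler_map v Y) p =
  d%:R / n%:R * \sum_(j < n) (qf (invmx Y) (v j))^-1 * dot (v j) p ^+ 2.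
Proof.
rewrite qfZ qf_sum; congr (_ * _); apply: eq_bigr => j _.
by rewrite qfZ qf_outer.
Qed.

Lemma tyler_map_sym v Y : (tyler_map v Y)^T = tyler_map v Y.
Proof.
rewrite linearZ/= linear_sum/=; congr (_ *: _); apply: eq_bigr => j _.
by rewrite linearZ/= trmx_mul trmxK.
Qed.

Lemma ratio_ge0 : 0 <= d%:R / n%:R :> R.
Proof. by rewrite divr_ge0. Qed.

(** Matrix inversion reverses the order and the reciprocal of the form reverses it back. The factor
    [t] includes homogeneity, so that comparisons up to constants pass to the images. *)
Lemma tyler_map_anti (t : R) v Y Y' : 0 < t -> posdefmx Y -> posdefmx Y' ->
  (forall p, t * qf Y p <= qf Y' p) ->
  forall p, t * qf (tyler_map v Y) p <= qf (tyler_map v Y') p.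
Proof.
move=> t0 pY pY' YY' p; rewrite !qf_tyler_map mulrCA ler_wpM2l ?ratio_ge0//.
rewrite mulr_sumr; apply: ler_sum => j _; rewrite mulrA ler_wpM2r ?sqr_ge0//.
(* For a zero vector both reciprocals are [0^-1 = 0]. *)
have [->|vj0] := eqVneq (v j) 0; first by rewrite !qf0 invr0 mulr0.
have s0 : 0 < qf (invmx Y) (v j) by have /posdefmxP[_] := invmx_pd pY; exact.
have s'0 : 0 < qf (invmx Y') (v j) by have /posdefmxP[_] := invmx_pd pY'; exact.
have := qf_invZ_anti t0 pY pY' YY' (v j).
by move=> h; rewrite ler_pdivrMr// ler_pdivlMl// mulrC.
Qed.

Lemma tyler_solution_unique x S1 S2 : (0 < d)%N ->
  (forall p q, p != 0 -> q != 0 ->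
    exists j, dot (x j) p != 0 /\ dot (x j) q != 0) ->
  tyler_solution x S1 -> tyler_solution x S2 -> S1 = S2.
Proof.
move=> d0 xspan /tyler_solutionE[p1 F1 t1] /tyler_solutionE[p2 F2 t2].
have [u [lam [u0 le eq]]] := rayleigh_eigen d0 (proj1 p2) p1.
have qu : qf S2 u = lam * qf S1 u by rewrite /qf eq dotZr.
have S1u : 0 < qf S1 u by case/posdefmxP: p1 => _; exact.
have S2u : 0 < qf S2 u by case/posdefmxP: p2 => _; exact.
have lam0 : 0 < lam by move: S2u; rewrite qu pmulr_lgt0.
have anti p : qf (invmx S1) p <= lam * qf (invmx S2) p.
  rewrite -ler_pdivrMl//.
  apply: qf_invZ_anti => // [|w]; first by rewrite invr_gt0.
  by rewrite ler_pdivrMl.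
pose N := lam *: invmx S2 - invmx S1.
have Ns : N^T = N.
  by rewrite linearB/= linearZ/= !trmx_invmx_sym ?(proj1 p1) ?(proj1 p2).
have N0 p : 0 <= qf N p by rewrite qfB qfZ subr_ge0.
(* Comparing the two fixed-point equations at [u] leaves a vanishing sum of nonnegative terms. A
   term with [dot (x j) u != 0] makes the form of [N] vanish at [x j], hence [N *m x j = 0]. *)
have touch j : dot (x j) u != 0 -> N *m x j = 0.
  move=> xju; apply: psd_ker => //.
  have inv_le i : 0 <= (lam * (qf (invmx S1) (x i))^-1 -
                        (qf (invmx S2) (x i))^-1) * dot (x i) u ^+ 2.
    rewrite mulr_ge0 ?sqr_ge0// subr_ge0.
    have [->|xi0] := eqVneq (x i) 0; first by rewrite !qf0 invr0 mulr0.
    have s0 : 0 < qf (invmx S1) (x i) by have /posdefmxP[_] := invmx_pd p1; exact.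
    have s'0 : 0 < qf (invmx S2) (x i) by have /posdefmxP[_] := invmx_pd p2; exact.
    by rewrite ler_pdivlMr// mulrC ler_pdivrMr.
  have sum0 : \sum_i (lam * (qf (invmx S1) (x i))^-1 -
        (qf (invmx S2) (x i))^-1) * dot (x i) u ^+ 2 = 0.
    have n0 : (0 < n)%N by exact: leq_ltn_trans (ltn_ord j).
    have dn0 : (d%:R / n%:R : R) != 0.
      by rewrite mulf_neq0// ?invr_neq0// pnatr_eq0 -lt0n.
    apply: (mulfI dn0); rewrite mulr0.
    under eq_bigr do rewrite mulrBl -mulrA.
    rewrite sumrB -mulr_sumr mulrBr mulrCA -!qf_tyler_map F1 F2 qu.
    exact: subrr.
  have /eqP : (lam * (qf (invmx S1) (x j))^-1 -
        (qf (invmx S2) (x j))^-1) * dot (x j) u ^+ 2 = 0.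
    exact: (psumr_eq0P (fun i _ => inv_le i) sum0).
  rewrite mulf_eq0 sqrf_eq0 (negPf xju) orbF subr_eq0 => /eqP e.
  rewrite qfB qfZ; apply/eqP; rewrite subr_eq0; apply/eqP.
  have xj0 : x j != 0 by apply: contra_neq xju => ->; rewrite dot0l.
  have s0 : 0 < qf (invmx S1) (x j) by have /posdefmxP[_] := invmx_pd p1; exact.
  have s'0 : 0 < qf (invmx S2) (x j) by have /posdefmxP[_] := invmx_pd p2; exact.
  apply: (@mulIf _ (qf (invmx S1) (x j))^-1); first by rewrite invr_eq0 gt_eqF.
  by rewrite mulrAC e mulVf ?gt_eqF// divff ?gt_eqF.
(* For a nonzero column of [N] some sample is orthogonal neither to it nor to [u], yet [N] kills
   every sample not orthogonal to [u]. *)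
have NE : N = 0.
  apply/eqP; apply: contraPT (erefl true) => NN0 _.
  have [i Ni] : exists i, N *m delta_mx i 0 != 0 :> 'cV_d.
    apply/existsP; move: NN0; apply: contra_neqT; rewrite negb_exists.
    move=> /forallP h; apply/matrixP => i j.
    have := h j; rewrite negbK -colE => /eqP/matrixP/(_ i 0).
    by rewrite !mxE.
  have [j [ju]] := xspan _ _ u0 Ni.
  by rewrite -{1}Ns -dot_mulmxl touch// dot0l eqxx.
have E : S2 = lam *: S1.
  have u1 := pd_unitmx p1; have u2 := pd_unitmx p2.
  move/eqP: NE; rewrite subr_eq0 => /eqP h.
  by rewrite -[LHS]mulmx1 -(mulVmx u1) -h -scalemxAl -scalemxAr mulmxA mulmxV ?mul1mx.
move: t2; rewrite E linearZ/= t1 -[RHS]mul1r => /mulIf.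
by rewrite pnatr_eq0 -lt0n => /(_ d0) ->; rewrite scale1r.
Qed.

Lemma mxtrace_psd (Z N : 'M[R]_d) : possemidefmx Z -> (forall p, 0 <= qf N p) ->
  0 <= \tr (Z *m N).
Proof.
move=> pZ N0; have [H [/possemidefmxP[Hs _] <-]] := psd_sqrt_exists pZ.
rewrite -mulmxA mxtrace_mulC; apply: sumr_ge0 => i _.
have := N0 (H *m delta_mx i 0).
by rewrite -qf_conj Hs /qf dotC dot_delta -colE mxE.
Qed.

(** Each sample contributes the trace of a rank-one matrix normalised to 1. The identity fixes the
    scale: the ratio of the forms of [tyler_map v Y] and [Y] can be neither always above nor always
    below 1. *)
Lemma mxtrace_inv_tyler_map v Y : (0 < n)%N -> posdefmx Y ->
  (forall j, v j != 0) -> \tr (invmx Y *m tyler_map v Y) = d%:R.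
Proof.
move=> n0 pY v0; rewrite -scalemxAr linearZ/= mulmx_sumr linear_sum/=.
rewrite (eq_bigr (fun=> 1)) => [|j _].
  by rewrite sumr_const card_ord -mulrA mulVf ?mulr1// pnatr_eq0 -lt0n.
rewrite -scalemxAr linearZ/= mulmxA mxtrace_mulC mulmxA trace_mx11 qfE mulVf//.
by rewrite gt_eqF//; have /posdefmxP[_] := invmx_pd pY; exact.
Qed.

Lemma pd_psd Y : posdefmx Y -> possemidefmx Y.
Proof.
by move=> pY; apply/possemidefmxP; split=> [|p]; [case: pY|exact: qf_pd_ge0].
Qed.

Lemma tyler_map_lower v Y (m : R) : (0 < n)%N -> (0 < d)%N -> posdefmx Y ->
  (forall j, v j != 0) -> (forall p, m * qf Y p <= qf (tyler_map v Y) p) ->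
  m <= 1.
Proof.
move=> n0 d0 pY v0 h.
have := @mxtrace_psd (invmx Y) (tyler_map v Y - m *: Y) (pd_psd (invmx_pd pY)).
move=> /(_ (fun p => ltac:(by rewrite qfB qfZ subr_ge0))).
rewrite mulmxBr linearB/= mxtrace_inv_tyler_map// -scalemxAr linearZ/=.
rewrite mulVmx ?pd_unitmx// mxtrace1 -{1}[d%:R]mul1r -mulrBl pmulr_lge0 ?ltr0n//.
by rewrite subr_ge0.
Qed.

Lemma tyler_map_upper v Y (M : R) : (0 < n)%N -> (0 < d)%N -> posdefmx Y ->
  (forall j, v j != 0) -> (forall p, qf (tyler_map v Y) p <= M * qf Y p) ->
  1 <= M.
Proof.
move=> n0 d0 pY v0 h.
have := @mxtrace_psd (invmx Y) (M *: Y - tyler_map v Y) (pd_psd (invmx_pd pY)).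
move=> /(_ (fun p => ltac:(by rewrite qfB qfZ subr_ge0))).
rewrite mulmxBr linearB/= mxtrace_inv_tyler_map// -scalemxAr linearZ/=.
rewrite mulVmx ?pd_unitmx// mxtrace1 -{2}[d%:R]mul1r -mulrBl pmulr_lge0 ?ltr0n//.
by rewrite subr_ge0.
Qed.

End TylerMap.

(** * Contraction of the fixed-point map *)

Section Contraction.
Context {R : realType}.

Lemma cvg_of_geometric_increments (u : R^nat) (C t : R) : 0 <= t -> t < 1 ->
  (forall k, `|u k.+1 - u k| <= C * t ^+ k) -> cvgn u.
Proof.
move=> t0 t1 h.
have : cvgn (series (telescope u)).
  apply: normed_cvg; apply: (@series_le_cvg _ _ (geometric C t)).
  - by move=> k; exact: normr_ge0.
  - by move=> k /=; exact: le_trans (h k).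
  - by move=> k /=; exact: h.
  - by apply: is_cvg_geometric_series; rewrite ger0_norm.
rewrite telescopeK => cv.
have -> : u = (fun k => (u k - u 0%N) + u 0%N).
  by apply/funext => k; rewrite subrK.
by apply: is_cvgD => //; exact: is_cvg_cst.
Qed.

(** Polarisation: the entry is a quarter of the difference of the forms at [e + f] and [e - f],
    which the parallelogram law bounds by [4 * b]. *)
Lemma entry_bound d (N : 'M[R]_d) (b : R) : N^T = N ->
  (forall p, `|qf N p| <= b * dot p p) -> forall i j, `|N i j| <= b.
Proof.
move=> Ns h i j.
have dd k : dot (delta_mx k 0 : 'cV[R]_d) (delta_mx k 0) = 1.
  by rewrite dot_delta mxE !eqxx.
have -> : N i j = dot (delta_mx i 0) (N *m delta_mx j 0).
  by rewrite dotC dot_delta -colE mxE.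
set e := delta_mx i 0; set f := delta_mx j 0.
have := h (e - f); have := h (e + f).
rewrite !qf_add// ?qfNv mulmxN dotNr !(dotDl, dotDr, dotNl, dotNr) !dd.
rewrite (dotC f e) !ler_norml => /andP[h1 h2] /andP[h3 h4].
apply/andP; clear -h1 h2 h3 h4; split; lra.
Qed.

(** The common part [\sum_i w i * r i] cancels in the difference; only the remaining mass, at most
    [1 - k] on each side, sees the gap between [m] and [M]. *)
Lemma doeblin (I : finType) (a b w r : I -> R) (m M k : R) :
  (forall i, 0 <= w i) -> (forall i, w i <= a i) -> (forall i, w i <= b i) ->
  \sum_i a i = 1 -> \sum_i b i = 1 -> k <= \sum_i w i ->
  (forall i, m <= r i) -> (forall i, r i <= M) -> m <= M ->
  \sum_i a i * r i - \sum_i b i * r i <= (1 - k) * (M - m).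
Proof.
move=> w0 wa wb a1 b1 kw mr rM mM.
have ha : \sum_i a i * r i <= \sum_i w i * r i + (1 - \sum_i w i) * M.
  rewrite -a1 -sumrB mulr_suml -big_split/=; apply: ler_sum => i _.
  rewrite -lerBlDl -mulrBl ler_wpM2l// subr_ge0//.
have hb : \sum_i w i * r i + (1 - \sum_i w i) * m <= \sum_i b i * r i.
  rewrite -b1 -sumrB mulr_suml -big_split/=; apply: ler_sum => i _.
  rewrite -lerBrDl -mulrBl ler_wpM2l// subr_ge0//.
apply: (@le_trans _ _ ((1 - \sum_i w i) * (M - m))); first by clear -ha hb; lra.
by rewrite ler_wpM2r ?subr_ge0// lerD2l lerN2.
Qed.

Context {d n : nat}.
Variable v : 'I_n -> 'cV[R]_d.
Variables (delta c0 : R).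
Hypotheses (d_gt0 : (0 < d)%N) (n_gt0 : (0 < n)%N).
Hypothesis v_unit : forall j, dot (v j) (v j) = 1.
Hypotheses (delta_gt0 : 0 < delta) (delta_le1 : delta <= 1).
Hypotheses (c0_gt0 : 0 < c0) (c0_le1 : c0 <= 1).
Hypothesis isotropy : forall p,
  `|d%:R / n%:R * \sum_j dot (v j) p ^+ 2 - dot p p| <= delta * dot p p.
Hypothesis spread : forall p q, c0 * (dot p p * dot q q) <=
  d%:R / n%:R * \sum_j Num.min (dot (v j) p ^+ 2 * dot q q)
                               (dot (v j) q ^+ 2 * dot p p).

Lemma v_neq0 j : v j != 0.
Proof. by rewrite -dot_eq0 v_unit oner_eq0. Qed.

Lemma pd_1 : posdefmx (1%:M : 'M[R]_d).
Proof.
by apply/posdefmxP; split; [rewrite trmx1|move=> p; rewrite qf1 dot_gt0].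
Qed.

Lemma inv_bounds (Y : 'M[R]_d) : posdefmx Y ->
  (forall p, dot p p / 2 <= qf Y p) -> (forall p, qf Y p <= 2 * dot p p) ->
  forall p, dot p p / 2 <= qf (invmx Y) p /\ qf (invmx Y) p <= 2 * dot p p.
Proof.
move=> pY lo up p; split.
  have h := @qf_invZ_anti _ _ 2^-1 Y 1%:M (ltac:(by rewrite invr_gt0)) pY pd_1.
  have {h} := h (fun w => ltac:(by rewrite qf1 ler_pdivrMl// up)) p.
  by rewrite invmx1 qf1 mulrC.
have h := @qf_invZ_anti _ _ 2^-1 1%:M Y (ltac:(by rewrite invr_gt0)) pd_1 pY.
have {h} := h (fun w => ltac:(by rewrite qf1 mulrC lo)) p.
by rewrite invmx1 qf1 ler_pdivrMl.
Qed.

Lemma tyler_map_pd (Y : 'M[R]_d) : posdefmx Y -> posdefmx (tyler_map v Y).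
Proof.
move=> pY; apply/posdefmxP; split=> [|p p0]; first exact: tyler_map_sym.
have pp : 0 < dot p p by rewrite dot_gt0.
have [j jp] : exists j, dot (v j) p != 0.
  apply/existsP; apply: contraT; rewrite negb_exists => /forallP h.
  have := spread p p; rewrite big1 => [|j _]; last first.
    by have := h j; rewrite negbK => /eqP->; rewrite expr0n mul0r minxx.
  by rewrite mulr0 leNgt !mulr_gt0.
rewrite qf_tyler_map mulr_gt0 ?divr_gt0 ?ltr0n//.
have s0 i : 0 < qf (invmx Y) (v i).
  by have /posdefmxP[_] := invmx_pd pY; apply; exact: v_neq0.
rewrite (bigD1 j)//= ltr_pwDl//.
  by rewrite mulr_gt0 ?invr_gt0// lt_neqAle sqr_ge0 eq_sym sqrf_eq0 jp.
by apply: sumr_ge0 => i _; rewrite mulr_ge0 ?sqr_ge0 ?invr_ge0 ?ltW.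
Qed.

(** The ratio of the forms of [tyler_map v Y'] and [Y'] at [p] is the average of the [r j] with
    weights [a p j], and [r j] lies in [[m, M]] by comparing inverses. The extreme ratios are
    attained at [u] and [w], whose weights overlap by the spread property. *)
Lemma tyler_map_contract (Y : 'M[R]_d) (m M : R) : posdefmx Y ->
  (forall p, dot p p / 2 <= qf Y p) -> (forall p, qf Y p <= 2 * dot p p) ->
  0 < m -> m <= M ->
  (forall p, m * qf Y p <= qf (tyler_map v Y) p) ->
  (forall p, qf (tyler_map v Y) p <= M * qf Y p) ->
  let Y' := tyler_map v Y in
  exists m' M', [/\ m <= m', M' - m' <= (1 - c0 / 8) * (M - m),
    forall p, m' * qf Y' p <= qf (tyler_map v Y') p &
    forall p, qf (tyler_map v Y') p <= M' * qf Y' p].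
Proof.
move=> pY Ylo Yup m0 mM lo up Y'.
have pY' : posdefmx Y' by exact: tyler_map_pd.
have M0 : 0 < M by exact: lt_le_trans mM.
have [u [M' [u0 leM' eM']]] := rayleigh (tyler_map v Y') d_gt0 pY'.
(* The smallest ratio is minus the largest one of the opposite matrix; hence the witness [- m']
   below. *)
have [w [m' [w0 lem' em']]] := rayleigh (- tyler_map v Y') d_gt0 pY'.
have Y'0 p : p != 0 -> 0 < qf Y' p by case/posdefmxP: pY' => _; exact.
pose s j := qf (invmx Y) (v j); pose s' j := qf (invmx Y') (v j).
have s0 j : 0 < s j.
  by have /posdefmxP[_] := invmx_pd pY; apply; exact: v_neq0.
have s'0 j : 0 < s' j.
  by have /posdefmxP[_] := invmx_pd pY'; apply; exact: v_neq0.
have sb j : 2^-1 <= s j <= 2.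
  have [] := inv_bounds pY Ylo Yup (v j).
  by rewrite v_unit mul1r mulr1 => -> ->.
pose r j := s j / s' j.
have rlo j : m <= r j.
  rewrite ler_pdivlMr//; exact: (qf_invZ_anti m0 pY pY' lo).
have rup j : r j <= M.
  rewrite ler_pdivrMr// -ler_pdivrMl//.
  apply: (@qf_invZ_anti _ _ M^-1) => // [|p]; first by rewrite invr_gt0.
  by rewrite ler_pdivrMl// up.
pose a p j := d%:R / n%:R * ((s j)^-1 * dot (v j) p ^+ 2) / qf Y' p.
have a1 p : p != 0 -> \sum_j a p j = 1.
  move=> p0; rewrite -mulr_suml -mulr_sumr -qf_tyler_map divff//.
  by rewrite gt_eqF// Y'0.
have ar p : p != 0 -> \sum_j a p j * r j = qf (tyler_map v Y') p / qf Y' p.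
  move=> p0; rewrite qf_tyler_map mulr_sumr mulr_suml; apply: eq_bigr => j _.
  rewrite /a /r -/(s' j); field.
  by rewrite !gt_eqF ?s0 ?s'0 ?Y'0 ?ltr0n.
(* One factor 2 comes from [(s j)^-1 <= 2], the other from isotropy with [delta <= 1]. Together with
   [s j <= 2] this 4 makes the 8 of the contraction rate. *)
have Y'up p : qf Y' p <= 4 * dot p p.
  rewrite qf_tyler_map; have := isotropy p; rewrite ler_distl => /andP[_ iso].
  apply: (@le_trans _ _ (2 * (d%:R / n%:R * \sum_j dot (v j) p ^+ 2))).
    rewrite mulrCA ler_wpM2l ?ratio_ge0// mulr_sumr; apply: ler_sum => j _.
    rewrite ler_wpM2r ?sqr_ge0// -[leRHS]invrK lef_pV2 ?posrE ?invr_gt0 ?s0//.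
    by case/andP: (sb j).
  have := dot_ge0 p; move: iso delta_le1.
  set X := _ / _ * _; set D := dot p p => h1 h2 h3.
  have h4 : delta * D <= D by rewrite ler_piMl.
  by lra.
have alo p j : p != 0 -> d%:R / n%:R * dot (v j) p ^+ 2 / (8 * dot p p) <= a p j.
  move=> p0; have pp : 0 < dot p p by rewrite dot_gt0.
  have sj := s0 j; have qp := Y'0 p p0.
  rewrite /a [leRHS](_ : _ =
    d%:R / n%:R * dot (v j) p ^+ 2 * ((s j)^-1 * (qf Y' p)^-1)); last by ring.
  apply: ler_wpM2l; first by apply: mulr_ge0; [exact: ratio_ge0|exact: sqr_ge0].
  rewrite -invfM lef_pV2 ?posrE ?mulr_gt0//.
  rewrite (_ : 8 * dot p p = 2 * (4 * dot p p)); last by ring.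
  by apply: ler_pM => //; [exact: ltW|exact: ltW|case/andP: (sb j)].
pose o j := Num.min (a u j) (a w j).
have a0 p j : p != 0 -> 0 <= a p j.
  move=> p0; have sj := s0 j; have qp := Y'0 p p0.
  rewrite /a; apply: mulr_ge0; last by rewrite invr_ge0 ltW.
  apply: mulr_ge0; first exact: ratio_ge0.
  by rewrite mulr_ge0 ?sqr_ge0// invr_ge0 ltW.
have ko : c0 / 8 <= \sum_j o j.
  have uu : 0 < dot u u by rewrite dot_gt0.
  have ww : 0 < dot w w by rewrite dot_gt0.
  have c : 0 < 8 * (dot u u * dot w w) by rewrite !mulr_gt0.
  apply: (@le_trans _ _ ((d%:R / n%:R * \sum_j Num.min (dot (v j) u ^+ 2 * dot w w)
      (dot (v j) w ^+ 2 * dot u u)) / (8 * (dot u u * dot w w)))).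
    rewrite ler_pdivlMr//; apply: le_trans (spread u w).
    by rewrite (_ : c0 / 8 * _ = c0 * (dot u u * dot w w))//; field.
  rewrite mulr_sumr mulr_suml; apply: ler_sum => j _.
  rewrite le_min; apply/andP; split.
    apply: le_trans (alo u j u0).
    rewrite ler_pdivrMr// (_ : _ * (8 * _) =
      d%:R / n%:R * (dot (v j) u ^+ 2 * dot w w)); last first.
      by field; rewrite !gt_eqF ?ltr0n.
    by rewrite ler_wpM2l ?ratio_ge0// ge_min lexx.
  apply: le_trans (alo w j w0).
  rewrite ler_pdivrMr// (_ : _ * (8 * _) =
    d%:R / n%:R * (dot (v j) w ^+ 2 * dot u u)); last first.
    by field; rewrite !gt_eqF ?ltr0n.
  by rewrite ler_wpM2l ?ratio_ge0// ge_min lexx orbT.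
exists (- m'), M'; split.
- have -> : - m' = \sum_j a w j * r j.
    rewrite ar//; apply: (@mulIf _ (qf Y' w)); first by rewrite gt_eqF// Y'0.
    by rewrite divfK ?gt_eqF ?Y'0// mulNr -em' qfN opprK.
  rewrite -[leLHS]mul1r -(a1 w w0) mulr_suml; apply: ler_sum => j _.
  by rewrite ler_wpM2l// a0.
- have -> : - m' = \sum_j a w j * r j.
    rewrite ar//; apply: (@mulIf _ (qf Y' w)); first by rewrite gt_eqF// Y'0.
    by rewrite divfK ?gt_eqF ?Y'0// mulNr -em' qfN opprK.
  have -> : M' = \sum_j a u j * r j.
    rewrite ar//; apply: (@mulIf _ (qf Y' u)); first by rewrite gt_eqF// Y'0.
    by rewrite divfK ?gt_eqF ?Y'0// -eM'.
  apply: (@doeblin _ _ _ o) => //; rewrite ?a1// => j.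
  - by rewrite le_min !a0.
  - by rewrite ge_min lexx.
  - by rewrite ge_min lexx orbT.
- by move=> p; have := lem' p; rewrite qfN mulNr lerNl.
- exact: leM'.
Qed.

(** * Convergence of the iterates *)

Hypothesis small : 64 * delta <= c0.
Let t := 1 - c0 / 8.
(** The sum over [k] of the increments [4 * delta * t ^+ k]. The hypothesis [small] says
    [e <= 1 / 2], which keeps the iterates between half and twice the identity, where the
    contraction rate is uniform. *)
Let e := 32 * delta / c0.
Let Y k := iter k (tyler_map v) (1%:M : 'M[R]_d).

Lemma rate_bounds : 0 <= t /\ t < 1.
Proof. by have h1 := c0_gt0; have h2 := c0_le1; rewrite /t; split; lra. Qed.

Lemma e_geometric : e * (1 - t) = 4 * delta.
Proof. by rewrite /e /t; field; rewrite gt_eqF. Qed.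

Lemma error_bounds : 0 < e /\ e <= 1 / 2.
Proof.
split; first by rewrite /e divr_gt0// mulr_gt0.
by rewrite /e ler_pdivrMr//; have h := small; lra.
Qed.

Lemma iterate_pd k : posdefmx (Y k).
Proof. by elim: k => [|k IH]; [exact: pd_1|exact: tyler_map_pd]. Qed.

Lemma half_twice_bounds (D q g : R) : 0 <= D -> `|q - D| <= g * D -> g <= 1 / 2 ->
  D / 2 <= q /\ q <= 2 * D.
Proof.
move=> D0 h g1; have gD : g * D <= 1 / 2 * D by rewrite ler_wpM2r.
by move: h; rewrite ler_distl => /andP[h1 h2]; split; lra.
Qed.

(** As 1 lies in [[m, M]], both [M - 1] and [1 - m] are at most [M - m]; the factor 2 is that of
    [y <= 2 * D]. *)
Lemma drift (y y' m M D g : R) : 0 <= D -> D / 2 <= y -> y <= 2 * D ->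
  m <= 1 -> 1 <= M -> m * y <= y' -> y' <= M * y -> M - m <= g ->
  `|y' - y| <= 2 * g * D.
Proof.
move=> D0 lo up m1 M1 h1 h2 h3; have y0 : 0 <= y by lra.
have mM : m <= M by exact: le_trans M1.
have h6 : (M - m) * y <= g * (2 * D).
  by apply: ler_pM => //; rewrite subr_ge0.
have h7 : (M - 1) * y <= (M - m) * y by rewrite ler_wpM2r; lra.
have h8 : (1 - m) * y <= (M - m) * y by rewrite ler_wpM2r; lra.
rewrite ler_distl; apply/andP; split; lra.
Qed.

(** The two statements feed each other: closeness to the identity permits the contraction step, and
    the ratio bounds control the increment that closeness must absorb. *)
Lemma iterate_bounds k :
  (forall p, `|qf (Y k) p - dot p p| <= e * (1 - t ^+ k) * dot p p) /\
  exists m M, [/\ 0 < m, m <= 1, 1 <= M, M - m <= 2 * delta * t ^+ k &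
    (forall p, m * qf (Y k) p <= qf (Y k.+1) p) /\
    (forall p, qf (Y k.+1) p <= M * qf (Y k) p)].
Proof.
have [t0 t1] := rate_bounds; have [e0 e1] := error_bounds.
have tk j : e * (1 - t ^+ j) <= 1 / 2.
  apply: le_trans e1; apply: ler_piMr; first exact: ltW.
  by rewrite gerBl exprn_ge0.
elim: k => [|k [close [m [M [m0 m1 M1 Mm [lo up]]]]]].
  split=> [p|]; first by rewrite qf1 subrr normr0 expr0 subrr mulr0 mul0r.
  have iso p : (1 - delta) * dot p p <= qf (tyler_map v 1%:M) p /\
               qf (tyler_map v 1%:M) p <= (1 + delta) * dot p p.
    rewrite qf_tyler_map (eq_bigr (fun j => dot (v j) p ^+ 2)) => [|j _]; last first.
      by rewrite invmx1 qf1 v_unit invr1 mul1r.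
    have := isotropy p; rewrite ler_distl => /andP[].
    set D := dot p p => h1 h2; split; lra.
  have h1 := small; have h2 := c0_le1; have h3 := delta_gt0.
  exists (1 - delta), (1 + delta); split; rewrite ?expr0; try lra.
  by split=> p; rewrite qf1; have [] := iso p.
have pY := iterate_pd k.
have Ylo p : dot p p / 2 <= qf (Y k) p.
  by have [] := half_twice_bounds (dot_ge0 p) (close p) (tk k).
have Yup p : qf (Y k) p <= 2 * dot p p.
  by have [] := half_twice_bounds (dot_ge0 p) (close p) (tk k).
have mM : m <= M by exact: le_trans M1.
split=> [p|].
  have inc : `|qf (Y k.+1) p - qf (Y k) p| <= 4 * delta * t ^+ k * dot p p.
    have := drift (dot_ge0 p) (Ylo p) (Yup p) m1 M1 (lo p) (up p) Mm.
    by rewrite (_ : 2 * (2 * delta * t ^+ k) = 4 * delta * t ^+ k)//; ring.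
  have -> : e * (1 - t ^+ k.+1) * dot p p =
      4 * delta * t ^+ k * dot p p + e * (1 - t ^+ k) * dot p p.
    by rewrite -e_geometric exprS; ring.
  by rewrite -(subrK (qf (Y k) p) (qf (Y k.+1) p)) -addrA (le_trans (ler_normD _ _))// lerD.
have [m' [M' [mm' MM' lo' up']]] := tyler_map_contract pY Ylo Yup m0 mM lo up.
have pY' := iterate_pd k.+1.
have m'1 := tyler_map_lower n_gt0 d_gt0 pY' v_neq0 lo'.
have M'1 := tyler_map_upper n_gt0 d_gt0 pY' v_neq0 up'.
exists m', M'; split=> //; first exact: lt_le_trans mm'.
apply: le_trans MM' _; rewrite exprS mulrCA ler_wpM2l//.
Qed.

Lemma iterate_half_twice k p : dot p p / 2 <= qf (Y k) p /\ qf (Y k) p <= 2 * dot p p.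
Proof.
have [t0 t1] := rate_bounds; have [e0 e1] := error_bounds.
apply: (half_twice_bounds (dot_ge0 p) ((iterate_bounds k).1 p)).
apply: le_trans e1; apply: ler_piMr; first exact: ltW.
by rewrite gerBl exprn_ge0.
Qed.

Lemma iterate_increment k p : `|qf (Y k.+1 - Y k) p| <= 4 * delta * t ^+ k * dot p p.
Proof.
have [close [m [M [m0 m1 M1 Mm [lo up]]]]] := iterate_bounds k.
have [Ylo Yup] := iterate_half_twice k p; rewrite qfB.
have := drift (dot_ge0 p) Ylo Yup m1 M1 (lo p) (up p) Mm.
by rewrite (_ : 2 * (2 * delta * t ^+ k) = 4 * delta * t ^+ k)//; ring.
Qed.

Lemma cvg_entries i j : cvgn (fun k => Y k i j).
Proof.
have [t0 t1] := rate_bounds.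
apply: (@cvg_of_geometric_increments (fun k => Y k i j) (4 * delta) t) => // k.
have -> : Y k.+1 i j - Y k i j = (Y k.+1 - Y k) i j by rewrite !mxE.
apply: entry_bound => [|p]; last exact: iterate_increment.
by rewrite linearB/= (proj1 (iterate_pd k)) (proj1 (iterate_pd k.+1)).
Qed.

Let Yl : 'M[R]_d := \matrix_(i, j) limn (fun k => Y k i j).

Lemma limit_sym : Yl^T = Yl.
Proof.
apply/matrixP => i j; rewrite !mxE; congr (limn _); apply/funext => k.
by rewrite -[in LHS](proj1 (iterate_pd k)) mxE.
Qed.

Lemma cvg_qf p : (fun k => qf (Y k) p) @ \oo --> qf Yl p.
Proof.
have E A : qf A p = \sum_i p i 0 * \sum_j A i j * p j 0.
  by apply: eq_bigr => i _; rewrite mxE.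
rewrite E (_ : (fun k => _) = fun k => \sum_i p i 0 * \sum_j Y k i j * p j 0).
  apply: (@cvg_big _ _ +%R 0 xpredT add_continuous) => i _.
  apply: cvgM; first exact: cvg_cst.
  apply: (@cvg_big _ _ +%R 0 xpredT add_continuous) => j _.
  apply: cvgM; last exact: cvg_cst.
  by rewrite mxE; exact: cvg_entries.
by apply/funext => k; exact: E.
Qed.

Lemma iterate_dist k l p :
  `|qf (Y (l + k)) p - qf (Y k) p| <= e * (t ^+ k - t ^+ (l + k)) * dot p p.
Proof.
elim: l => [|l IH]; first by rewrite !subrr normr0 mulr0 mul0r.
have -> : e * (t ^+ k - t ^+ (l.+1 + k)) * dot p p =
   4 * delta * t ^+ (l + k) * dot p p +
   e * (t ^+ k - t ^+ (l + k)) * dot p p.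
  by rewrite -e_geometric addSn exprS; ring.
rewrite -(subrK (qf (Y (l + k)) p) (qf (Y (l.+1 + k)) p)) -addrA.
apply: le_trans (ler_normD _ _) (lerD _ IH).
by rewrite -qfB; exact: iterate_increment.
Qed.

Lemma limit_dist k p : `|qf Yl p - qf (Y k) p| <= e * t ^+ k * dot p p.
Proof.
have [t0 t1] := rate_bounds; have [e0 e1] := error_bounds.
have cv : (fun l => `|qf (Y l) p - qf (Y k) p|) @ \oo -->
    `|qf Yl p - qf (Y k) p|.
  by apply: cvg_norm; apply: cvgB; [exact: cvg_qf|exact: cvg_cst].
rewrite -(cvg_lim _ cv)//; apply: limr_le; first by apply/cvg_ex; eexists; exact: cv.
exists k => // l /= kl; rewrite -(subnK kl).
apply: le_trans (iterate_dist k (l - k) p) _.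
rewrite ler_wpM2r ?dot_ge0// ler_wpM2l ?(ltW e0)// gerBl.
exact: exprn_ge0.
Qed.

Lemma limit_close p : `|qf Yl p - dot p p| <= e * dot p p.
Proof. by have := limit_dist 0 p; rewrite qf1 expr0 mulr1. Qed.

Lemma limit_pd : posdefmx Yl.
Proof.
apply/posdefmxP; split=> [|p p0]; first exact: limit_sym.
have [_ e1] := error_bounds; have pp : 0 < dot p p by rewrite dot_gt0.
have [h _] := half_twice_bounds (dot_ge0 p) (limit_close p) e1.
by apply: lt_le_trans h; rewrite divr_gt0.
Qed.

(** Continuity of the map at the limit comes from order: [Yl] and [Y k] agree up to the factors
    [1 - 2 * g] and [1 + 2 * g], hence so do their images, and the image of [Y k] is [Y k.+1]. *)
Lemma limit_fixed : tyler_map v Yl = Yl.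
Proof.
have [t0 t1] := rate_bounds; have [e0 e1] := error_bounds.
have pl := limit_pd.
(* Of the 5, 4 comes from comparing the image of [Yl] with [Y k.+1], whose form is at most
   [2 * dot p p], and 1 from the distance between [Y k.+1] and [Yl]. The condition makes [1 - 2 * g]
   positive. *)
have step k p : 2 * (e * t ^+ k) < 1 ->
    `|qf (tyler_map v Yl) p - qf Yl p| <= 5 * e * dot p p * t ^+ k.
  set g := e * t ^+ k => g1.
  have g0 : 0 <= g by rewrite mulr_ge0 ?exprn_ge0// ltW.
  have yk q := (iterate_half_twice k q).1.
  have near q : `|qf Yl q - qf (Y k) q| <= 2 * g * qf (Y k) q.
    apply: le_trans (limit_dist k q) _; rewrite -/g -mulrA mulrCA ler_wpM2l//.
    by have := yk q; lra.
  have lo : forall q, (1 - 2 * g) * qf (Y k) q <= qf Yl q.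
    by move=> q; have := near q; rewrite ler_distl => /andP[h _]; lra.
  have up : forall q, (1 + 2 * g)^-1 * qf Yl q <= qf (Y k) q.
    move=> q; have := near q; rewrite ler_distl => /andP[_ h].
    by rewrite ler_pdivrMl; lra.
  have lo' := tyler_map_anti v (ltac:(lra) : 0 < 1 - 2 * g) (iterate_pd k) pl lo p.
  have c0' : 0 < (1 + 2 * g)^-1 by rewrite invr_gt0; lra.
  have := tyler_map_anti v c0' pl (iterate_pd k) up p.
  rewrite ler_pdivrMl; last by lra.
  rewrite -/(Y k.+1) in lo' * => up'.
  have [h1 h2] := iterate_half_twice k.+1 p.
  have h3 : g * qf (Y k.+1) p <= g * (2 * dot p p) by rewrite ler_wpM2l.
  have h4 := limit_dist k.+1 p.
  have h5 : e * t ^+ k.+1 * dot p p <= g * dot p p.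
    by rewrite ler_wpM2r ?dot_ge0// ler_wpM2l ?(ltW e0)// exprS ler_piMl ?exprn_ge0// ltW.
  move: h4; rewrite ler_distl => /andP[h6 h7].
  rewrite (_ : 5 * e * dot p p * t ^+ k = 5 * (g * dot p p)); last by rewrite /g; ring.
  by rewrite ler_distl; apply/andP; split; lra.
apply: qf_inj; [exact: tyler_map_sym|exact: limit_sym|move=> p].
apply/eqP; rewrite -subr_eq0 -normr_le0.
have tn : `|t| < 1 by rewrite ger0_norm.
have cv : (fun k => 5 * e * dot p p * t ^+ k) @ \oo --> (0 : R).
  by have := @cvg_geometric R (5 * e * dot p p) t tn.
rewrite -(cvg_lim _ cv)//; apply: limr_ge; first by apply/cvg_ex; eexists; exact: cv.
have cv2 : (fun k => 2 * e * t ^+ k) @ \oo --> (0 : R).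
  by have := @cvg_geometric R (2 * e) t tn.
have cv3 : \forall k \near \oo, 2 * e * t ^+ k < 1.
  by apply: (cvgr_lt 0 cv2); exact: ltr01.
by apply: filterS cv3 => k h; apply: step; rewrite mulrA.
Qed.

Lemma tyler_fixpoint : exists Y : 'M[R]_d,
  [/\ posdefmx Y, tyler_map v Y = Y &
      forall p, `|qf Y p - dot p p| <= 32 * delta / c0 * dot p p].
Proof.
by exists Yl; split; [exact: limit_pd|exact: limit_fixed|exact: limit_close].
Qed.

End Contraction.

(** * Reduction to the identity shape *)

Section Whitening.
Context {R : realType} {d : nat}.
Implicit Types (A B N S : 'M[R]_d).

Lemma sqrtmxP S : posdefmx S -> possemidefmx (sqrtmx S) /\ sqrtmx S *m sqrtmx S = S.
Proof. by move=> /pd_psd/psd_sqrt_exists h; exact: (xgetPex S h). Qed.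

Lemma invmx_unique A B : A *m B = 1%:M -> invmx A = B.
Proof.
by move=> AB; have [uA _] := mulmx1_unit AB; rewrite -[LHS]mulmx1 -AB mulKmx.
Qed.

(** With [u = N *m p], polarising at [b^-1 *: u + p] and [b^-1 *: u - p] turns the bound on the form
    into [dot u u <= b ^+ 2 * dot p p]. *)
Lemma opnorm_sym_le N (b : R) : 0 < b -> N^T = N ->
  (forall p, `|qf N p| <= b * dot p p) -> opnorm N <= b.
Proof.
move=> b0 Ns h; apply: ge_sup.
  by exists (norm2 (N *m 0)), 0 => //=; rewrite norm2_le1 dot0l.
move=> _ [p /= p1 <-]; rewrite norm2_le1 in p1.
rewrite -(@ler_pXn2r _ 2) ?nnegrE ?(ltW b0)//; last by rewrite norm2E sqrtr_ge0.
rewrite sqr_norm2; set u := N *m p.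
have := h (b^-1 *: u + p); have := h (b^-1 *: u - p).
rewrite !qf_add// qfNv mulmxN -/u dotZl dotNr dotZl.
rewrite !(dotDl, dotDr, dotNl, dotNr, dotZl, dotZr) !ler_norml.
rewrite (dotC p u) => /andP[h1 _] /andP[_ h2].
set X := dot u u in h1 h2 *; set P := dot p p in h1 h2 p1; set C := dot u p in h1 h2.
have h3 : 4 * (b^-1 * X) <= b * (2 * (b^-1 * (b^-1 * X)) + 2 * P) by lra.
have e1 : b * (b^-1 * (b^-1 * X)) = b^-1 * X by rewrite mulVKf ?gt_eqF.
have h4 : b^-1 * X <= b * P by lra.
rewrite ler_pdivrMl// mulrA -expr2 in h4.
apply: le_trans h4 _; apply: ler_piMr => //; exact: sqr_ge0.
Qed.

Variables (n : nat) (S : 'M[R]_d) (x : 'I_n -> 'cV[R]_d).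
Let H := sqrtmx S.
Let y j := (norm2 (invmx H *m x j))^-1 *: (invmx H *m x j).

Lemma tyler_estimator_close (delta c0 : R) :
  (0 < d)%N -> (0 < n)%N -> posdefmx S -> \tr S = d%:R ->
  (forall j, x j != 0) ->
  0 < delta -> c0 <= 1 -> 64 * delta <= c0 ->
  (forall p, `|d%:R / n%:R * \sum_j dot (y j) p ^+ 2 - dot p p| <=
             delta * dot p p) ->
  (forall p q, c0 * (dot p p * dot q q) <=
    d%:R / n%:R * \sum_j Num.min (dot (y j) p ^+ 2 * dot q q)
                                 (dot (y j) q ^+ 2 * dot p p)) ->
  exists2 Shat, tyler_estimator x Shat &
    opnorm (1%:M - H *m invmx Shat *m H) <= 128 * delta / c0.
Proof.
move=> d0 n0 pS trS x0 delta0 c01 small iso spr.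
have [/possemidefmxP[Hs H0] HH] := sqrtmxP pS; rewrite -/H in Hs H0 HH.
have uH : H \in unitmx.
  by have := pd_unitmx pS; rewrite -HH unitmx_mul => /andP[].
have Hx j : invmx H *m x j != 0.
  by apply: contra_neq (x0 j) => h; rewrite -[LHS](mulKVmx uH) h mulmx0.
pose rho j := norm2 (invmx H *m x j).
have rho0 j : 0 < rho j by rewrite /rho norm2E sqrtr_gt0 dot_gt0.
have y1 j : dot (y j) (y j) = 1.
  by rewrite /y dotZl dotZr mulrA -expr2 exprVn sqr_norm2 mulVf// dot_eq0.
(* The radii [rho j] cancel in Tyler's equation, and the radial variable with them. *)
have xE j : x j = rho j *: (H *m y j).
  by rewrite /y -scalemxAr mulKVmx// scalerA divff ?scale1r// gt_eqF.
have c00 : 0 < c0 by apply: lt_le_trans small; rewrite mulr_gt0.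
have [Y [pY FY Yc]] := tyler_fixpoint d0 n0 y1 delta0 (ltac:(lra)) c00 c01 iso spr small.
set eta := 32 * delta / c0 in Yc.
have eta0 : 0 < eta by rewrite divr_gt0// mulr_gt0.
have eta1 : eta <= 1 / 2 by rewrite ler_pdivrMr//; lra.
(* Half of [4 * eta] pays for inverting [Y], half for the trace normalisation; [eta <= 1 / 2] makes
   [invmx Y] at most twice the identity. *)
have etaE : 128 * delta / c0 = 4 * eta by rewrite /eta; field; rewrite gt_eqF.
have uY := pd_unitmx pY.
pose B := H *m Y *m H.
have qB p : qf B p = qf Y (H *m p) by rewrite /B -{1}Hs qf_conj.
have Hn p : p != 0 -> H *m p != 0.
  by move=> p0; apply: contra_neq p0 => h; rewrite -[LHS](mulKmx uH) h mulmx0.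
have pB : posdefmx B.
  apply/posdefmxP; split; first by rewrite /B !trmx_mul Hs (proj1 pY) mulmxA.
  by move=> p p0; rewrite qB; case/posdefmxP: pY => _; apply; exact: Hn.
(* The trace is a sum of values of the form at basis vectors, and at each of them [qf B] is within
   [eta * qf S] of [qf S]. *)
have tB : `|\tr B - d%:R| <= eta * d%:R.
  have trE A : \tr A = \sum_i qf A (delta_mx i 0).
    by apply: eq_bigr => i _; rewrite /qf dotC dot_delta -colE mxE.
  rewrite -trS -HH !trE mulr_sumr -sumrB.
  apply: le_trans (ler_norm_sum _ _ _) _; apply: ler_sum => i _.
  rewrite qB (_ : qf (H *m H) _ = dot (H *m delta_mx i 0) (H *m delta_mx i 0))//.
  by rewrite /qf dot_mulmxl Hs mulmxA.
have dR : 0 < d%:R :> R by rewrite ltr0n.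
move: tB; rewrite ler_distl => /andP[tB1 tB2].
have trB0 : 0 < \tr B.
  have : eta * d%:R <= 1 / 2 * d%:R by rewrite ler_wpM2r// ltW.
  by move=> h; lra.
pose t := d%:R / \tr B.
have t0 : 0 < t by rewrite divr_gt0.
pose Shat := t *: B.
have iB : invmx B = invmx H *m invmx Y *m invmx H.
  by apply: invmx_unique; rewrite /B !mulmxA mulmxK// mulmxK// mulmxV.
have iS : invmx Shat = t^-1 *: (invmx H *m invmx Y *m invmx H).
  by rewrite invmxZ_pd ?gt_eqF ?pd_unitmx// iB.
have iHs : (invmx H)^T = invmx H by exact: trmx_invmx_sym.
have pSh : posdefmx Shat by exact: pdZ.
have qiY j : 0 < qf (invmx Y) (y j).
  by have /posdefmxP[_] := invmx_pd pY; apply; rewrite -dot_eq0 y1 oner_eq0.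
exists Shat.
  have sol : tyler_solution x Shat.
    apply/tyler_solutionE; split=> //; last first.
      by rewrite linearZ/= /t divfK// gt_eqF.
    apply: qf_inj => [||p]; [exact: tyler_map_sym|by case: pSh|].
    have e : qf Y (H *m p) = qf (tyler_map y Y) (H *m p) by rewrite FY.
    rewrite [RHS]qfZ qB e !qf_tyler_map mulrCA; congr (_ * _).
    rewrite mulr_sumr; apply: eq_bigr => j _.
    rewrite iS qfZ -{1}iHs qf_conj xE -scalemxAr mulKmx// qfZv.
    rewrite dotZl dot_mulmxl Hs; field.
    by rewrite !gt_eqF.
  split=> // S' sol'; apply: (tyler_solution_unique d0 _ sol sol') => p q p0 q0.
  have pp : 0 < dot (H *m p) (H *m p) by rewrite dot_gt0 Hn.
  have qq : 0 < dot (H *m q) (H *m q) by rewrite dot_gt0 Hn.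
  have xd j r : dot (x j) r = rho j * dot (y j) (H *m r).
    by rewrite xE dotZl dot_mulmxl Hs.
  have [j /andP[jp jq]] : exists j, (dot (y j) (H *m p) != 0) && (dot (y j) (H *m q) != 0).
    apply/existsP; apply: contraT; rewrite negb_exists => /forallP h.
    have := spr (H *m p) (H *m q).
    have : \sum_j Num.min (dot (y j) (H *m p) ^+ 2 * dot (H *m q) (H *m q))
            (dot (y j) (H *m q) ^+ 2 * dot (H *m p) (H *m p)) <= 0.
      apply: sumr_le0 => j _; have := h j; rewrite negb_and !negbK.
      by case/orP => /eqP->; rewrite expr0n mul0r ge_min lexx ?orbT.
    move=> s0 s1; have := le_trans s1 (mulr_ge0_le0 ratio_ge0 s0).
    by rewrite leNgt !mulr_gt0.
  by exists j; rewrite !xd !mulf_neq0// gt_eqF.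
have -> : H *m invmx Shat *m H = t^-1 *: invmx Y.
  by rewrite iS -scalemxAr -scalemxAl !mulmxA mulmxV// mul1mx mulmxKV.
rewrite etaE; apply: opnorm_sym_le; first by rewrite mulr_gt0.
  by rewrite linearB/= linearZ/= trmx1 trmx_invmx_sym ?(proj1 pY).
move=> p; rewrite qfB qfZ qf1.
have D0 := dot_ge0 p; set D := dot p p in D0 *.
have Ylo q : (1 - eta) * qf 1%:M q <= qf Y q.
  by have := Yc q; rewrite ler_distl qf1 => /andP[h _]; lra.
have Yup q : (1 + eta)^-1 * qf Y q <= qf 1%:M q.
  rewrite ler_pdivrMl; last by lra.
  by have := Yc q; rewrite ler_distl qf1 => /andP[_ h]; lra.
have p1 : posdefmx (1%:M : 'M[R]_d) by exact: pd_1.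
have lo := qf_invZ_anti (ltac:(lra) : 0 < 1 - eta) p1 pY Ylo p.
have up := qf_invZ_anti (ltac:(rewrite invr_gt0; lra) : 0 < (1 + eta)^-1) pY p1 Yup p.
rewrite invmx1 qf1 -/D in lo up.
rewrite ler_pdivrMl in up; last by lra.
set Q := qf _ p in lo up *.
have tV : t^-1 = \tr B / d%:R by rewrite /t invf_div.
have tlo : 1 - eta <= t^-1 by rewrite tV ler_pdivlMr//; lra.
have tup : t^-1 <= 1 + eta by rewrite tV ler_pdivrMr//; lra.
have Q0 : 0 <= Q by rewrite /Q qf_pd_ge0//; exact: invmx_pd.
have h1 : (1 - eta) * Q <= t^-1 * Q by rewrite ler_wpM2r.
have h2 : t^-1 * Q <= (1 + eta) * Q by rewrite ler_wpM2r.
have h3 : eta * Q <= eta * (2 * D).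
  rewrite ler_wpM2l ?(ltW eta0)//.
  have : eta * Q <= 1 / 2 * Q by rewrite ler_wpM2r.
  by lra.
rewrite ler_distl; apply/andP; split; lra.
Qed.

End Whitening.

(** * Bounded measurable functions *)

(** The sum counts the integers from 1 to [k] that do not exceed [z]: it is the integer part of [z],
    written with indicators of upper level sets. *)
Lemma staircase (R : realFieldType) (k : nat) (z : R) : 0 <= z -> z <= k%:R ->
  0 <= z - \sum_(i < k) (i.+1%:R <= z)%R%:R <= 1.
Proof.
elim: k => [|k IH] z0 zk.
  by rewrite big_ord0 subr0 z0 (le_trans zk).
rewrite big_ord_recr/=; have [kz|kz] := leP k%:R z; last first.
  have -> : (k.+1%:R <= z) = false.
    by apply/negbTE; rewrite -ltNge (lt_le_trans kz)// ler_nat.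
  by rewrite addr0; exact: IH z0 (ltW kz).
have -> : \sum_(i < k) (i.+1%:R <= z)%R%:R = k%:R :> R.
  rewrite (eq_bigr (fun=> 1)) => [|i _]; first by rewrite sumr_const card_ord.
  by rewrite (le_trans _ kz)// ler_nat.
rewrite -natr1 in zk *; have [kz1|kz1] := leP (k%:R + 1) z.
  by rewrite (_ : z = k%:R + 1) ?subrr ?lexx ?ler01//; apply/eqP; rewrite eq_le zk.
by rewrite addr0; apply/andP; split; lra.
Qed.

Section BoundedMeasurable.
Context {R : realType} {disp : measure_display} {T : measurableType disp}.
Variable P : probability T R.
Implicit Types f g : T -> R.

(** Boundedness is built in so that integrability follows at once and the class is stable under
    sums, products and exponentials. *)
Definition bmeas f := measurable_fun setT f /\ exists M, forall x, `|f x| <= M.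
Definition Ex f : R := \int[P]_x f x.

Lemma bmeas_integrable f : bmeas f -> P.-integrable setT (EFin \o f).
Proof.
move=> [mf [M fM]]; apply: measurable_bounded_integrable => //.
  exact: fin_num_fun_lty.
exists M; split; rewrite ?num_real// => r Mr x _ /=.
exact: le_trans (fM x) (ltW Mr).
Qed.

Lemma bmeas_cst c : bmeas (fun=> c).
Proof. by split=> //; exists `|c|. Qed.

Lemma bmeasD f g : bmeas f -> bmeas g -> bmeas (fun x => f x + g x).
Proof.
move=> [mf [M fM]] [mg [N gN]]; split; first exact: measurable_funD.
by exists (M + N) => x; rewrite (le_trans (ler_normD _ _))// lerD.
Qed.

Lemma bmeasM f g : bmeas f -> bmeas g -> bmeas (fun x => f x * g x).
Proof.
move=> [mf [M fM]] [mg [N gN]]; split; first exact: measurable_funM.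
by exists (M * N) => x; rewrite normrM ler_pM.
Qed.

Lemma bmeasN f : bmeas f -> bmeas (fun x => - f x).
Proof.
move=> bf; have := bmeasM (bmeas_cst (-1)) bf.
by under eq_fun do rewrite mulN1r.
Qed.

Lemma bmeasB f g : bmeas f -> bmeas g -> bmeas (fun x => f x - g x).
Proof. by move=> bf bg; apply: bmeasD => //; exact: bmeasN. Qed.

Lemma bmeasX f k : bmeas f -> bmeas (fun x => f x ^+ k).
Proof.
move=> bf; elim: k => [|k IH].
  by under eq_fun do rewrite expr0; exact: bmeas_cst.
by under eq_fun do rewrite exprS; exact: bmeasM.
Qed.

Lemma bmeas_sum (I : Type) (r : seq I) (Q : pred I) (F : I -> T -> R) :
  (forall i, bmeas (F i)) -> bmeas (fun x => \sum_(i <- r | Q i) F i x).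
Proof.
move=> bF; elim: r => [|i r IH].
  by under eq_fun do rewrite big_nil; exact: bmeas_cst.
under eq_fun do rewrite big_cons.
by case: (Q i) => //; exact: bmeasD.
Qed.

Lemma bmeas_prod (I : Type) (r : seq I) (Q : pred I) (F : I -> T -> R) :
  (forall i, bmeas (F i)) -> bmeas (fun x => \prod_(i <- r | Q i) F i x).
Proof.
move=> bF; elim: r => [|i r IH].
  by under eq_fun do rewrite big_nil; exact: bmeas_cst.
under eq_fun do rewrite big_cons.
by case: (Q i) => //; exact: bmeasM.
Qed.

Lemma bmeas_exp f : bmeas f -> bmeas (fun x => expR (f x)).
Proof.
move=> [mf [M fM]]; split; first exact: measurableT_comp.
exists (expR M) => x; rewrite ger0_norm ?expR_ge0// ler_expR.
exact: le_trans (ler_norm _) (fM x).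
Qed.

Lemma bmeas_indic (A : set T) : measurable A -> bmeas (\1_A : T -> R).
Proof.
move=> mA; split=> //; exists 1 => x; rewrite indicE.
by case: (_ \in _); rewrite ?normr1 ?normr0.
Qed.

Lemma measurable_ge f c : measurable_fun setT f -> measurable [set x | c <= f x].
Proof.
move=> mf; have := mf measurableT `[c, +oo[%classic (measurable_itv _).
by rewrite setTI; congr measurable; apply/seteqP; split=> x /=; rewrite in_itv/= andbT.
Qed.

Lemma Ex_cst c : Ex (fun=> c) = c.
Proof.
rewrite /Ex Rintegral_cst// -[RHS]mulr1; congr (_ * _).
exact: (congr1 fine (probability_setT P)).
Qed.

Lemma ExD f g : bmeas f -> bmeas g -> Ex (fun x => f x + g x) = Ex f + Ex g.
Proof. by move=> bf bg; rewrite /Ex RintegralD//; exact: bmeas_integrable. Qed.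

Lemma ExZ c f : bmeas f -> Ex (fun x => c * f x) = c * Ex f.
Proof. by move=> bf; rewrite /Ex RintegralZl//; exact: bmeas_integrable. Qed.

Lemma ExN f : bmeas f -> Ex (fun x => - f x) = - Ex f.
Proof.
by move=> bf; under eq_fun do rewrite -mulN1r; rewrite ExZ// mulN1r.
Qed.

Lemma ExB f g : bmeas f -> bmeas g -> Ex (fun x => f x - g x) = Ex f - Ex g.
Proof. by move=> bf bg; rewrite ExD ?ExN//; exact: bmeasN. Qed.

Lemma Ex_sum (I : Type) (r : seq I) (Q : pred I) (F : I -> T -> R) :
  (forall i, bmeas (F i)) ->
  Ex (fun x => \sum_(i <- r | Q i) F i x) = \sum_(i <- r | Q i) Ex (F i).
Proof.
move=> bF; elim: r => [|i r IH].
  by under eq_fun do rewrite big_nil; rewrite Ex_cst big_nil.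
under eq_fun do rewrite big_cons.
rewrite big_cons; case: (Q i) => //; rewrite ExD ?IH//; exact: bmeas_sum.
Qed.

Lemma Ex_le f g : bmeas f -> bmeas g -> (forall x, f x <= g x) -> Ex f <= Ex g.
Proof.
by move=> bf bg fg; apply: le_Rintegral => //; exact: bmeas_integrable.
Qed.

Lemma Ex_ge0 f : (forall x, 0 <= f x) -> 0 <= Ex f.
Proof. by move=> f0; apply: Rintegral_ge0. Qed.

Lemma Ex_indic (A : set T) : measurable A -> Ex \1_A = fine (P A).
Proof.
by move=> mA; rewrite /Ex /Rintegral integral_indic// setIT.
Qed.

Lemma Ex_norm_le f g : bmeas f -> bmeas g -> (forall x, `|f x| <= g x) ->
  `|Ex f| <= Ex g.
Proof.
move=> bf bg fg; rewrite ler_norml -ExN//; apply/andP; split.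
  apply: Ex_le => [||x] //; first exact: bmeasN.
  by have := fg x; rewrite ler_norml => /andP[].
apply: Ex_le => // x; exact: le_trans (ler_norm _) (fg x).
Qed.

Lemma Ex_eq_ae f g (A : set T) : bmeas f -> bmeas g -> measurable A -> P A = 1%E ->
  (forall x, A x -> f x = g x) -> Ex f = Ex g.
Proof.
move=> bf bg mA PA fg.
have PC : fine (P (~` A)) = 0.
  by rewrite probability_setC// PA -EFinB subrr.
have [_ [M fM]] := bmeasB bf bg.
apply/eqP; rewrite -subr_eq0 -ExB// -normr_le0.
have bC : bmeas (fun x => M * (\1_(~` A) x : R)).
  by apply: bmeasM; [exact: bmeas_cst|apply: bmeas_indic; exact: measurableC].
have EC : Ex (fun x => M * (\1_(~` A) x : R)) = 0.
  by rewrite ExZ ?Ex_indic ?PC ?mulr0//; [exact: measurableC|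
     apply: bmeas_indic; exact: measurableC].
have key x : `|f x - g x| <= M * (\1_(~` A) x : R).
  rewrite indicE; have [xA|xA] := boolP (x \in ~` A).
    by rewrite mulr1.
  rewrite mulr0 fg ?subrr ?normr0//.
  by move: xA; rewrite notin_setE /= => /contrapT.
by rewrite -EC; exact: (Ex_norm_le (bmeasB bf bg) bC key).
Qed.

(* Layer cake: reduces expectations to probabilities of upper level sets. *)
Lemma Ex_layers (G f : T -> R) (B M : R) (k : nat) : bmeas G -> bmeas f ->
  (forall x, `|G x| <= B) -> 0 < M -> (0 < k)%N ->
  (forall x, 0 <= f x) -> (forall x, f x <= M) ->
  `|Ex (fun x => G x * f x) - M / k%:R * \sum_(i < k)
     Ex (fun x => G x * \1_[set x | M / k%:R * i.+1%:R <= f x] x)| <=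
  B * (M / k%:R).
Proof.
move=> bG bf GB M0 k0 f0 fM.
have k0' : 0 < k%:R :> R by rewrite ltr0n.
have Mk0 : 0 < M / k%:R by rewrite divr_gt0.
have mf := measurable_ge _ (proj1 bf).
have bI i : bmeas (fun x => G x * \1_[set x | M / k%:R * i.+1%:R <= f x] x).
  by apply: bmeasM => //; exact/bmeas_indic/mf.
have bS : bmeas (fun x => M / k%:R * \sum_(i < k)
    G x * \1_[set x | M / k%:R * i.+1%:R <= f x] x).
  by apply: bmeasM; [exact: bmeas_cst|apply: bmeas_sum => i; exact: bI].
have bF : bmeas (fun x => G x * f x) by exact: bmeasM.
rewrite -Ex_sum// -ExZ; last by apply: bmeas_sum => i; exact: bI.
rewrite -ExB// -[leRHS]Ex_cst; apply: Ex_norm_le => [||x].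
- exact: bmeasB.
- exact: bmeas_cst.
rewrite -mulr_sumr mulrCA -mulrBr normrM; apply: ler_pM => //.
have z0 : 0 <= f x / (M / k%:R) by rewrite divr_ge0// ltW.
have zk : f x / (M / k%:R) <= k%:R by rewrite ler_pdivrMr// mulrC divfK ?gt_eqF.
have := staircase z0 zk.
rewrite (eq_bigr (fun i : 'I_k => \1_[set x | M / k%:R * i.+1%:R <= f x] x)).
  set S := \sum_(_ < _) _ => /andP[h1 h2].
  have -> : f x - M / k%:R * S = M / k%:R * (f x / (M / k%:R) - S).
    by rewrite mulrBr mulrCA mulfV ?mulr1// gt_eqF.
  rewrite ger0_norm; first by apply: ler_piMr => //; exact: ltW.
  by apply: mulr_ge0 => //; exact: ltW.
move=> i _; rewrite indicE; congr (_%:R); congr nat_of_bool.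
by rewrite ler_pdivlMr// mulrC; apply/idP/idP; rewrite inE.
Qed.

Lemma eq0_of_harmonic (a C : R) : (forall k, (0 < k)%N -> `|a| <= C / k%:R) -> a = 0.
Proof.
move=> h; apply/eqP; rewrite -normr_le0; apply/ler_addgt0Pr => e e0.
rewrite add0r; pose k := (Num.truncn (`|C| / e)).+1.
apply: le_trans (h k isT) _; rewrite ler_pdivrMr ?ltr0n//.
apply: le_trans (ler_norm C) _; rewrite mulrC -ler_pdivrMr//.
exact/ltW/truncnS_gt.
Qed.

(** Layer decompositions of both sides agree on each level set, so the two sides differ by
    [O(1 / k)] for every [k]. *)
Lemma Ex_mul_layers (G f : T -> R) (c : R) : bmeas G -> bmeas f ->
  (forall x, 0 <= f x) ->
  (forall t, Ex (fun x => G x * \1_[set x | t <= f x] x) =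
             c * Ex (\1_[set x | t <= f x])) ->
  Ex (fun x => G x * f x) = c * Ex f.
Proof.
move=> bG bf f0 h.
have [_ [B GB]] := bG; have [_ [M0 fM0]] := bf.
pose M := `|M0| + 1.
have M_gt0 : 0 < M by rewrite ltr_wpDl.
have fM x : f x <= M.
  apply: le_trans (ler_norm _) (le_trans (fM0 x) _).
  by apply: le_trans (ler_norm _) _; rewrite lerDl.
apply/eqP; rewrite -subr_eq0; apply/eqP.
apply: (@eq0_of_harmonic _ (B * M + `|c| * M)) => k k0.
have h1 := Ex_layers bG bf GB M_gt0 k0 f0 fM.
have one1 (x : T) : `|1 : R| <= 1 by rewrite normr1.
have h2 := Ex_layers (bmeas_cst 1) bf one1 M_gt0 k0 f0 fM.
pose Z := \sum_(i < k) Ex (\1_[set x | M / k%:R * i.+1%:R <= f x]).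
have e1 : \sum_(i < k) Ex (fun x => G x * \1_[set x | M / k%:R * i.+1%:R <= f x] x)
    = c * Z.
  by rewrite mulr_sumr; apply: eq_bigr => i _; exact: h.
have e2 : \sum_(i < k) Ex (fun x => 1 * \1_[set x | M / k%:R * i.+1%:R <= f x] x)
    = Z.
  by apply: eq_bigr => i _; congr Ex; apply/funext => x; rewrite mul1r.
have e3 : Ex (fun x => 1 * f x) = Ex f.
  by congr Ex; apply/funext => x; rewrite mul1r.
rewrite e1 in h1; rewrite e2 e3 mul1r in h2.
set X := Ex _; set Y := Ex f.
have -> : X - c * Y = (X - M / k%:R * (c * Z)) - c * (Y - M / k%:R * Z) by ring.
apply: le_trans (ler_normB _ _) _; rewrite [leRHS]mulrDl; apply: lerD.
  by rewrite -[leRHS]mulrA.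
by rewrite normrM -[leRHS]mulrA ler_wpM2l.
Qed.

Lemma markov_bmeas f (c : R) : bmeas f -> (forall x, 0 <= f x) -> 0 < c ->
  (P [set x | (c <= f x)%R] <= (Ex f / c)%:E)%E.
Proof.
move=> bf f0 c0; have mA := measurable_ge c (proj1 bf).
rewrite -[leLHS]fineK ?fin_num_measure// lee_fin -Ex_indic//.
rewrite ler_pdivlMr// mulrC -ExZ; last exact: bmeas_indic.
apply: Ex_le => //; first by apply: bmeasM; [exact: bmeas_cst|exact: bmeas_indic].
move=> x; rewrite indicE; have [|_] := boolP (x \in _); last by rewrite mulr0.
by rewrite inE /= mulr1.
Qed.

End BoundedMeasurable.

(** * Products of independent variables *)

Lemma Ex_same_law (R : realType) d1 d2 (T1 : measurableType d1)
    (T2 : measurableType d2) (P1 : probability T1 R) (P2 : probability T2 R)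
    (f : T1 -> R) (g : T2 -> R) :
  bmeas f -> bmeas g -> (forall x, 0 <= f x) -> (forall x, 0 <= g x) ->
  same_law P1 P2 f g -> Ex P1 f = Ex P2 g.
Proof.
move=> bf bg f0 g0 fg.
have [_ [Mf fM]] := bf; have [_ [Mg gM]] := bg.
pose M := `|Mf| + `|Mg| + 1.
have M_gt0 : 0 < M by rewrite ltr_wpDl// addr_ge0.
have fM' x : f x <= M.
  apply: le_trans (ler_norm _) (le_trans (fM x) _).
  by apply: le_trans (ler_norm _) _; rewrite /M -addrA lerDl addr_ge0.
have gM' x : g x <= M.
  apply: le_trans (ler_norm _) (le_trans (gM x) _).
  by apply: le_trans (ler_norm _) _; rewrite /M addrAC lerDr addr_ge0.
apply/eqP; rewrite -subr_eq0; apply/eqP.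
apply: (@eq0_of_harmonic _ _ (M + M)) => k k0.
have one1 (T : Type) (x : T) : `|1 : R| <= 1 by rewrite normr1.
have h1 := Ex_layers P1 (bmeas_cst 1) bf (one1 _) M_gt0 k0 f0 fM'.
have h2 := Ex_layers P2 (bmeas_cst 1) bg (one1 _) M_gt0 k0 g0 gM'.
have Zeq t : Ex P1 (fun x => 1 * \1_[set x | t <= f x] x) =
             Ex P2 (fun x => 1 * \1_[set x | t <= g x] x).
  transitivity (Ex P1 (\1_[set x | t <= f x])).
    by congr Ex; apply/funext => x; rewrite mul1r.
  transitivity (Ex P2 (\1_[set x | t <= g x])); last first.
    by congr Ex; apply/funext => x; rewrite mul1r.
  rewrite !Ex_indic; [|exact/measurable_ge/(proj1 bg)|exact/measurable_ge/(proj1 bf)].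
  have := fg `[t, +oo[%classic (measurable_itv _).
  have e (T : Type) (h : T -> R) : h @^-1` `[t, +oo[ = [set x | t <= h x].
    by apply/seteqP; split=> x /=; rewrite in_itv/= andbT.
  by rewrite !e => ->.
have e1 : Ex P1 (fun x => 1 * f x) = Ex P1 f.
  by congr Ex; apply/funext => x; rewrite mul1r.
have e2 : Ex P2 (fun x => 1 * g x) = Ex P2 g.
  by congr Ex; apply/funext => x; rewrite mul1r.
rewrite e1 mul1r in h1; rewrite e2 mul1r in h2.
rewrite (eq_bigr _ (fun i _ => Zeq _)) in h1.
move: h1 h2; set S := _ * _; move: (Ex P1 f) (Ex P2 g) => a b h1 h2.
have -> : a - b = (a - S) - (b - S) by ring.
apply: le_trans (ler_normB _ _) _; rewrite [leRHS]mulrDl; exact: lerD.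
Qed.

Section Independence.
Context {R : realType} {d1 d2 : measure_display} {T : measurableType d1}
  {U : measurableType d2}.
Variables (P : probability T R) (n : nat) (X : 'I_n -> T -> U).
Hypothesis mX : forall i, measurable_fun setT (X i).
Hypothesis indX : mutually_independent P X.

Lemma bmeas_comp (h : U -> R) i : bmeas h -> bmeas (h \o X i).
Proof.
move=> [mh [M hM]]; split; first exact: measurableT_comp.
by exists M => x; exact: hM.
Qed.

Lemma Ex_prod_indep (h : 'I_n -> U -> R) :
  (forall i, bmeas (h i)) -> (forall i u, 0 <= h i u) ->
  Ex P (fun w => \prod_i h i (X i w)) = \prod_i Ex P (h i \o X i).
Proof.
(* Induction on the number [k] of leading factors that may be arbitrary, the others being
   indicators. The case 0 is the definition of independence; [Ex_mul_layers] frees one more factor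
   through its level sets. *)
suff H k : forall h : 'I_n -> U -> R,
    (forall i, bmeas (h i)) -> (forall i u, 0 <= h i u) ->
    (forall i : 'I_n, (k <= i)%N -> exists2 B : set U, measurable B & h i = \1_B) ->
    Ex P (fun w => \prod_i h i (X i w)) = \prod_i Ex P (h i \o X i).
  by move=> bh h0; apply: (H n) => // i; rewrite leqNgt ltn_ord.
elim: k => [|k IH] {}h bh h0 hB.
  have /choice[B BP] : forall i, exists B : set U, measurable B /\ h i = \1_B.
    by move=> i; have [B mB hiB] := hB i isT; exists B.
  have mB i : measurable (B i) by have [] := BP i.
  have mXB i : measurable (X i @^-1` B i).
    by rewrite -[X in measurable X]setTI; exact: mX.
  have hE i : h i \o X i = \1_(X i @^-1` B i).
    by apply/funext => w; rewrite /= (BP i).2 !indicE.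
  pose A := \big[setI/setT]_(i in [set: 'I_n]%SET) (X i @^-1` B i).
  have mA : measurable A by apply: bigsetI_measurable.
  have -> : (fun w => \prod_i h i (X i w)) = \1_A.
    apply/funext => w; rewrite indicE.
    rewrite (eq_bigr (fun i => \1_(X i @^-1` B i) w)) => [|i _]; last by rewrite -hE.
    have [wA|wA] := boolP (w \in A).
      rewrite big1// => i _; rewrite indicE.
      by move: wA; rewrite inE /A (bigD1 i) ?inE//= => -[wi _]; rewrite mem_set.
    suff [i wi] : exists i, w \notin X i @^-1` B i.
      by rewrite (bigD1 i)//= indicE (negbTE wi) mul0r.
    apply/existsP; apply: contraNT wA; rewrite negb_exists => /forallP wB.
    rewrite inE /A; elim/big_ind : _ => // i _.
    by have := wB i; rewrite negbK inE.
  rewrite Ex_indic// indX//.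
  transitivity (\prod_i fine (P (X i @^-1` B i))); last first.
    by apply: eq_bigr => i _; rewrite hE Ex_indic.
  rewrite [X in fine X](eq_bigl xpredT); last by move=> i; rewrite finset.in_setT.
  suff -> : (\prod_i P (X i @^-1` B i) = (\prod_i fine (P (X i @^-1` B i)))%:E)%E by [].
  elim/big_rec2: _ => //= i x y _ ->.
  by rewrite EFinM fineK// fin_num_measure.
have [nk|kn] := leqP n k.
  by apply: IH => // i ki; have := ltn_ord i; rewrite ltnNge (leq_trans nk ki).
pose i0 := Ordinal kn.
under eq_fun do rewrite (bigD1 i0)//= mulrC.
rewrite (bigD1 i0)//= mulrC.
have bhX i : bmeas (h i \o X i) by exact: bmeas_comp.
apply: (@Ex_mul_layers _ _ _ P _ (h i0 \o X i0)) => //.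
  by apply: bmeas_prod => i; exact: bhX.
  by move=> x; exact: h0.
move=> t; pose Bt := [set u | t <= h i0 u].
have mBt : measurable Bt by exact/measurable_ge/(proj1 (bh i0)).
pose h' i := if i == i0 then \1_Bt : U -> R else h i.
have := IH h'.
have bh' i : bmeas (h' i) by rewrite /h'; case: ifP => // _; exact: bmeas_indic.
have h'0 i u : 0 <= h' i u.
  by rewrite /h'; case: (i == i0); [rewrite indicE ler0n|exact: h0].
move=> /(_ bh' h'0) {}IH.
have h'B (i : 'I_n) : (k <= i)%N -> exists2 B : set U, measurable B & h' i = \1_B.
  rewrite leq_eqVlt /h'; have [_ _|ii0] := eqVneq i i0; first by exists Bt.
  case/orP => [/eqP ki|]; last exact: hB.
  by case/eqP: ii0; exact/val_inj.
have {IH} := IH h'B.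
under eq_fun do rewrite (bigD1 i0)//= mulrC.
rewrite (bigD1 i0)//= mulrC => IH.
have e0 : h' i0 = \1_Bt by rewrite /h' eqxx.
have eN i : i != i0 -> h' i = h i by move=> /negbTE ii0; rewrite /h' ii0.
transitivity (Ex P (fun w => (\prod_(i | i != i0) h' i (X i w)) * h' i0 (X i0 w))).
  congr Ex; apply/funext => w; rewrite e0; congr (_ * _).
  by apply: eq_bigr => i ii0; rewrite eN.
by rewrite IH e0; congr (_ * _); apply: eq_bigr => i ii0; rewrite eN.
Qed.

End Independence.

(** * Rademacher sums *)

Section ExpBounds.
Context {R : realType}.
Implicit Types x y : R.

Lemma expR_le_quadratic x : expR x <= 1 + x + x ^+ 2 * expR `|x|.
Proof.
have h1 : expR x - 1 <= x * expR x.
  have := ler_wpM2l (expR_ge0 x) (expR_ge1Dx (- x)).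
  by rewrite -expRD subrr expR0; lra.
have [x0|x0] := leP 0 x.
  rewrite ger0_norm//.
  have := ler_wpM2l x0 h1; rewrite mulrBr mulr1 mulrA -expr2; lra.
rewrite ltr0_norm//.
have h2 : 1 <= expR (- x) by rewrite -expR0 ler_expR oppr_ge0 ltW.
have h3 : x ^+ 2 <= x ^+ 2 * expR (- x) by rewrite ler_peMr// sqr_ge0.
have h4 : 0 <= (- x) * (expR x - 1 - x).
  by apply: mulr_ge0; [lra|have := expR_ge1Dx x; lra].
rewrite expr2 in h3 *; lra.
Qed.

Lemma expRN_le_quadratic x : 0 <= x -> expR (- x) <= 1 - x + x ^+ 2.
Proof.
move=> x0; have h1 : expR (- x) * (1 + x) <= 1.
  have := ler_wpM2l (expR_ge0 (- x)) (expR_ge1Dx x).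
  by rewrite -expRD addNr expR0.
have h2 : 1 <= (1 - x + x ^+ 2) * (1 + x).
  have -> : (1 - x + x ^+ 2) * (1 + x) = 1 + x ^+ 3 by ring.
  by rewrite lerDl exprn_ge0.
by rewrite -(@ler_pM2r _ (1 + x)); [exact: le_trans h2|lra].
Qed.

Lemma expR_le_inv x : x < 1 -> expR x <= (1 - x)^-1.
Proof.
move=> x1; rewrite -[leLHS]invrK lef_pV2 ?posrE ?invr_gt0 ?expR_gt0//; last by lra.
by rewrite -expRN expR_ge1Dx.
Qed.

(** For [0 <= x], up to 1/2 this follows from [expR x <= (1 - x)^-1], beyond 1/2 from
    [x <= 2 * x ^+ 2]. The constant 2 in the exponent is not optimal. *)
Lemma cosh_le_expR x : expR x + expR (- x) <= 2 * expR (2 * x ^+ 2).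
Proof.
wlog x0 : x / 0 <= x.
  move=> h; have [/h//|/ltW x0] := leP 0 x.
  by have := h (- x); rewrite oppr_ge0 opprK sqrrN addrC; exact.
have [x1|x1] := leP x (1 / 2); last first.
  have h1 : expR x <= expR (2 * x ^+ 2).
    rewrite ler_expR expr2 mulrA ler_peMl// ; lra.
  have h2 : expR (- x) <= expR x by rewrite ler_expR; lra.
  by lra.
have h0 : x ^+ 2 <= 1 / 4 by nra.
have h1 : expR x <= (1 - x)^-1 by apply: expR_le_inv; lra.
have h2 : expR (- x) <= (1 + x)^-1.
  by have := @expR_le_inv (- x); rewrite opprK; apply; lra.
have h3 : (1 - x)^-1 + (1 + x)^-1 = 2 / (1 - x ^+ 2).
  have -> : 1 - x ^+ 2 = (1 - x) * (1 + x) by ring.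
  have n1 : 1 - x != 0 by rewrite gt_eqF//; lra.
  have n2 : 1 + x != 0 by rewrite gt_eqF//; lra.
  by field; rewrite n1 n2.
have h4 : (1 - x ^+ 2)^-1 <= 1 + 2 * x ^+ 2.
  have p0 : 0 < 1 - x ^+ 2 by lra.
  rewrite -[leLHS]mul1r ler_pdivrMr//.
  have -> : (1 + 2 * x ^+ 2) * (1 - x ^+ 2) = 1 + x ^+ 2 * (1 - 2 * x ^+ 2) by ring.
  by rewrite lerDl mulr_ge0 ?sqr_ge0//; lra.
have h5 := expR_ge1Dx (2 * x ^+ 2); lra.
Qed.

Lemma sqr_le_expR x c : 0 < c -> x ^+ 2 <= c ^+ 2 * expR (2 * (`|x| / c)).
Proof.
move=> c0; rewrite mulr_natl mulr2n expRD -expr2 -exprMn -real_normK ?num_real//.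
apply: lerXn2r; rewrite ?nnegrE ?mulr_ge0 ?expR_ge0 ?(ltW c0)//.
rewrite -ler_pdivrMl// mulrC.
by apply: le_trans (expR_ge1Dx _); rewrite lerDr.
Qed.

End ExpBounds.

Section Rademacher.
Context {R : realType} {d : nat}.

Definition flip (k : 'I_d) (s : {ffun 'I_d -> bool}) : {ffun 'I_d -> bool} :=
  [ffun i => if i == k then ~~ s i else s i].

Lemma flipK k : involutive (flip k).
Proof.
by move=> s; apply/ffunP => i; rewrite !ffunE; case: eqP => // _; rewrite negbK.
Qed.

Definition sg (b : bool) : R := if b then 1 else -1.

Lemma sgN b : sg (~~ b) = - sg b.
Proof. by case: b; rewrite /sg/= ?opprK. Qed.

Lemma sqr_sg b : sg b ^+ 2 = 1.
Proof. by case: b; rewrite /sg ?sqrrN expr1n. Qed.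

(* Each sign is integrated out in turn: since [cosh t <= exp (2 t^2)],
   averaging over the sign of [v k] turns [exp (l (s v k + S)^2)] into
   [exp (l (v k)^2 + (l + 8 l^2 (v k)^2) S^2)] at most. *)
Lemma rademacher_exp_sqr (v : 'I_d -> R) : \sum_i v i ^+ 2 <= 1 ->
  \sum_(s : {ffun 'I_d -> bool}) expR (32^-1 * (\sum_i sg (s i) * v i) ^+ 2) <=
  expR 16^-1 * #|{ffun 'I_d -> bool}|%:R.
Proof.
move=> v1.
pose r (k : nat) := \sum_(i < d | (i < k)%N) v i ^+ 2.
pose S (k : nat) (s : {ffun 'I_d -> bool}) := \sum_(i < d | (k <= i)%N) sg (s i) * v i.
have r1 k : 0 <= r k <= 1.
  rewrite /r sumr_ge0 => [|i _]; last exact: sqr_ge0.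
  apply: le_trans v1; rewrite [leRHS](bigID (fun i : 'I_d => (i < k)%N))/= lerDl.
  by apply: sumr_ge0 => i _; exact: sqr_ge0.
(* [r k] is the squared norm already integrated out. As [r k <= 1], the coefficient
   [l = (1 + r k) / 32] is at most 1/16, so [8 * l ^+ 2 <= 32^-1], exactly the rate at which [l]
   grows with [r k]. *)
have claim k : (k <= d)%N ->
    \sum_(s : {ffun 'I_d -> bool}) expR (32^-1 * (\sum_i sg (s i) * v i) ^+ 2) <=
    expR (r k / 16) * \sum_(s : {ffun 'I_d -> bool}) expR ((1 + r k) / 32 * S k s ^+ 2).
  elim: k => [_|k IH kd].
    have -> : r 0%N = 0 by rewrite /r big_pred0.
    rewrite mul0r expR0 mul1r addr0 div1r; apply: ler_sum => s _.
    by rewrite (_ : S 0%N s = \sum_i sg (s i) * v i)//; exact: eq_bigl.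
  apply: le_trans (IH (ltnW kd)) _; pose k0 := Ordinal kd.
  have rS : r k.+1 = r k + v k0 ^+ 2.
    rewrite /r (bigD1 k0)//= addrC; congr (_ + _); apply: eq_bigl => i.
    by rewrite -val_eqE/= ltnS; case: ltngtP.
  have SE s : S k s = sg (s k0) * v k0 + S k.+1 s.
    rewrite /S (bigD1 k0)//=; congr (_ + _); apply: eq_bigl => i.
    by rewrite -val_eqE/=; case: ltngtP.
  have Sf s : S k.+1 (flip k0 s) = S k.+1 s.
    apply: eq_bigr => i ki; rewrite ffunE -val_eqE/=.
    by rewrite gtn_eqF.
  set l := (1 + r k) / 32.
  have /andP[rk0 rk1] := r1 k.
  have l0 : 0 <= l by rewrite /l divr_ge0//; lra.
  have l1 : l <= 16^-1 by rewrite /l; lra.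
  have sum2 : \sum_(s : {ffun 'I_d -> bool}) expR (l * S k s ^+ 2) =
      2^-1 * \sum_(s : {ffun 'I_d -> bool}) (expR (l * (sg (s k0) * v k0 + S k.+1 s) ^+ 2) +
                    expR (l * (- (sg (s k0) * v k0) + S k.+1 s) ^+ 2)).
    rewrite big_split/=.
    have -> : \sum_(s : {ffun 'I_d -> bool}) expR (l * (- (sg (s k0) * v k0) + S k.+1 s) ^+ 2) =
        \sum_(s : {ffun 'I_d -> bool}) expR (l * S k s ^+ 2).
      rewrite [RHS](reindex_inj (can_inj (flipK k0))); apply: eq_bigr => s _.
      by rewrite SE Sf ffunE eqxx sgN mulNr.
    by under [X in _ = _ * (X + _)]eq_bigr do rewrite -SE; field.
  rewrite sum2 mulr_sumr !mulr_sumr; apply: ler_sum => s _.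
  set a := sg (s k0) * v k0; set b := S k.+1 s.
  have a2 : a ^+ 2 = v k0 ^+ 2 by rewrite /a exprMn sqr_sg mul1r.
  have -> : expR (l * (a + b) ^+ 2) + expR (l * (- a + b) ^+ 2) =
     expR (l * a ^+ 2 + l * b ^+ 2) * (expR (2 * l * a * b) + expR (- (2 * l * a * b))).
    by rewrite mulrDr -!expRD; congr (expR _ + expR _); ring.
  have := ler_wpM2l (expR_ge0 (l * a ^+ 2 + l * b ^+ 2)) (cosh_le_expR (2 * l * a * b)).
  set X := _ * (_ + _) => h.
  have {}h : 2^-1 * X <= expR (l * a ^+ 2 + l * b ^+ 2 + 2 * (2 * l * a * b) ^+ 2).
    by rewrite expRD; lra.
  apply: le_trans (ler_wpM2l (expR_ge0 _) h) _.
  rewrite -!expRD ler_expR rS -a2.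
  have h1 : l * a ^+ 2 <= 16^-1 * a ^+ 2 by rewrite ler_wpM2r ?sqr_ge0.
  have h2 : l ^+ 2 * (a ^+ 2 * b ^+ 2) <= 256^-1 * (a ^+ 2 * b ^+ 2).
    apply: ler_wpM2r; first by apply: mulr_ge0; exact: sqr_ge0.
    rewrite (_ : 256^-1 = 16^-1 ^+ 2); last by field.
    by rewrite lerXn2r ?nnegrE//; lra.
  have -> : 2 * (2 * l * a * b) ^+ 2 = 8 * (l ^+ 2 * (a ^+ 2 * b ^+ 2)) by ring.
  have -> : (1 + (r k + a ^+ 2)) / 32 * b ^+ 2 = l * b ^+ 2 + 32^-1 * (a ^+ 2 * b ^+ 2).
    by rewrite /l; field.
  lra.
apply: le_trans (claim d (leqnn d)) _.
have S0 s : S d s = 0.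
  by rewrite /S big_pred0// => i; rewrite leqNgt ltn_ord.
rewrite (eq_bigr (fun=> 1)) => [|s _]; last by rewrite S0 expr0n/= mulr0 expR0.
rewrite sumr_const ler_wpM2r// ler_expR.
by have /andP[_ h] := r1 d; lra.
Qed.

End Rademacher.

(** * Moments on the sphere *)

Section Spherical.
Context {R : realType} {disp : measure_display} {T : measurableType disp}.
Variables (P : probability T R) (d : nat) (Y : T -> 'cV[R]_d).
Hypothesis d_gt0 : (0 < d)%N.
Hypothesis mY : forall i, measurable_fun setT (fun w => Y w i 0).
(** [Y] will be a normalised sample, with value 0 at the zero vector: its norm is at most 1
    everywhere, which keeps functions of it bounded, but equal to 1 only almost surely. *)
Hypothesis Y_le1 : forall w, dot (Y w) (Y w) <= 1.
Hypothesis Y_as1 : exists A : set T,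
  [/\ measurable A, P A = 1%E & forall w, A w -> dot (Y w) (Y w) = 1].
Hypothesis Y_inv : forall p q : 'cV[R]_d, dot p p = dot q q ->
  same_law P P (fun w => dot (Y w) p ^+ 2) (fun w => dot (Y w) q ^+ 2).
Implicit Types p q : 'cV[R]_d.

Local Notation E := (Ex P).
Let dR : 0 < d%:R :> R. Proof. by rewrite ltr0n. Qed.

Lemma bmeas_coord i : bmeas (fun w => Y w i 0).
Proof.
split=> //; exists 1 => w; rewrite -(@expr_le1 _ 2)// real_normK ?num_real//.
apply: le_trans (Y_le1 w); rewrite /dot (bigD1 i)//= -expr2 lerDl.
by apply: sumr_ge0 => j _; rewrite -expr2 sqr_ge0.
Qed.

Lemma bmeas_dot p : bmeas (fun w => dot (Y w) p).
Proof.
apply: bmeas_sum => i; apply: bmeasM; [exact: bmeas_coord|exact: bmeas_cst].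
Qed.

Lemma bmeas_dot2 p : bmeas (fun w => dot (Y w) p ^+ 2).
Proof. exact/bmeasX/bmeas_dot. Qed.

Lemma Ex_inv (G : R -> R) p q : measurable_fun setT G -> (forall x, 0 <= x -> 0 <= G x) ->
  (forall f : T -> R, bmeas f -> bmeas (fun w => G (f w))) ->
  dot p p = dot q q ->
  E (fun w => G (dot (Y w) p ^+ 2)) = E (fun w => G (dot (Y w) q ^+ 2)).
Proof.
move=> mG G0 bG pq; apply: Ex_same_law => //; try exact/bG/bmeas_dot2.
- by move=> w; apply/G0/sqr_ge0.
- by move=> w; apply/G0/sqr_ge0.
move=> B mB; have mGB : measurable (G @^-1` B).
  by rewrite -[X in measurable X]setTI; exact: mG.
exact: (Y_inv pq mGB).
Qed.

Lemma Ex_as (f g : T -> R) : bmeas f -> bmeas g ->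
  (forall w, dot (Y w) (Y w) = 1 -> f w = g w) -> E f = E g.
Proof.
have [A [mA PA A1]] := Y_as1; move=> bf bg fg.
by apply: (Ex_eq_ae bf bg mA PA) => w /A1; exact: fg.
Qed.

(** By invariance all [d] coordinates have the same second moment, and these moments sum to 1. *)
Lemma Ex_second p : E (fun w => dot (Y w) p ^+ 2) = dot p p / d%:R.
Proof.
pose e i : 'cV[R]_d := Num.sqrt (dot p p) *: delta_mx i 0.
have ee i : dot p p = dot (e i) (e i).
  rewrite /e dotZl dotZr dot_delta mxE !eqxx mulr1 -expr2 sqr_sqrtr//.
  exact: dot_ge0.
have H i : E (fun w => dot (Y w) p ^+ 2) = dot p p * E (fun w => Y w i 0 ^+ 2).
  rewrite (Ex_inv (G := id) _ _ _ (ee i)) //.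
  rewrite -ExZ; last exact/bmeasX/bmeas_coord.
  congr Ex; apply/funext => w; rewrite /e dotZr dot_delta exprMn sqr_sqrtr//.
  exact: dot_ge0.
have : \sum_(i < d) E (fun w => dot (Y w) p ^+ 2) = dot p p.
  rewrite (eq_bigr _ (fun i _ => H i)) -mulr_sumr -Ex_sum; last first.
    by move=> i; exact/bmeasX/bmeas_coord.
  rewrite (@Ex_as _ (fun=> 1)) ?Ex_cst ?mulr1//.
  - by apply: bmeas_sum => i; exact/bmeasX/bmeas_coord.
  - exact: bmeas_cst.
rewrite sumr_const card_ord => <-.
by rewrite -[X in X / _]mulr_natr mulfK// gt_eqF.
Qed.

Let A p w := d%:R * dot (Y w) p ^+ 2.

Lemma bmeas_A p : bmeas (A p).
Proof. by apply: bmeasM; [exact: bmeas_cst|exact: bmeas_dot2]. Qed.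

Lemma A_ge0 p w : 0 <= A p w.
Proof. by rewrite mulr_ge0 ?sqr_ge0// ltW. Qed.

Lemma Ex_A p : E (A p) = dot p p.
Proof.
by rewrite /A ExZ ?Ex_second; [rewrite mulrC divfK ?gt_eqF|exact: bmeas_dot2].
Qed.

(* By invariance [p] may be replaced by each vector [(|p| / sqrt d) (+-1, .., +-1)];
   averaging over the signs makes [A p] the square of a Rademacher sum. *)
Lemma Ex_exp_A p : dot p p <= 1 -> E (fun w => expR (32^-1 * A p w)) <= expR 16^-1.
Proof.
move=> p1; have pp := dot_ge0 p.
pose q (s : {ffun 'I_d -> bool}) : 'cV[R]_d :=
  \col_i (Num.sqrt (dot p p / d%:R) * sg (s i)).
have pd0 : 0 <= dot p p / d%:R by rewrite divr_ge0// ltW.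
have qq s : dot p p = dot (q s) (q s).
  rewrite [RHS](eq_bigr (fun=> dot p p / d%:R)) => [|i _].
    by rewrite sumr_const card_ord -[RHS]mulr_natr divfK// gt_eqF.
  by rewrite mxE -expr2 exprMn sqr_sqrtr// sqr_sg mulr1.
pose S (s : {ffun 'I_d -> bool}) w := \sum_i sg (s i) * Y w i 0.
have bS s : bmeas (S s).
  by apply: bmeas_sum => i; apply: bmeasM; [exact: bmeas_cst|exact: bmeas_coord].
have Aq s w : A (q s) w = dot p p * S s w ^+ 2.
  rewrite /A (_ : dot (Y w) (q s) = Num.sqrt (dot p p / d%:R) * S s w).
    by rewrite exprMn sqr_sqrtr// mulrA [d%:R * _]mulrC divfK// gt_eqF.
  by rewrite /S mulr_sumr; apply: eq_bigr => i _; rewrite mxE; ring.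
have bE s : bmeas (fun w => expR (32^-1 * S s w ^+ 2)).
  by apply/bmeas_exp/bmeasM; [exact: bmeas_cst|exact: bmeasX].
have bA r : bmeas (fun w => expR (32^-1 * A r w)).
  by apply/bmeas_exp/bmeasM; [exact: bmeas_cst|exact: bmeas_A].
have step s : E (fun w => expR (32^-1 * A p w)) <=
    E (fun w => expR (32^-1 * S s w ^+ 2)).
  have -> : E (fun w => expR (32^-1 * A p w)) = E (fun w => expR (32^-1 * A (q s) w)).
    apply: (Ex_inv (G := fun x => expR (32^-1 * (d%:R * x)))) => //.
    - by apply: measurableT_comp => //; apply: measurable_funM => //; apply: measurable_funM.
    - move=> f bf; apply/bmeas_exp/bmeasM; first exact: bmeas_cst.
      by apply: bmeasM => //; exact: bmeas_cst.
  by apply: Ex_le => // w; rewrite ler_expR ler_wpM2l// Aq ler_piMl// sqr_ge0.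
have N0 : 0 < #|{ffun 'I_d -> bool}|%:R :> R.
  by rewrite ltr0n; apply/card_gt0P; exists [ffun=> true].
rewrite -(@ler_pM2r _ #|{ffun 'I_d -> bool}|%:R)// [leLHS]mulr_natr -sumr_const.
apply: le_trans (ler_sum _ (fun s _ => step s)) _.
rewrite -Ex_sum// -[leRHS](Ex_cst P); apply: Ex_le => [||w].
- exact: bmeas_sum.
- exact: bmeas_cst.
by apply: rademacher_exp_sqr; under eq_bigr do rewrite expr2; exact: Y_le1.
Qed.

(** One exponential moment that dominates the moments needed below; the shift by 1 absorbs the
    centring, as [dot p p <= 1]. *)
Lemma Ex_exp_A_shift p : dot p p <= 1 ->
  E (fun w => expR ((1 + A p w) / 32)) <= 2.
Proof.
move=> p1.
have -> : (fun w => expR ((1 + A p w) / 32)) =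
    (fun w => expR 32^-1 * expR (32^-1 * A p w)).
  by apply/funext => w; rewrite -expRD; congr expR; rewrite mulrDl div1r [A p w / _]mulrC.
rewrite ExZ; last by apply/bmeas_exp/bmeasM; [exact: bmeas_cst|exact: bmeas_A].
apply: le_trans (ler_wpM2l (expR_ge0 _) (Ex_exp_A p1)) _; rewrite -expRD.
apply: le_trans (expR_le_inv _) _; first by lra.
by rewrite -[leRHS]invrK lef_pV2 ?posrE ?invr_gt0//; lra.
Qed.

Lemma Ex_mgf p (l : R) : dot p p <= 1 -> `|l| <= 128^-1 ->
  E (fun w => expR (l * (A p w - dot p p))) <= expR (2 ^+ 15 * l ^+ 2).
Proof.
move=> p1 l1; have pp := dot_ge0 p.
have bZ : bmeas (fun w => l * (A p w - dot p p)).
  apply: bmeasM; first exact: bmeas_cst.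
  by apply: bmeasB; [exact: bmeas_A|exact: bmeas_cst].
have bQ : bmeas (fun w => l ^+ 2 * 128 ^+ 2 * expR ((1 + A p w) / 32)).
  apply: bmeasM; first exact: bmeas_cst.
  apply/bmeas_exp/bmeasM; last exact: bmeas_cst.
  by apply: bmeasD; [exact: bmeas_cst|exact: bmeas_A].
(* The linear term is centred. With [y] the centred variable, the exponents in the remainder add up
   to [|y| / 64 + |y| / 128], below [(1 + A p w) / 32]; the final constant is
   [128 ^+ 2 * 2 = 2 ^+ 15]. *)
have key w : expR (l * (A p w - dot p p)) <= 1 + l * (A p w - dot p p) +
    l ^+ 2 * 128 ^+ 2 * expR ((1 + A p w) / 32).
  set y := A p w - dot p p.
  have yA : `|y| <= 1 + A p w.
    by have := A_ge0 p w; rewrite ler_norml /y => h; apply/andP; split; lra.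
  apply: le_trans (expR_le_quadratic _) _; rewrite lerD2l.
  rewrite exprMn -[leLHS]mulrA -[leRHS]mulrA.
  apply: ler_wpM2l; first exact: sqr_ge0.
  have c128 : (0 : R) < 128 by [].
  apply: le_trans (ler_wpM2r (expR_ge0 _) (sqr_le_expR y c128)) _.
  rewrite -[leLHS]mulrA; apply: ler_wpM2l; first exact: sqr_ge0.
  rewrite -expRD ler_expR normrM.
  have h : `|l| * `|y| <= 128^-1 * `|y| by rewrite ler_wpM2r.
  have := normr_ge0 y; lra.
have b1 : bmeas (fun w => 1 + l * (A p w - dot p p)).
  by apply: bmeasD => //; exact: bmeas_cst.
apply: le_trans (Ex_le P _ _ key) _; [exact: bmeas_exp|exact: bmeasD|].
rewrite ExD// ExD//; last exact: bmeas_cst.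
rewrite Ex_cst ExZ; last by apply: bmeasB; [exact: bmeas_A|exact: bmeas_cst].
rewrite ExB; [|exact: bmeas_A|exact: bmeas_cst].
rewrite Ex_cst Ex_A subrr mulr0 addr0.
rewrite ExZ; last first.
  apply/bmeas_exp/bmeasM; last exact: bmeas_cst.
  by apply: bmeasD; [exact: bmeas_cst|exact: bmeas_A].
apply: le_trans (expR_ge1Dx _); rewrite lerD2l.
rewrite (_ : 2 ^+ 15 * l ^+ 2 = l ^+ 2 * 128 ^+ 2 * 2); last by ring.
apply: ler_wpM2l; first by rewrite mulr_ge0 ?sqr_ge0.
exact: Ex_exp_A_shift.
Qed.

Lemma Ex_quartic p q : dot p p = dot q q ->
  E (fun w => A p w ^+ 2) = E (fun w => A q w ^+ 2).
Proof.
move=> pq; apply: (Ex_inv (G := fun x => (d%:R * x) ^+ 2)) => //.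
- by apply: measurable_funX; apply: measurable_funM.
- by move=> x _; exact: sqr_ge0.
- by move=> f bf; apply/bmeasX/bmeasM => //; exact: bmeas_cst.
Qed.

(** Polarisation of degree four: fourth moments depend only on the norm, so those at [p + q] and
    [p - q] give [(|p|^2 |q|^2 + 2 (p, q)^2) m4 / 3] for the mixed moment. Here [m4 >= 1] because
    [A e] has mean 1. *)
Lemma Ex_A_mul p q : dot p p * dot q q / 3 <= E (fun w => A p w * A q w).
Proof.
pose e : 'cV[R]_d := delta_mx (Ordinal d_gt0) 0.
have ee : dot e e = 1 by rewrite dot_delta mxE !eqxx.
pose m4 := E (fun w => A e w ^+ 2).
have quart r : E (fun w => A r w ^+ 2) = dot r r ^+ 2 * m4.
  pose r' := Num.sqrt (dot r r) *: e.
  have rr : dot r r = dot r' r'.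
    by rewrite dotZl dotZr ee mulr1 -expr2 sqr_sqrtr// dot_ge0.
  rewrite (Ex_quartic rr) /m4 -ExZ; last exact/bmeasX/bmeas_A.
  have s2 : Num.sqrt (dot r r) ^+ 2 = dot r r by rewrite sqr_sqrtr// dot_ge0.
  congr Ex; apply/funext => w; rewrite /A /r' dotZr.
  by move: (Num.sqrt _) s2 => t <-; ring.
have m41 : 1 <= m4.
  have : 0 <= E (fun w => (A e w - 1) ^+ 2) by apply: Ex_ge0 => w; exact: sqr_ge0.
  have -> : (fun w => (A e w - 1) ^+ 2) = (fun w => A e w ^+ 2 + (-2 * A e w + 1)).
    by apply/funext => w; ring.
  have b2 : bmeas (fun w => -2 * A e w) by apply: bmeasM; [exact: bmeas_cst|exact: bmeas_A].
  rewrite ExD; [|exact/bmeasX/bmeas_A|apply: bmeasD => //; exact: bmeas_cst].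
  rewrite ExD//; last exact: bmeas_cst.
  rewrite ExZ; last exact: bmeas_A.
  by rewrite Ex_cst Ex_A ee /m4; lra.
have pol : E (fun w => A (p + q) w ^+ 2) + E (fun w => A (p - q) w ^+ 2) =
    2 * E (fun w => A p w ^+ 2) + 12 * E (fun w => A p w * A q w) +
    2 * E (fun w => A q w ^+ 2).
  have b r : bmeas (fun w => A r w ^+ 2) by exact/bmeasX/bmeas_A.
  have bpq : bmeas (fun w => A p w * A q w) by apply: bmeasM; exact: bmeas_A.
  have bc c (f : T -> R) : bmeas f -> bmeas (fun w => c * f w).
    by move=> bf; apply: bmeasM => //; exact: bmeas_cst.
  rewrite -ExD//; transitivity (E (fun w => 2 * A p w ^+ 2 +
      (12 * (A p w * A q w) + 2 * A q w ^+ 2))).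
    by congr Ex; apply/funext => w; rewrite /A dotDr dotBr; ring.
  have b1 := bc 12 _ bpq; have b2 := bc 2 _ (b p); have b3 := bc 2 _ (b q).
  rewrite (ExD P b2 (bmeasD b1 b3)) (ExD P b1 b3).
  by rewrite !ExZ// addrA.
move: pol; rewrite !quart !(dotDl, dotDr, dotNl, dotNr) (dotC q p).
set X := E _; set a := dot p p; set b := dot q q; set c := dot p q => pol.
have a0 : 0 <= a by exact: dot_ge0.
have b0 : 0 <= b by exact: dot_ge0.
have -> : X = (a * b + 2 * c ^+ 2) * m4 / 3 by lra.
rewrite ler_pM2r ?invr_gt0//.
have h1 : a * b <= a * b * m4 by rewrite ler_peMr// mulr_ge0.
have h2 : 0 <= 2 * c ^+ 2 * m4.
  by apply: mulr_ge0; [apply: mulr_ge0 => //; exact: sqr_ge0|exact: (le_trans ler01 m41)].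
lra.
Qed.

(* The constant comes from [1 / u >= 2 s - s^2 u] at [s = 1 / (48 K)],
   where [K] bounds the fourth moment of [1 + A p]. *)
Definition spread_cst : R := 48^-1 ^+ 2 / (128 ^+ 4 * 2).

Lemma spread_cst_gt0 : 0 < spread_cst.
Proof. by rewrite divr_gt0 ?exprn_gt0 ?mulr_gt0 ?exprn_gt0 ?invr_gt0. Qed.

(** A smooth truncation of [x] at height 1. Boundedness serves the Chernoff bound, and the Lipschitz
    dependence on the square root of [x] serves the passage from the net. *)
Definition psi (x : R) := x / (1 + x).

Lemma psi_bounds x : 0 <= x -> 0 <= psi x <= 1.
Proof.
move=> x0; rewrite divr_ge0//=; last by lra.
by rewrite ler_pdivrMr; lra.
Qed.

Lemma bmeas_psi (f : T -> R) : bmeas f -> (forall w, 0 <= f w) ->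
  bmeas (fun w => psi (f w)).
Proof.
move=> [mf _] f0; split; last first.
  by exists 1 => w; have /andP[h1 h2] := psi_bounds (f0 w); rewrite ger0_norm.
have -> : (fun w => psi (f w)) = (fun w => f w * (1 + f w) `^ (-1)).
  by apply/funext => w; rewrite /psi powR_inv1// addr_ge0.
apply: measurable_funM => //.
apply: (measurableT_comp (measurable_powR _)).
exact: measurable_funD.
Qed.

Lemma Ex_psi p q : 4^-1 <= dot p p -> dot p p <= 1 -> 4^-1 <= dot q q ->
  dot q q <= 1 -> spread_cst <= E (fun w => psi (A p w) * psi (A q w)).
Proof.
move=> p0 p1 q0 q1.
pose K4 : R := 128 ^+ 4; pose K := K4 * 2.
have K40 : 0 < K4 by rewrite exprn_gt0.
have K0 : 0 < K by rewrite mulr_gt0.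
pose s := (48 * K)^-1; have s0 : 0 < s by rewrite invr_gt0 mulr_gt0.
have bA2 := bmeasM (bmeas_A p) (bmeas_A q).
have bF r : bmeas (fun w => expR ((1 + A r w) / 32)).
  apply/bmeas_exp/bmeasM; last exact: bmeas_cst.
  by apply: bmeasD; [exact: bmeas_cst|exact: bmeas_A].
have bc c (f : T -> R) : bmeas f -> bmeas (fun w => c * f w).
  by move=> bf; apply: bmeasM => //; exact: bmeas_cst.
have four r w : (1 + A r w) ^+ 4 <= K4 * expR ((1 + A r w) / 32).
  have r0 := A_ge0 r w; set z := 1 + A r w; have z0 : 0 <= z by rewrite /z addr_ge0.
  have c128 : (0 : R) < 128 by [].
  have h := sqr_le_expR z c128; rewrite ger0_norm// in h.
  rewrite /K4 (_ : 4%N = (2 * 2)%N)// exprM (exprM 128).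
  apply: le_trans (_ : (128 ^+ 2 * expR (2 * (z / 128))) ^+ 2 <= _).
    by rewrite lerXn2r ?nnegrE ?sqr_ge0// mulr_ge0 ?expR_ge0 ?sqr_ge0.
  rewrite exprMn expr2 -[X in _ * X <= _]expRM_natl.
  by rewrite (_ : _ * _ = z / 32)//; field.
have cE : spread_cst = 48^-1 ^+ 2 / K by [].
clearbody K4.
(* The tangent bound on [u^-1], with [u = (1 + a) * (1 + b)], replaces the quotient by a mixed
   moment, bounded below by [Ex_A_mul], minus fourth powers dominated by exponentials. *)
have key w : 2 * s * (A p w * A q w) +
    - (s ^+ 2 * K4 / 2) * (expR ((1 + A p w) / 32) + expR ((1 + A q w) / 32)) <=
    psi (A p w) * psi (A q w).
  have := four p w; have := four q w; have := A_ge0 p w; have := A_ge0 q w.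
  rewrite /psi; set a := A p w; set b := A q w; set ea := expR _; set eb := expR _.
  move=> b0 a0 hb ha; pose u := (1 + a) * (1 + b).
  have u0 : 0 < u by rewrite mulr_gt0//; lra.
  have -> : a / (1 + a) * (b / (1 + b)) = a * b / u.
    by rewrite /u; field; rewrite !gt_eqF//; lra.
  have h1 : 2 * s - s ^+ 2 * u <= u^-1.
    rewrite -(ler_pM2r u0) mulVf ?gt_eqF//.
    have := sqr_ge0 (1 - s * u); rewrite -subr_ge0; set X := _ ^+ 2.
    by rewrite [X in _ -> 0 <= X](_ : _ = X)//; rewrite /X; ring.
  have ab0 : 0 <= a * b by rewrite mulr_ge0.
  have h2 := ler_wpM2l ab0 h1.
  have abu : a * b <= u by rewrite /u; nra.
  have h3 : a * b * u <= ((1 + a) ^+ 4 + (1 + b) ^+ 4) / 2.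
    have : a * b * u <= u * u by rewrite ler_wpM2r// ltW.
    have := sqr_ge0 ((1 + a) ^+ 2 - (1 + b) ^+ 2).
    have -> : u * u = (1 + a) ^+ 2 * (1 + b) ^+ 2 by rewrite /u; ring.
    have -> : (1 + a) ^+ 4 = ((1 + a) ^+ 2) ^+ 2 by rewrite -exprM.
    have -> : (1 + b) ^+ 4 = ((1 + b) ^+ 2) ^+ 2 by rewrite -exprM.
    move: ((1 + a) ^+ 2) ((1 + b) ^+ 2) => x y; rewrite !expr2; lra.
  have h4 := ler_wpM2l (sqr_ge0 s) h3.
  have h5 := ler_wpM2l (sqr_ge0 s) ha.
  have h6 := ler_wpM2l (sqr_ge0 s) hb.
  lra.
apply: le_trans (Ex_le P _ _ key); last 2 first.
- apply: bmeasD; apply: bc => //; exact: bmeasD.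
- apply: bmeasM; apply: bmeas_psi; by [exact: bmeas_A|exact: A_ge0].
rewrite ExD; [|exact: bc|apply: bc; exact: bmeasD].
rewrite ExZ// ExZ; last exact: bmeasD.
rewrite ExD//.
have h1 := Ex_A_mul p q.
have h2 : 48^-1 <= E (fun w => A p w * A q w).
  have h : 4^-1 * 4^-1 <= dot p p * dot q q by rewrite ler_pM.
  by apply: le_trans h1; lra.
have h3 := Ex_exp_A_shift p1; have h4 := Ex_exp_A_shift q1.
have h5 : 2 * s * 48^-1 <= 2 * s * E (fun w => A p w * A q w).
  by rewrite ler_wpM2l// mulr_ge0// ltW.
have h6 : s ^+ 2 * K4 / 2 * (E (fun w => expR ((1 + A p w) / 32)) +
    E (fun w => expR ((1 + A q w) / 32))) <= s ^+ 2 * K4 / 2 * 4.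
  rewrite ler_wpM2l; [by []|by rewrite divr_ge0// mulr_ge0 ?sqr_ge0// ltW|lra].
have -> : spread_cst = 2 * s * 48^-1 - s ^+ 2 * K4 / 2 * 4.
  have Kn : K != 0 by rewrite gt_eqF.
  rewrite (_ : s ^+ 2 * K4 / 2 * 4 = s ^+ 2 * K); last by rewrite /K; field.
  by rewrite cE /s; field.
lra.
Qed.

End Spherical.

(** * A net of the unit ball *)

Section Net.
Context {R : realType}.
Variables (d N : nat).
Hypotheses (d_gt0 : (0 < d)%N) (N_gt0 : (0 < N)%N).

(** Grid points of mesh [1 / (N sqrt d)], by sign and magnitude. The double encoding of 0 is
    harmless for an upper bound on the cardinality. The range [N * d] only makes the type finite;
    [in_net] selects the ball. *)
Definition net_index := {ffun 'I_d -> 'I_(N * d).+1 * bool}.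

Definition net_vec (k : net_index) : 'cV[R]_d :=
  \col_i (sg (k i).2 * ((k i).1%:R / (N%:R * Num.sqrt d%:R))).

Definition in_net (k : net_index) : bool :=
  (\sum_i (k i).1%:R ^+ 2 <= N%:R ^+ 2 * d%:R :> R).

Let NR : 0 < N%:R :> R. Proof. by rewrite ltr0n. Qed.
Let dR : 0 < d%:R :> R. Proof. by rewrite ltr0n. Qed.
Let sdR : 0 < Num.sqrt d%:R :> R. Proof. by rewrite sqrtr_gt0. Qed.
Let scale2 : (N%:R * Num.sqrt d%:R) ^+ 2 = N%:R ^+ 2 * d%:R :> R.
Proof. by rewrite exprMn sqr_sqrtr// ltW. Qed.
Let scale_gt0 : 0 < N%:R * Num.sqrt d%:R :> R. Proof. by rewrite mulr_gt0. Qed.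

Lemma net_le1 k : in_net k -> dot (net_vec k) (net_vec k) <= 1.
Proof.
move=> kn; rewrite /dot.
rewrite (eq_bigr (fun i => (k i).1%:R ^+ 2 / (N%:R ^+ 2 * d%:R))) => [|i _].
  by rewrite -mulr_suml ler_pdivrMr ?mul1r// mulr_gt0// exprn_gt0.
by rewrite mxE -expr2 exprMn sqr_sg mul1r exprMn exprVn scale2.
Qed.

Lemma net_cover (p : 'cV[R]_d) : dot p p <= 1 ->
  exists2 k, in_net k & dot (p - net_vec k) (p - net_vec k) <= N%:R^-1 ^+ 2.
Proof.
move=> p1; set c := N%:R * Num.sqrt d%:R : R.
(* Rounding toward zero stays in the ball, and each of the [d] coordinates errs by at most
   [1 / (N sqrt d)]. *)
pose m i := Num.truncn (`|p i 0| * c).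
have z0 i : 0 <= `|p i 0| * c by rewrite mulr_ge0// ltW.
have mlo i : (m i)%:R <= `|p i 0| * c by have /andP[] := truncn_itv (z0 i).
have mhi i : `|p i 0| * c < (m i)%:R + 1.
  by have /andP[_] := truncn_itv (z0 i); rewrite -natr1.
have mM i : (m i < (N * d).+1)%N.
  rewrite ltnS -(ler_nat R); apply: le_trans (mlo i) _.
  have pi1 : `|p i 0| <= 1.
    rewrite -(@expr_le1 _ 2)// real_normK ?num_real//.
    apply: le_trans p1; rewrite /dot (bigD1 i)//= -expr2 lerDl.
    by apply: sumr_ge0 => j _; rewrite -expr2 sqr_ge0.
  have sd : Num.sqrt d%:R <= d%:R :> R.
    rewrite -(@ler_pXn2r _ 2) ?nnegrE ?(ltW sdR) ?(ltW dR)// sqr_sqrtr ?(ltW dR)//.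
    by rewrite expr2 ler_peMl ?(ltW dR)// ler1n.
  rewrite natrM -[leRHS]mul1r; apply: ler_pM => //; first exact: ltW.
  by rewrite /c ler_wpM2l// ltW.
pose k : net_index := [ffun i => (Ordinal (mM i), 0 <= p i 0)].
exists k.
  rewrite /in_net; under eq_bigr do rewrite ffunE/=.
  apply: (@le_trans _ _ (\sum_i p i 0 ^+ 2 * c ^+ 2)).
    apply: ler_sum => i _; rewrite -[p i 0 ^+ 2]real_normK ?num_real// -exprMn.
    by rewrite lerXn2r ?nnegrE.
  rewrite -mulr_suml -scale2 -/c ler_piMl ?sqr_ge0//.
have c0 : c != 0 by rewrite gt_eqF.
have bnd i : ((p - net_vec k) i 0) ^+ 2 <= (c ^+ 2)^-1.
  rewrite !mxE ffunE/= -real_normK ?num_real// -exprVn lerXn2r ?nnegrE ?invr_ge0 ?(ltW scale_gt0)//.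
  have -> : p i 0 = sg (0 <= p i 0) * `|p i 0|.
    have [h|h] := leP 0 (p i 0); rewrite /sg; first by rewrite mul1r ger0_norm.
    by rewrite mulN1r ltr0_norm ?opprK.
  have -> : (0 <= sg (0 <= p i 0) * `|p i 0|) = (0 <= p i 0).
    have [h|h] := leP 0 (p i 0); rewrite /sg; first by rewrite mul1r normr_ge0.
    by rewrite mulN1r oppr_ge0 normr_le0 (lt_eqF h).
  rewrite -mulrBr normrM.
  have -> : `|sg (0 <= p i 0) : R| = 1 by case: (0 <= p i 0); rewrite /sg ?normrN normr1.
  rewrite mul1r -[`|p i 0|](mulfK c0) -mulrBl normrM.
  rewrite [`|_^-1|]gtr0_norm ?invr_gt0// ler_piMl ?invr_ge0 ?(ltW scale_gt0)//.
  by have := mlo i; have := mhi i => h1 h2; rewrite ger0_norm; lra.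
apply: (@le_trans _ _ (\sum_(i < d) (c ^+ 2)^-1)).
  by apply: ler_sum => i _; rewrite -expr2; exact: bnd.
by rewrite sumr_const card_ord -[leLHS]mulr_natr scale2 invfM exprVn divfK// gt_eqF.
Qed.

(** A net point has weight at least 1 under [expR (N^2 d - \sum_i k_i^2)], and the total weight
    factorises into [d] sums bounded by 4. Counting the whole cube of grid points would put
    [d log d] in the exponent. *)
Lemma net_card : #|in_net|%:R <= expR ((N%:R ^+ 2 + 2) * d%:R) :> R.
Proof.
pose F (x : 'I_(N * d).+1 * bool) : R := expR (- (x.1%:R ^+ 2)).
have e2 : 2 <= expR 1 :> R by have := @expR_ge1Dx R 1; lra.
have e1 : expR (-1) <= 2^-1 :> R by rewrite expRN lef_pV2 ?posrE ?expR_gt0.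
have geo M : \sum_(m < M) expR (- (m%:R ^+ 2)) <= 2 - 2 * 2^-1 ^+ M :> R.
  elim: M => [|M IH]; first by rewrite big_ord0 expr0; lra.
  rewrite big_ord_recr/= [2^-1 ^+ M.+1]exprS.
  have h : expR (- (M%:R ^+ 2)) <= 2^-1 ^+ M :> R.
    apply: le_trans (_ : expR (-1) ^+ M <= _); last first.
      by rewrite lerXn2r ?nnegrE ?expR_ge0.
    rewrite -expRM_natl ler_expR mulrN1 lerN2 -natrX ler_nat.
    by case: M {IH} => // M; rewrite expnS expn1 leq_pmulr.
  lra.
have sF : \sum_x F x <= 4.
  have -> : \sum_x F x = 2 * \sum_(m < (N * d).+1) expR (- (m%:R ^+ 2)).
    rewrite -(pair_bigA _ (fun m b => F (m, b)))/= mulr_sumr.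
    by apply: eq_bigr => m _; rewrite big_bool /F/= mulr_natl mulr2n.
  have := geo (N * d).+1; have : 0 <= 2^-1 ^+ (N * d).+1 :> R by rewrite exprn_ge0.
  lra.
have -> : #|in_net|%:R = \sum_(k : net_index | in_net k) (1 : R).
  by rewrite sumr_const.
apply: (@le_trans _ _ (\sum_(k : net_index)
    expR (N%:R ^+ 2 * d%:R) * \prod_i F (k i))).
  rewrite [leRHS](bigID in_net)/= -[leLHS]addr0; apply: lerD.
    apply: ler_sum => k kn; rewrite -expR_sum -expRD -[leLHS]expR0 ler_expR.
    by rewrite sumrN subr_ge0; exact: kn.
  by apply: sumr_ge0 => k _; rewrite mulr_ge0 ?expR_ge0// prodr_ge0// => i _; rewrite expR_ge0.
rewrite -mulr_sumr -(bigA_distr_bigA (fun=> F))/= prodr_const card_ord.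
rewrite mulrDl expRD ler_pM2l ?expR_gt0//.
apply: (@le_trans _ _ (4 ^+ d)).
  rewrite lerXn2r ?nnegrE//; apply: sumr_ge0 => x _; exact: expR_ge0.
rewrite mulrC expRM_natl lerXn2r ?nnegrE ?expR_ge0//.
rewrite (_ : 2 = 1 + 1)// expRD (_ : 4 = 2 * 2); last by ring.
by apply: ler_pM.
Qed.

(** * From the net to all vectors *)

Section Transfer.
Variables (n : nat) (y : 'I_n -> 'cV[R]_d) (delta c1 : R).
Hypotheses (n_gt0 : (0 < n)%N) (N_ge4 : (4 <= N)%N).

Let nR : 0 < n%:R :> R. Proof. by rewrite ltr0n. Qed.
Let Q (p : 'cV[R]_d) := d%:R / n%:R * \sum_j dot (y j) p ^+ 2.

(** At some unit vector the form of the error [M] reaches its largest absolute value [S]. Moving to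
    a net point within 1/4 changes it by at most [S / 2], so [S <= delta / 2 + S / 2]. *)
Lemma isotropy_of_net :
  (forall k, in_net k -> `|Q (net_vec k) - dot (net_vec k) (net_vec k)| <= delta / 2) ->
  forall p, `|Q p - dot p p| <= delta * dot p p.
Proof.
move=> hnet.
pose M : 'M[R]_d := (d%:R / n%:R) *: (\sum_j (y j *m (y j)^T)) - 1%:M.
have qM p : qf M p = Q p - dot p p.
  rewrite qfB qfZ qf_sum qf1; congr (_ * _ - _).
  by apply: eq_bigr => j _; rewrite qf_outer.
have Ms : M^T = M.
  rewrite linearB/= linearZ/= linear_sum/= trmx1; congr (_ *: _ - _).
  by apply: eq_bigr => j _; rewrite trmx_mul trmxK.
have [u1 [l1 [u10 le1 eq1]]] := rayleigh M d_gt0 pd_1.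
have [u2 [l2 [u20 le2 eq2]]] := rayleigh (- M) d_gt0 pd_1.
pose S := Num.max l1 l2.
have upS p : `|qf M p| <= S * dot p p.
  have := le1 p; have := le2 p; rewrite qfN qf1 => h2 h1.
  have D0 := dot_ge0 p.
  have h3 : l1 * dot p p <= S * dot p p by rewrite ler_wpM2r// le_max lexx.
  have h4 : l2 * dot p p <= S * dot p p by rewrite ler_wpM2r// le_max lexx orbT.
  by rewrite ler_norml; apply/andP; split; lra.
have [u [u1' uS]] : exists u : 'cV[R]_d, dot u u = 1 /\ S <= `|qf M u|.
  have norma (v : 'cV[R]_d) : v != 0 -> dot ((Num.sqrt (dot v v))^-1 *: v)
      ((Num.sqrt (dot v v))^-1 *: v) = 1.
    by move=> v0; rewrite dotZl dotZr mulrA -expr2 exprVn sqr_sqrtr ?dot_ge0// mulVf ?dot_eq0.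
  have attain (v : 'cV[R]_d) l A : v != 0 -> qf A v = l * qf 1%:M v ->
      qf A ((Num.sqrt (dot v v))^-1 *: v) = l.
    move=> v0 h; rewrite qfZv h qf1 exprVn sqr_sqrtr ?dot_ge0// mulrCA mulVf ?mulr1//.
    by rewrite dot_eq0.
  rewrite /S; have [_|_] := leP l1 l2.
    exists ((Num.sqrt (dot u2 u2))^-1 *: u2); split; first exact: norma.
    by have := attain _ _ _ u20 eq2; rewrite qfN => <-; rewrite -normrN ler_norm.
  exists ((Num.sqrt (dot u1 u1))^-1 *: u1); split; first exact: norma.
  by have := attain _ _ _ u10 eq1 => <-; rewrite ler_norm.
have u1le : dot u u <= 1 by rewrite u1'.
have [k kn kd] := net_cover u1le.
have S0 : 0 <= S by have := upS u; rewrite u1' mulr1; exact: le_trans.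
pose a := u - net_vec k; pose b := u + net_vec k.
have da : dot a a <= 16^-1.
  apply: le_trans kd _; rewrite (_ : 16^-1 = 4^-1 ^+ 2); last by field.
  by rewrite lerXn2r ?nnegrE ?invr_ge0// lef_pV2 ?posrE// ler_nat.
have kle := net_le1 kn.
have db : dot b b <= 4.
  have := dot_ge0 a; rewrite /a /b !(dotDl, dotDr, dotNl, dotNr).
  by rewrite (dotC (net_vec k) u); lra.
have ab : qf M u - qf M (net_vec k) = dot a (M *m b).
  rewrite /a /b mulmxDr !(dotDl, dotDr, dotNl, dotNr) (dot_sym (net_vec k) u Ms).
  by rewrite /qf; ring.
clearbody a b.
have hab : `|dot a (M *m b)| <= S / 2.
  (* The weight 8 balances [|a| <= 1 / 4] against [|b| <= 2]: polarisation gives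
     [32 |(a, M b)| <= 16 S]. *)
  have := upS (8 *: a + b); have := upS (8 *: a - b).
  rewrite !qf_add// qfNv mulmxN dotZl dotNr dotZl.
  rewrite !(dotDl, dotDr, dotNl, dotNr, dotZl, dotZr) (dotC b a).
  have h1 := ler_wpM2l S0 da; have h2 := ler_wpM2l S0 db.
  rewrite !ler_norml => /andP[h3 h4] /andP[h5 h6].
  by apply/andP; split; lra.
have Sd : S <= delta.
  have := hnet k kn; rewrite -qM => h.
  have : `|qf M u| <= delta / 2 + S / 2.
    rewrite -(subrK (qf M (net_vec k)) (qf M u)) ab addrC.
    by apply: le_trans (ler_normD _ _) _; exact: lerD.
  by move: uS; lra.
move=> p; rewrite -qM; apply: le_trans (upS p) _.
by rewrite ler_wpM2r// dot_ge0.
Qed.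

Lemma psi_sqr_lipschitz (a b : R) : `|psi (a ^+ 2) - psi (b ^+ 2)| <= `|a - b|.
Proof.
have a2 := sqr_ge0 a; have b2 := sqr_ge0 b.
have p0 : 0 < (1 + a ^+ 2) * (1 + b ^+ 2) by rewrite mulr_gt0//; lra.
have -> : psi (a ^+ 2) - psi (b ^+ 2) =
    (a - b) * ((a + b) / ((1 + a ^+ 2) * (1 + b ^+ 2))).
  by rewrite /psi; field; rewrite !gt_eqF//; lra.
rewrite normrM ler_piMr// normrM normfV [`|_ * _|]gtr0_norm//.
rewrite ler_pdivrMr// mul1r; apply: le_trans (ler_normD _ _) _.
have ha : 2 * `|a| <= 1 + a ^+ 2.
  by have := sqr_ge0 (1 - `|a|); rewrite -[in a ^+ 2]real_normK ?num_real// !expr2; lra.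
have hb : 2 * `|b| <= 1 + b ^+ 2.
  by have := sqr_ge0 (1 - `|b|); rewrite -[in b ^+ 2]real_normK ?num_real// !expr2; lra.
have h3 : 0 <= a ^+ 2 * b ^+ 2 by rewrite mulr_ge0.
lra.
Qed.

Let A p j := d%:R * dot (y j) p ^+ 2.

(** Replacing a unit vector by a net point costs [3 / 2 * rho * n], by isotropy; for two vectors
    this is at most [c1 / 4 * n], as [12 <= c1 * N]. The minimum then dominates the product, since
    [psi] is at most 1 and at most its argument. *)
Lemma spread_of_net : 12 <= c1 * N%:R ->
  (forall p, Q p <= 2 * dot p p) ->
  (forall k l, in_net k -> in_net l ->
     4^-1 <= dot (net_vec k) (net_vec k) -> 4^-1 <= dot (net_vec l) (net_vec l) ->
     c1 / 2 * n%:R <= \sum_j psi (A (net_vec k) j) * psi (A (net_vec l) j)) ->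
  forall p q, c1 / 4 * (dot p p * dot q q) <=
    d%:R / n%:R * \sum_j Num.min (dot (y j) p ^+ 2 * dot q q)
                                 (dot (y j) q ^+ 2 * dot p p).
Proof.
move=> cN Q2 hnet.
pose rho : R := N%:R^-1.
have rho0 : 0 < rho by rewrite invr_gt0.
have A0 p j : 0 <= A p j by rewrite mulr_ge0 ?sqr_ge0// ltW.
have drift p k : dot (p - net_vec k) (p - net_vec k) <= rho ^+ 2 ->
    \sum_j `|psi (A p j) - psi (A (net_vec k) j)| <= 3 / 2 * rho * n%:R.
  move=> pk.
  have AE r j : A r j = (Num.sqrt d%:R * dot (y j) r) ^+ 2.
    by rewrite exprMn sqr_sqrtr// ltW.
  (* The bound [|e| <= (rho + e^2 / rho) / 2] trades an absolute value for a square, whose sum over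
     the samples isotropy controls. *)
  have h j : `|psi (A p j) - psi (A (net_vec k) j)| <=
      (rho + A (p - net_vec k) j / rho) / 2.
    rewrite !AE; apply: le_trans (psi_sqr_lipschitz _ _) _.
    rewrite -mulrBr -dotBr; set e := _ * dot _ _.
    have := sqr_ge0 (rho - `|e|); rewrite -[in e ^+ 2]real_normK ?num_real//.
    move: `|e| => z hz.
    have h2 : z <= (rho + z ^+ 2 / rho) / 2 <-> 2 * z * rho <= rho ^+ 2 + z ^+ 2.
      rewrite ler_pdivlMr// (_ : rho + z ^+ 2 / rho = (rho ^+ 2 + z ^+ 2) / rho).
        by rewrite ler_pdivlMr// [z * 2]mulrC.
      by field; rewrite gt_eqF.
    by apply/h2; move: hz; rewrite !expr2; lra.
  apply: le_trans (ler_sum _ (fun j _ => h j)) _.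
  rewrite -mulr_suml big_split/= sumr_const card_ord -mulr_suml -mulr_natr.
  have q2 : \sum_j A (p - net_vec k) j <= 2 * rho ^+ 2 * n%:R.
    have := Q2 (p - net_vec k).
    rewrite /Q mulrAC ler_pdivrMr// mulr_sumr => hh; apply: le_trans hh _.
    by rewrite ler_wpM2r ?(ltW nR)// ler_wpM2l.
  have : (\sum_j A (p - net_vec k) j) / rho <= 2 * rho * n%:R.
    by rewrite ler_pdivrMr//; apply: le_trans q2 _; rewrite expr2; lra.
  by lra.
have unit_case p q : dot p p = 1 -> dot q q = 1 ->
    c1 / 4 * n%:R <= \sum_j psi (A p j) * psi (A q j).
  move=> p1 q1.
  have [k kn kd] := net_cover (ltac:(by rewrite p1) : dot p p <= 1).
  have [l ln ld] := net_cover (ltac:(by rewrite q1) : dot q q <= 1).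
  have big r m : dot r r = 1 -> dot (r - net_vec m) (r - net_vec m) <= N%:R^-1 ^+ 2 ->
      4^-1 <= dot (net_vec m) (net_vec m).
    move=> r1 rm.
    have : dot (r - net_vec m) (r - net_vec m) <= 16^-1.
      apply: le_trans rm _; rewrite (_ : 16^-1 = 4^-1 ^+ 2); last by field.
      by rewrite lerXn2r ?nnegrE ?invr_ge0// lef_pV2 ?posrE// ler_nat.
    have := dot_ge0 (r - 2 *: net_vec m).
    rewrite !(dotDl, dotDr, dotNl, dotNr, dotZl, dotZr) r1 (dotC (net_vec m) r).
    lra.
  have H := hnet k l kn ln (big _ _ p1 kd) (big _ _ q1 ld).
  have h1 := drift p k kd; have h2 := drift q l ld.
  have h3 : \sum_j psi (A (net_vec k) j) * psi (A (net_vec l) j) <=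
     \sum_j (psi (A p j) * psi (A q j) + (`|psi (A p j) - psi (A (net_vec k) j)| +
        `|psi (A q j) - psi (A (net_vec l) j)|)).
    apply: ler_sum => j _.
    have /andP[a0 a1] := psi_bounds (A0 p j).
    have /andP[b0 b1] := psi_bounds (A0 q j).
    have /andP[a0' a1'] := psi_bounds (A0 (net_vec k) j).
    have /andP[b0' b1'] := psi_bounds (A0 (net_vec l) j).
    move: (psi (A p j)) (psi (A q j)) (psi (A (net_vec k) j)) (psi (A (net_vec l) j))
      a0 a1 b0 b1 a0' a1' b0' b1' => a b a' b' a0 a1 b0 b1 a0' a1' b0' b1'.
    have e1 : (a' - a) * b' <= `|a - a'|.
      apply: le_trans (ler_norm _) _; rewrite normrM distrC ler_piMr//.
      by rewrite ger0_norm.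
    have e2 : a * (b' - b) <= `|b - b'|.
      apply: le_trans (ler_norm _) _; rewrite normrM [`|b' - b|]distrC ler_piMl//.
      by rewrite ger0_norm.
    lra.
  rewrite !big_split/= in h3.
  have h4 : 12 * rho <= c1 by rewrite /rho ler_pdivrMr.
  have h5 : 12 * rho * n%:R <= c1 * n%:R by rewrite ler_wpM2r// ltW.
  lra.
move=> p q; have [->|p0] := eqVneq p 0.
  rewrite dot0l mul0r mulr0 mulr_ge0 ?divr_ge0//; apply: sumr_ge0 => j _.
  by rewrite le_min dot0r expr0n mul0r mulr0 lexx.
have [->|q0] := eqVneq q 0.
  rewrite dot0l !mulr0 mulr_ge0 ?divr_ge0//; apply: sumr_ge0 => j _.
  by rewrite le_min dot0r expr0n mul0r mulr0 lexx.
pose s (r : 'cV[R]_d) := (Num.sqrt (dot r r))^-1.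
have s2 r : r != 0 -> s r ^+ 2 * dot r r = 1.
  by move=> r0; rewrite /s exprVn sqr_sqrtr ?dot_ge0// mulVf ?dot_eq0.
have norma r : r != 0 -> dot (s r *: r) (s r *: r) = 1.
  by move=> r0; rewrite dotZl dotZr mulrA -expr2 s2.
have pp : 0 < dot p p by rewrite dot_gt0.
have qq : 0 < dot q q by rewrite dot_gt0.
have := unit_case _ _ (norma p p0) (norma q q0).
rewrite -[c1 / 4 * n%:R]mulr1 => h.
have As r j : A (s r *: r) j = s r ^+ 2 * A r j by rewrite /A dotZr exprMn; ring.
have key j : psi (A (s p *: p) j) * psi (A (s q *: q) j) * (dot p p * dot q q) <=
    d%:R * Num.min (dot (y j) p ^+ 2 * dot q q) (dot (y j) q ^+ 2 * dot p p).
  have a0 := A0 (s p *: p) j; have b0 := A0 (s q *: q) j.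
  have /andP[h1 h2] := psi_bounds a0; have /andP[h3 h4] := psi_bounds b0.
  have psi_le (x : R) : 0 <= x -> psi x <= x.
    move=> x0; rewrite /psi ler_pdivrMr; last by lra.
    by rewrite mulrDr mulr1 lerDl mulr_ge0.
  have ha : A (s p *: p) j * dot p p = A p j by rewrite As mulrAC s2// mul1r.
  have hb : A (s q *: q) j * dot q q = A q j by rewrite As mulrAC s2// mul1r.
  rewrite minr_pMr ?(ltW dR)// le_min; apply/andP; split.
    rewrite [leRHS](_ : _ = A p j * dot q q); last by rewrite /A; ring.
    rewrite -ha -[leRHS]mulrA.
    apply: ler_wpM2r; first by rewrite mulr_ge0// ltW.
    by apply: (le_trans _ (psi_le _ a0)); apply: ler_piMr.
  rewrite [X in _ <= X](_ : _ = A q j * dot p p); last by rewrite /A; ring.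
  rewrite -hb -[leRHS]mulrA [dot q q * _]mulrC; apply: ler_wpM2r; first by rewrite mulr_ge0// ltW.
  by apply: (le_trans _ (psi_le _ b0)); apply: ler_piMl.
rewrite [leRHS]mulrAC ler_pdivlMr// [leRHS]mulr_sumr.
apply: (@le_trans _ _ (\sum_j psi (A (s p *: p) j) * psi (A (s q *: q) j) *
    (dot p p * dot q q))); last by apply: ler_sum => j _; exact: key.
rewrite -mulr_suml [leLHS]mulrAC; apply: ler_wpM2r.
  by rewrite mulr_ge0// ltW.
by rewrite mulr1 in h.
Qed.

End Transfer.
End Net.

(** * Concentration and elliptical directions *)

Section EventTools.
Context {R : realType} {disp : measure_display} {T : measurableType disp}.
Variable P : probability T R.

Lemma prob_eq_ae (E1 E2 O : set T) : measurable E1 -> measurable E2 ->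
  measurable O -> P O = 1%E -> (forall w, O w -> E1 w <-> E2 w) -> P E1 = P E2.
Proof.
move=> m1 m2 mO PO h; rewrite -[LHS]fineK ?fin_num_measure//.
rewrite -[RHS]fineK ?fin_num_measure// -!Ex_indic//; congr EFin.
apply: (Ex_eq_ae (bmeas_indic m1) (bmeas_indic m2) mO PO) => w Ow.
by rewrite !indicE; congr (_%:R); congr nat_of_bool; apply/idP/idP; rewrite !inE => /(h w Ow).
Qed.

Lemma prob_union (I : finType) (Q : pred I) (B : I -> set T) (b : R) :
  (forall i, measurable (B i)) -> (forall i, Q i -> (P (B i) <= b%:E)%E) ->
  (P (\big[setU/set0]_(i | Q i) B i) <= (#|Q|%:R * b)%:E)%E.
Proof.
move=> mB hB; have -> : #|Q|%:R * b = \sum_(i | Q i) b.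
  by rewrite sumr_const mulr_natl.
suff [] : measurable (\big[setU/set0]_(i | Q i) B i) /\
  (P (\big[setU/set0]_(i | Q i) B i) <= (\sum_(i | Q i) b)%:E)%E by [].
elim/big_ind2: _ => [|A x A' x' [mA Ax] [mA' Ax']|i Qi].
- by split=> //; rewrite measure0.
- split; first exact: measurableU.
  apply: le_trans (measureU2 P mA mA') _.
  by rewrite EFinD; exact: leeD.
- by split=> //; exact: hB.
Qed.

Lemma in_big_union (I : finType) (Q : pred I) (B : I -> set T) i w :
  Q i -> B i w -> (\big[setU/set0]_(i | Q i) B i) w.
Proof. by move=> Qi Bw; rewrite (bigD1 i)//=; left. Qed.

Context {d2 : measure_display} {U : measurableType d2}.
Variables (n : nat) (X : 'I_n -> T -> U).
Hypothesis mX : forall i, measurable_fun setT (X i).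
Hypothesis indX : mutually_independent P X.

Lemma chernoff (h : U -> R) (b t : R) : bmeas h ->
  (forall i, Ex P (fun w => expR (h (X i w))) <= expR b) ->
  (P [set w | t <= \sum_i h (X i w)]%R <= (expR (n%:R * b - t))%:E)%E.
Proof.
move=> bh hb.
have bX i : bmeas (fun w => h (X i w)) by exact: (bmeas_comp mX).
have bS : bmeas (fun w => expR (\sum_i h (X i w))) by exact/bmeas_exp/bmeas_sum.
have -> : [set w | t <= \sum_i h (X i w)] =
    [set w | expR t <= expR (\sum_i h (X i w))].
  by apply/seteqP; split=> w /=; rewrite ler_expR.
apply: le_trans (markov_bmeas P bS (fun w => expR_ge0 _) (expR_gt0 t)) _.
rewrite lee_fin ler_pdivrMr ?expR_gt0// -expRD subrK expRM_natl.
have -> : (fun w => expR (\sum_i h (X i w))) = (fun w => \prod_i expR (h (X i w))).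
  by apply/funext => w; rewrite expR_sum.
rewrite (Ex_prod_indep mX indX (h := fun _ u => expR (h u))) => [|i|i u]; last 2 first.
- exact: bmeas_exp.
- exact: expR_ge0.
apply: le_trans (_ : \prod_(i < n) expR b <= _); last by rewrite prodr_const card_ord.
by apply: ler_prod => i _; rewrite hb andbT Ex_ge0// => w; exact: expR_ge0.
Qed.

End EventTools.

(** * Law of the normalised samples *)

Section EllipticalDirection.
Context {R : realType} {d : nat}.
Variable S : 'M[R]_d.
Hypothesis pS : posdefmx S.
Let H := sqrtmx S.

(** At 0 the inverse norm is [0^-1 = 0], so a zero sample shows up as a direction that is not a unit
    vector. *)
Definition direction (x : 'cV[R]_d) : 'cV[R]_d :=
  (norm2 (invmx H *m x))^-1 *: (invmx H *m x).

Lemma sqrtmx_unit : H \in unitmx.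
Proof.
have [_ HH] := sqrtmxP pS.
by have := pd_unitmx pS; rewrite -HH unitmx_mul => /andP[].
Qed.

Lemma dot_direction x : x != 0 -> dot (direction x) (direction x) = 1.
Proof.
move=> x0; rewrite /direction dotZl dotZr mulrA -expr2 exprVn sqr_norm2 mulVf//.
rewrite dot_eq0; apply: contra_neq x0 => h.
by rewrite -[LHS](mulKVmx sqrtmx_unit) h mulmx0.
Qed.

Lemma dot_direction_le1 x : dot (direction x) (direction x) <= 1.
Proof.
have [->|/dot_direction->//] := eqVneq x 0.
by rewrite /direction mulmx0 scaler0 dot0l.
Qed.

Lemma measurable_coord (i : 'I_d) :
  measurable_fun setT (fun x : borel_cV R d => (x : 'cV[R]_d) i 0).
Proof.
apply: (measurability _ (RGenOInfty.measurableE R)).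
move=> _ [_ [a ->] <-]; rewrite setTI; apply: sub_sigma_algebra.
have : open (`]a, +oo[%classic : set R) by exact: interval_open.
by have /continuousP := @coord_continuous R d 1 i 0; exact.
Qed.

Lemma measurable_fun_direction dd (T' : measurableType dd) (W : T' -> 'cV[R]_d) :
  (forall i, measurable_fun setT (fun w => W w i 0)) ->
  forall i, measurable_fun setT (fun w => direction (W w) i 0).
Proof.
move=> mW i; pose z k w : R := \sum_j invmx H k j * W w j 0.
have mz k : measurable_fun setT (z k).
  by apply: measurable_sum => j; exact: measurable_funM.
have -> : (fun w => direction (W w) i 0) =
    (fun w => (((\sum_k z k w ^+ 2) `^ 2^-1) `^ (-1)) * z i w).
  apply/funext => w; rewrite /direction !mxE; congr (_ * _).
  rewrite powR_inv1 ?powR_ge0// powR12_sqrt; last by apply: sumr_ge0 => k _; exact: sqr_ge0.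
  rewrite /norm2; congr (_^-1); congr Num.sqrt; apply: eq_bigr => k _.
  by rewrite mxE.
apply: measurable_funM => //.
apply: (measurableT_comp (measurable_powR _)).
apply: (measurableT_comp (measurable_powR _)).
by apply: measurable_sum => k; exact: measurable_funX.
Qed.

Lemma measurable_direction i :
  measurable_fun setT (fun x : borel_cV R d => direction (x : 'cV[R]_d) i 0).
Proof.
apply: (@measurable_fun_direction _ (borel_cV R d) (fun x => x)) => k.
exact: measurable_coord.
Qed.

Lemma measurable_dot_direction p :
  measurable_fun setT (fun x : borel_cV R d => dot (direction (x : 'cV[R]_d)) p).
Proof.
by apply: measurable_sum => i; apply: measurable_funM => //; exact: measurable_direction.
Qed.

(** Whitening and normalising give back [v] up to the sign of [c], which the square removes; hence
    invariance is stated for squared inner products. *)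
Lemma direction_scaled (c : R) (v : 'cV[R]_d) p : c != 0 -> dot v v = 1 ->
  dot (direction (c *: (H *m v))) p ^+ 2 = dot v p ^+ 2.
Proof.
move=> c0 v1; rewrite /direction -scalemxAr mulKmx ?sqrtmx_unit//.
rewrite !dotZl !exprMn exprVn sqr_norm2 dotZl dotZr v1 mulr1 -expr2 mulrA.
by rewrite mulVf ?mul1r// expf_neq0.
Qed.

Context {d1 d2 : measure_display} {T : measurableType d1} {T0 : measurableType d2}.
Variables (P : probability T R) (P0 : probability T0 R) (u : {RV P0 >-> R}).
Hypothesis u_neq0 : P0 (u @^-1` [set 0]) = 0%E.
Variable X : {RV P >-> borel_cV R d}.
Hypothesis ellX : elliptical u S X.

Let Y w := direction (X w : 'cV[R]_d).

(** Equality of laws transports events to the space carrying [V]. There, off the null set where [u1]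
    vanishes or [V] is not a unit vector, the direction is [V] up to sign. *)
Lemma elliptical_direction_law :
  P [set w | dot (Y w) (Y w) = 1] = 1%E /\
  forall p q : 'cV[R]_d, dot p p = dot q q ->
    same_law P P (fun w => dot (Y w) p ^+ 2) (fun w => dot (Y w) q ^+ 2).
Proof.
case: ellX => d3 [T1 [P1 [V [u1 [[V1 Vinv] uu _ law]]]]].
have mV i : measurable_fun setT (fun w => (V w : 'cV[R]_d) i 0).
  by apply: (measurableT_comp (measurable_coord i)).
have mVd p : measurable_fun setT (fun w => dot (V w : 'cV[R]_d) p).
  by apply: measurable_sum => i; exact: measurable_funM.
pose Z := (u1 @^-1` [set 0])%classic.
have mZ : measurable Z by rewrite -[Z]setTI; exact: measurable_funP.
have PZ : P1 Z = 0%E by rewrite /Z uu.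
pose O1 := V @^-1` [set v : 'cV[R]_d | norm2 v = 1].
have O1E : O1 = [set w | dot (V w : 'cV[R]_d) (V w) = 1].
  by apply/seteqP; split=> w; rewrite /O1/= => /norm2_eq1.
have meq1 dd (T' : measurableType dd) (f : T' -> R) : measurable_fun setT f ->
    measurable [set w | f w = 1].
  by move=> mf; rewrite -[X in measurable X]setTI; exact: (mf measurableT [set 1]).
have mO1 : measurable O1.
  rewrite O1E; apply: meq1; apply: measurable_sum => i; exact: measurable_funM.
pose G := ~` Z `&` O1.
have mG : measurable G by apply: measurableI => //; exact: measurableC.
have PG : P1 G = 1%E.
  rewrite -V1; apply: (@prob_eq_ae _ _ _ P1 _ _ (~` Z)) => //.
  - exact: measurableC.
  - by rewrite probability_setC// PZ sube0.
  - by move=> w Ow; split=> [[]//|h]; split.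
have GE w : G w -> u1 w != 0 /\ dot (V w : 'cV[R]_d) (V w) = 1.
  by move=> [/= /eqP u0]; rewrite O1E.
pose W w : borel_cV R d := u1 w *: (H *m (V w : 'cV[R]_d)).
have mW i : measurable_fun setT (fun w => (W w : 'cV[R]_d) i 0).
  have -> : (fun w => (W w : 'cV[R]_d) i 0) =
      (fun w => u1 w * \sum_j H i j * (V w : 'cV[R]_d) j 0).
    by apply/funext => w; rewrite !mxE.
  by apply: measurable_funM => //; apply: measurable_sum => j; exact: measurable_funM.
have lawB (f : borel_cV R d -> R) (B : set R) : measurable_fun setT f ->
    measurable B -> P ((f \o X) @^-1` B) = P1 ((f \o W) @^-1` B).
  move=> mf mB; have mfB : measurable (f @^-1` B).
    by rewrite -[X in measurable X]setTI; exact: mf.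
  by have := law _ mfB.
have mdW i : measurable_fun setT (fun w => direction (W w) i 0).
  exact: measurable_fun_direction.
have mpre dd (T' : measurableType dd) (f : T' -> R) (B : set R) :
    measurable_fun setT f -> measurable B -> measurable (f @^-1` B).
  by move=> mf mB; rewrite -[X in measurable X]setTI; exact: mf.
split.
  have mf : measurable_fun setT (fun x : borel_cV R d =>
      dot (direction (x : 'cV[R]_d)) (direction (x : 'cV[R]_d))).
    by apply: measurable_sum => i; apply: measurable_funM; exact: measurable_direction.
  have mfW : measurable_fun setT (fun w => dot (direction (W w)) (direction (W w))).
    by apply: measurable_sum => i; exact: measurable_funM.
  transitivity (P1 [set w | dot (direction (W w)) (direction (W w)) = 1]).
    exact: (lawB _ [set 1] mf).
  rewrite -(probability_setT P1); apply: (@prob_eq_ae _ _ _ P1 _ _ G) => //.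
    exact: meq1.
  move=> w /GE[u0 v1]; split=> // _ /=; apply: dot_direction.
  rewrite /W scaler_eq0 negb_or u0/=; apply/eqP => h.
  have v0 : (V w : 'cV[R]_d) = 0 by rewrite -[LHS](mulKmx sqrtmx_unit) h mulmx0.
  by move/eqP: v1; rewrite v0 dot0l eq_sym oner_eq0.
move=> p q pq B mB.
have red r : P ((fun w => dot (Y w) r ^+ 2) @^-1` B) =
    P1 ((fun w => dot (V w : 'cV[R]_d) r ^+ 2) @^-1` B).
  have mf : measurable_fun setT (fun x : borel_cV R d =>
      dot (direction (x : 'cV[R]_d)) r ^+ 2).
    by apply: measurable_funX; exact: measurable_dot_direction.
  have mfW : measurable_fun setT (fun w => dot (direction (W w)) r ^+ 2).
    by apply: measurable_funX; apply: measurable_sum => i; exact: measurable_funM.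
  transitivity (P1 ((fun w => dot (direction (W w)) r ^+ 2) @^-1` B)).
    exact: (lawB _ B mf).
  apply: (@prob_eq_ae _ _ _ P1 _ _ G) => //; [exact: mpre| |].
    by apply: mpre => //; exact: measurable_funX.
  by move=> w /GE[u0 v1]; rewrite /= /W direction_scaled.
(* The reflection carrying [p] to [q] is orthogonal, and moving it from [V] to the test vector turns
   [p] into [q]. *)
rewrite !red; have [Q [Qs QQ Qp]] := householder pq.
have QtQ : Q^T *m Q = 1%:M by rewrite Qs.
have mf : measurable_fun setT (fun x : borel_cV R d => dot (x : 'cV[R]_d) p ^+ 2).
  apply: measurable_funX; apply: measurable_sum => i; apply: measurable_funM => //.
  exact: measurable_coord.
have := Vinv Q QtQ _ (mpre _ _ _ _ mf mB).
set E1 := (X in P1 X = _ -> _); set E2 := (X in _ = P1 X -> _) => e12.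
transitivity (P1 E2); first exact: e12.
congr (P1 _); apply/seteqP; split=> w; rewrite /E2 /= dot_mulmxl Qs Qp //.
Qed.

End EllipticalDirection.

(** * The good event *)

Section GoodEvent.
Context {R : realType} {d n N : nat}.
Variable S : 'M[R]_d.
Hypotheses (pS : posdefmx S) (d_gt0 : (0 < d)%N) (n_gt0 : (0 < n)%N) (N_gt0 : (0 < N)%N).
Context {d1 d2 : measure_display} {T : measurableType d1} {T0 : measurableType d2}.
Variables (P : probability T R) (P0 : probability T0 R) (u : {RV P0 >-> R}).
Hypothesis u_neq0 : P0 (u @^-1` [set 0]) = 0%E.
Variable x : 'I_n -> {RV P >-> borel_cV R d}.
Hypothesis indx : mutually_independent P (fun j => x j : T -> borel_cV R d).
Hypothesis ellx : forall j, elliptical u S (x j).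

Let dir (v : borel_cV R d) : 'cV[R]_d := direction S (v : 'cV[R]_d).
Let y j w := dir (x j w).
Let A p (v : borel_cV R d) := d%:R * dot (dir v) p ^+ 2.
Let K : R := 2 ^+ 15.
Let K0 : 0 < K. Proof. by rewrite exprn_gt0. Qed.
Let nR : 0 < n%:R :> R. Proof. by rewrite ltr0n. Qed.
Let c1 : R := spread_cst.
Let c10 : 0 < c1. Proof. exact: spread_cst_gt0. Qed.

Let mx j : measurable_fun setT (x j : T -> borel_cV R d).
Proof. exact: measurable_funP. Qed.

Let my j i : measurable_fun setT (fun w => y j w i 0).
Proof. by apply: (measurableT_comp (measurable_direction S i)); exact: mx. Qed.

Let y_le1 j w : dot (y j w) (y j w) <= 1.
Proof. exact: dot_direction_le1. Qed.

Let m_unit j : measurable [set w | dot (y j w) (y j w) = 1].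
Proof.
rewrite -[X in measurable X]setTI.
have m : measurable_fun setT (fun w => dot (y j w) (y j w)).
  by apply: measurable_sum => i; exact: measurable_funM.
exact: (m measurableT [set 1]).
Qed.

Let y_as1 j : exists B : set T,
  [/\ measurable B, P B = 1%E & forall w, B w -> dot (y j w) (y j w) = 1].
Proof.
exists [set w | dot (y j w) (y j w) = 1]; split=> //.
by have [] := elliptical_direction_law pS u_neq0 (ellx j).
Qed.

Let y_inv j (p q : 'cV[R]_d) : dot p p = dot q q ->
  same_law P P (fun w => dot (y j w) p ^+ 2) (fun w => dot (y j w) q ^+ 2).
Proof. by have [_] := elliptical_direction_law pS u_neq0 (ellx j); exact. Qed.

Let bA p : bmeas (A p).
Proof.
apply: bmeasM; first exact: bmeas_cst.
apply/bmeasX/bmeas_dot; first by move=> i; exact: measurable_direction.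
by move=> v; exact: dot_direction_le1.
Qed.

Let A0 p v : 0 <= A p v. Proof. by rewrite mulr_ge0 ?sqr_ge0. Qed.

(** [|l| = delta / (4 * K)] minimises the exponent [K l^2 - |l| delta / 2] per sample; the two signs
    of [l] give the two tails. *)
Lemma deviation_prob (delta l : R) (p : 'cV[R]_d) : dot p p <= 1 ->
  0 < delta -> delta <= 1 -> `|l| = delta / (4 * K) ->
  (P [set w | n%:R * (delta ^+ 2 / (8 * K)) <=
       \sum_j l * (A p (x j w) - dot p p)]%R <=
   (expR (- (n%:R * (delta ^+ 2 / (16 * K)))))%:E)%E.
Proof.
move=> p1 delta0 delta1 le.
have l2 : K * l ^+ 2 = delta ^+ 2 / (16 * K).
  by rewrite -[l ^+ 2]real_normK ?num_real// le; field; rewrite gt_eqF.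
have l128 : `|l| <= 128^-1.
  rewrite le ler_pdivrMr ?mulr_gt0//; apply: le_trans delta1 _.
  have -> : K = 32 * 1024 by rewrite /K; ring.
  lra.
pose h v := l * (A p v - dot p p).
have bh : bmeas h.
  apply: bmeasM; first exact: bmeas_cst.
  by apply: bmeasB => //; exact: bmeas_cst.
have mgf j : Ex P (fun w => expR (h (x j w))) <= expR (K * l ^+ 2).
  exact: (Ex_mgf d_gt0 (my j) (y_le1 j) (y_as1 j) (y_inv j) p1 l128).
have := chernoff mx indx (n%:R * (delta ^+ 2 / (8 * K))) bh mgf.
rewrite l2 (_ : n%:R * (delta ^+ 2 / (16 * K)) - n%:R * (delta ^+ 2 / (8 * K)) =
  - (n%:R * (delta ^+ 2 / (16 * K))))//.
by field; rewrite gt_eqF.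
Qed.

Lemma spread_prob (p q : 'cV[R]_d) : 4^-1 <= dot p p -> dot p p <= 1 ->
  4^-1 <= dot q q -> dot q q <= 1 ->
  (P [set w | - (c1 ^+ 2 / 8 * n%:R) <=
       \sum_j - (c1 / 4) * (psi (A p (x j w)) * psi (A q (x j w)))]%R <=
   (expR (- (n%:R * (c1 ^+ 2 / 16))))%:E)%E.
Proof.
(* [s = c1 / 4] minimises the exponent [s^2 - s c1 / 2] for the event that the average falls to half
   of [c1]. *)
move=> p0 p1 q0 q1; pose s := c1 / 4.
have s0 : 0 < s by rewrite divr_gt0.
pose g v := psi (A p v) * psi (A q v).
have bg : bmeas g by apply: bmeasM; exact: bmeas_psi.
have g01 v : 0 <= g v <= 1.
  have /andP[h1 h2] := psi_bounds (A0 p v); have /andP[h3 h4] := psi_bounds (A0 q v).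
  by rewrite /g mulr_ge0//= mulr_ile1.
pose h v := - s * g v.
have bh : bmeas h by apply: bmeasM => //; exact: bmeas_cst.
have mgf j : Ex P (fun w => expR (h (x j w))) <= expR (- s * c1 + s ^+ 2).
  have bgx : bmeas (fun w => g (x j w)) by exact: (bmeas_comp mx).
  have Eg : c1 <= Ex P (fun w => g (x j w)).
    exact: (Ex_psi d_gt0 (my j) (y_le1 j) (y_as1 j) (y_inv j) p0 p1 q0 q1).
  have bsg : bmeas (fun w => - s * g (x j w)) by exact: (bmeas_comp mx j bh).
  apply: (@le_trans _ _ (Ex P (fun w => - s * g (x j w) + (1 + s ^+ 2)))).
    apply: Ex_le => [||w]; first exact: (bmeas_exp (bmeas_comp mx j bh)).
      by apply: bmeasD => //; exact: bmeas_cst.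
    have /andP[h1 h2] := g01 (x j w).
    have h3 : 0 <= s * g (x j w) by rewrite mulr_ge0// ltW.
    have := expRN_le_quadratic h3; rewrite /h mulNr => h4.
    have h5 : (s * g (x j w)) ^+ 2 <= s ^+ 2.
      by rewrite lerXn2r ?nnegrE ?(ltW s0)// ler_piMr// ltW.
    lra.
  rewrite ExD//; last exact: bmeas_cst.
  rewrite Ex_cst ExZ//.
  apply: le_trans (expR_ge1Dx _).
  have := ler_wpM2l (ltW s0) Eg; lra.
have := chernoff mx indx (- (c1 ^+ 2 / 8 * n%:R)) bh mgf.
rewrite (_ : n%:R * (- s * c1 + s ^+ 2) - - (c1 ^+ 2 / 8 * n%:R) =
  - (n%:R * (c1 ^+ 2 / 16)))//.
by rewrite /s; field.
Qed.

Lemma good_event (delta : R) : 0 < delta -> delta <= 1 ->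
  let m : R := #|@in_net R d N|%:R in
  exists2 B : set T, measurable B /\
   ((1 - (2 * (m * expR (- (n%:R * (delta ^+ 2 / (16 * K))))) +
      m ^+ 2 * expR (- (n%:R * (c1 ^+ 2 / 16)))))%:E <= P B)%E &
  forall w, B w -> [/\ forall j, (x j w : 'cV[R]_d) != 0,
    forall k, @in_net R d N k ->
      `|d%:R / n%:R * \sum_j dot (y j w) (net_vec k) ^+ 2 -
        dot (net_vec k) (net_vec k)| <= delta / 2 &
    forall k l, @in_net R d N k -> @in_net R d N l ->
     4^-1 <= dot (net_vec k : 'cV[R]_d) (net_vec k) ->
     4^-1 <= dot (net_vec l : 'cV[R]_d) (net_vec l) ->
     c1 / 2 * n%:R <= \sum_j psi (d%:R * dot (y j w) (net_vec k) ^+ 2) *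
                             psi (d%:R * dot (y j w) (net_vec l) ^+ 2)].
Proof.
move=> delta0 delta1 m.
pose v (k : net_index d N) : 'cV[R]_d := net_vec k.
(* Four ways to fail: a direction that is not a unit vector, a form too large or too small at a net
   point, too little overlap at a pair. The first is null, the last accounts for [m ^+ 2]. *)
pose B0 := \big[setU/set0]_(j | true) ~` [set w | dot (y j w) (y j w) = 1].
pose E l k := [set w | n%:R * (delta ^+ 2 / (8 * K)) <=
       \sum_j l * (A (v k) (x j w) - dot (v k) (v k))].
pose l := delta / (4 * K).
have l0 : 0 < l by rewrite divr_gt0// mulr_gt0.
pose B1 := \big[setU/set0]_(k | @in_net R d N k) E l k.
pose B2 := \big[setU/set0]_(k | @in_net R d N k) E (- l) k.
pose F (kl : net_index d N * net_index d N) :=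
  [set w | - (c1 ^+ 2 / 8 * n%:R) <=
       \sum_j - (c1 / 4) * (psi (A (v kl.1) (x j w)) * psi (A (v kl.2) (x j w)))].
pose Q (kl : net_index d N * net_index d N) :=
  [&& @in_net R d N kl.1, @in_net R d N kl.2, 4^-1 <= dot (v kl.1) (v kl.1) &
      4^-1 <= dot (v kl.2) (v kl.2)].
pose B3 := \big[setU/set0]_(kl | Q kl) F kl.
have bAx p j : bmeas (fun w => A p (x j w)) by exact: (bmeas_comp mx).
have mE a k : measurable (E a k).
  apply: measurable_ge; apply: measurable_sum => j.
  by apply: measurable_funM => //; apply: measurable_funB => //; have [] := bAx (v k) j.
have mpsi p j : measurable_fun setT (fun w => psi (A p (x j w))).
  by have [] := bmeas_psi (bAx p j) (fun w => A0 p (x j w)).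
have mF kl : measurable (F kl).
  apply: measurable_ge; apply: measurable_sum => j; apply: measurable_funM => //.
  by apply: measurable_funM; exact: mpsi.
have mB0' j : measurable (~` [set w | dot (y j w) (y j w) = 1]).
  exact: measurableC.
have mB0 : measurable B0 by apply: bigsetU_measurable => j _.
have mB1 : measurable B1 by apply: bigsetU_measurable => j _.
have mB2 : measurable B2 by apply: bigsetU_measurable => j _.
have mB3 : measurable B3 by apply: bigsetU_measurable => j _.
pose e1 := expR (- (n%:R * (delta ^+ 2 / (16 * K)))).
pose e3 := expR (- (n%:R * (c1 ^+ 2 / 16))).
have h0 : (P B0 <= 0%:E)%E.
  have := @prob_union _ _ _ P _ xpredT _ 0 mB0'; rewrite mulr0; apply=> j _.
  have [h _] := elliptical_direction_law pS u_neq0 (ellx j).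
  rewrite probability_setC//; rewrite [X in (1 - X)%E](_ : _ = 1%E) //.
  by rewrite -EFinB subrr.
have h1 : (P B1 <= (m * e1)%:E)%E.
  apply: prob_union => // k kn; apply: deviation_prob => //; first exact: net_le1.
  by rewrite gtr0_norm.
have h2 : (P B2 <= (m * e1)%:E)%E.
  apply: prob_union => // k kn; apply: deviation_prob => //; first exact: net_le1.
  by rewrite normrN gtr0_norm.
have h3 : (P B3 <= (m ^+ 2 * e3)%:E)%E.
  apply: (@le_trans _ _ (#|Q|%:R * e3)%:E).
    apply: prob_union => // kl /and4P[k1 k2 k3 k4].
    by apply: spread_prob => //; exact: net_le1.
  rewrite lee_fin ler_wpM2r ?expR_ge0// /m -natrX ler_nat -mulnn -cardX.
  apply: subset_leq_card; apply/fintype.subsetP => -[k k']; rewrite !inE /=.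
  by move=> /and4P[h1' h2' _ _]; apply/andP; split.
pose B := B0 `|` B1 `|` B2 `|` B3.
have mB01 := measurableU _ _ mB0 mB1.
have mB012 := measurableU _ _ mB01 mB2.
have mB : measurable B by exact: measurableU.
exists (~` B).
  split; first exact: measurableC.
  rewrite probability_setC// EFinB; apply: leeB => //.
  rewrite (_ : 2 * _ + _ = 0 + m * e1 + m * e1 + m ^+ 2 * e3); last by rewrite /e1 /e3; ring.
  rewrite EFinD; apply: le_trans (measureU2 P mB012 mB3) _; apply: leeD => //.
  rewrite EFinD; apply: le_trans (measureU2 P mB01 mB2) _; apply: leeD => //.
  by rewrite EFinD; apply: le_trans (measureU2 P mB0 mB1) _; exact: leeD.
move=> w nB; split.
- move=> j; apply/eqP => xj0; apply: nB; left; left; left.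
  apply: (in_big_union (i := j)) => //= h.
  move/eqP: h; rewrite /y /dir xj0 /direction mulmx0 scaler0 dot0l eq_sym.
  by rewrite oner_eq0.
- move=> k kn; set p : 'cV[R]_d := net_vec k.
  have SE a : \sum_j a * (A p (x j w) - dot p p) =
      a * (n%:R * (d%:R / n%:R * \sum_j dot (y j w) p ^+ 2 - dot p p)).
    rewrite -mulr_sumr sumrB sumr_const card_ord -mulr_sumr; congr (_ * _).
    by rewrite -[X in _ - X = _]mulr_natl; field; rewrite gt_eqF.
  have tE : n%:R * (delta ^+ 2 / (8 * K)) = l * (n%:R * (delta / 2)).
    by rewrite /l; field; rewrite gt_eqF.
  rewrite ler_norml; apply/andP; split.
    apply: contra_notT nB; rewrite -ltNge => h; left; right.
    apply: (in_big_union (i := k)) => //; rewrite /E /= -/p SE tE mulNr -mulrN.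
    by rewrite ler_pM2l// -mulrN ler_pM2l//; lra.
  apply: contra_notT nB; rewrite -ltNge => h; left; left; right.
  apply: (in_big_union (i := k)) => //; rewrite /E /= -/p SE tE.
  by rewrite ler_pM2l// ler_pM2l//; lra.
- move=> k k' kn kn' k4 k4'; apply: contra_notT nB; rewrite -ltNge => h; right.
  apply: (in_big_union (i := (k, k'))); first by apply/and4P.
  rewrite /F /= -mulr_sumr; set Z := \sum_(_ < _) _ in h *.
  have c4 : 0 < c1 / 4 by rewrite divr_gt0.
  have := h; rewrite -(ltr_pM2l c4) => /ltW h4.
  rewrite (_ : c1 ^+ 2 / 8 * n%:R = c1 / 4 * (c1 / 2 * n%:R)); last by field.
  by rewrite mulNr lerN2.
Qed.

End GoodEvent.

(** * Choice of the constants *)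

Lemma spread_cst_le1 (R : realType) : spread_cst <= 1 :> R.
Proof.
rewrite ler_pdivrMr ?mul1r ?mulr_gt0 ?exprn_gt0//.
have h1 : 48^-1 ^+ 2 <= 1 :> R by rewrite expr_le1//; lra.
have h2 : 1 <= 128 ^+ 4 :> R by rewrite exprn_ege1//; lra.
lra.
Qed.

(** The union bound costs [2 * L * d] for pairs of net points and 2 for the three terms, as
    [3 <= expR 2]. The lower bound on [t] makes this at most half of [k1 * t]. *)
Lemma failure_prob_le (R : realType) (k1 k2 L t d m : R) :
  0 < k1 -> k1 <= k2 -> 0 <= L -> 1 <= d -> 0 <= m -> m <= expR (L * d) ->
  0 <= t -> (2 + 2 * L) * 2 / k1 * d <= t -> forall n, t <= n ->
  2 * (m * expR (- (k1 * t))) + m ^+ 2 * expR (- (k2 * n)) <= expR (- (k1 / 2 * t)).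
Proof.
move=> k10 k12 L0 d1 m0 mL t0 dt n tn.
set e := expR (L * d); set f := expR (- (k1 * t)).
have f0 : 0 <= f by exact: expR_ge0.
have e1 : 1 <= e by rewrite -expR0 ler_expR mulr_ge0//; lra.
have h1 : m * f <= e ^+ 2 * f.
  by rewrite ler_wpM2r// (le_trans mL)// expr2 ler_peMl//; lra.
have h2 : m ^+ 2 * expR (- (k2 * n)) <= e ^+ 2 * f.
  apply: ler_pM; rewrite ?exprn_ge0 ?expR_ge0//.
    by rewrite lerXn2r ?nnegrE// (le_trans m0).
  by rewrite ler_expR lerN2 ler_pM// ltW.
have e3 : 3 <= expR 2 :> R by have := @expR_ge1Dx R 2; lra.
have h3 : 3 * (e ^+ 2 * f) <= expR 2 * (e ^+ 2 * f).
  by rewrite ler_wpM2r// mulr_ge0// exprn_ge0// expR_ge0.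
have h4 : expR 2 * (e ^+ 2 * f) <= expR (- (k1 / 2 * t)).
  rewrite /e /f -expRM_natl -!expRD ler_expR.
  have : (2 + 2 * L) * d <= k1 / 2 * t.
    move: dt; rewrite (_ : _ / k1 * d = ((2 + 2 * L) * d) / (k1 / 2)).
      by rewrite ler_pdivrMr ?divr_gt0// [t * _]mulrC.
    by field; rewrite gt_eqF.
  by lra.
lra.
Qed.

(** The shape matters only up to a scalar, which [u] can absorb, so its trace is normalised to that
    of the estimator. A zero sample leaves Tyler's equation without solution, so [u] must not vanish
    with positive probability. *)
Theorem theorem1p1 (R : realType) :
  exists C c eps0 : R, [/\ 0 < C, 0 < c, 0 < eps0 &
  forall (d n : nat) (eps : R), (0 < d)%N -> (0 < n)%N ->
    0 < eps -> eps <= eps0 -> C * (d%:R / eps ^+ 2) <= n%:R ->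
  forall (Sigma : 'M[R]_d), posdefmx Sigma -> \tr Sigma = d%:R ->
  forall (disp0 : measure_display) (T0 : measurableType disp0)
    (P0 : probability T0 R) (u : {RV P0 >-> R}),
    P0 (u @^-1` [set 0]) = 0%E ->
  forall (disp : measure_display) (T : measurableType disp)
    (P : probability T R) (x : 'I_n -> {RV P >-> borel_cV R d}),
    mutually_independent P (fun j => x j : T -> borel_cV R d) ->
    (forall j, elliptical u Sigma (x j)) ->
  exists2 A : set T, measurable A /\
      ((1 - expR (- (c * eps ^+ 2 * n%:R)))%:E <= P A)%E &
    forall w, A w ->
      exists2 Shat : 'M[R]_d, tyler_estimator (fun j => x j w) Shat &
        opnorm (1%:M - sqrtmx Sigma *m invmx Shat *m sqrtmx Sigma) <= eps].
Proof.
pose c1 : R := spread_cst; have c10 : 0 < c1 by exact: spread_cst_gt0.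
have c11 : c1 <= 1 by exact: spread_cst_le1.
(* Mesh for both transfers: [N >= 4] for isotropy, [N >= 12 / c1] for the spread. *)
pose N := ((Num.truncn (12 / c1)).+1 + 4)%N.
have N0 : (0 < N)%N by rewrite addn_gt0.
have N4 : (4 <= N)%N by rewrite leq_addl.
have cN : 12 <= c1 * N%:R.
  rewrite mulrC -ler_pdivrMr//; apply: le_trans (ltW (truncnS_gt _)) _.
  by rewrite ler_nat leq_addr.
pose K : R := 2 ^+ 15; have K0 : 0 < K by rewrite exprn_gt0.
have K1 : 1 <= K by rewrite exprn_ege1//; lra.
pose c0 := c1 / 4; have c00 : 0 < c0 by rewrite divr_gt0.
pose k1 := (c0 / 128) ^+ 2 / (16 * K).
have k10 : 0 < k1 by rewrite divr_gt0 ?exprn_gt0 ?mulr_gt0 ?divr_gt0.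
pose k2 := c1 ^+ 2 / 16.
have k12 : k1 <= k2.
  rewrite /k1 ler_pdivrMr ?mulr_gt0// /k2 /c0.
  have h1 : c1 ^+ 2 <= c1 ^+ 2 * K by rewrite ler_peMr// sqr_ge0.
  have h2 := sqr_ge0 c1.
  rewrite (_ : (c1 / 4 / 128) ^+ 2 = c1 ^+ 2 / (512 * 512)); last by field.
  by lra.
pose L : R := N%:R ^+ 2 + 2.
have L0 : 0 <= L by rewrite addr_ge0 ?exprn_ge0.
exists ((2 + 2 * L) * 2 / k1), (k1 / 2), 1; split; [|by rewrite divr_gt0|by []|].
  by rewrite divr_gt0// mulr_gt0//; lra.
move=> d n eps d0 n0 e0 e1 large Sigma pS trS disp0 T0 P0 u u0 disp T P x indx ellx.
(* Chosen to make the error [128 * delta / c0] of the estimator equal to [eps]. *)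
pose delta := eps * (c0 / 128).
have delta0 : 0 < delta by rewrite mulr_gt0// divr_gt0.
have ec : eps * c0 <= c0 by rewrite ler_piMl// ltW.
have delta64 : 64 * delta <= c0 by rewrite /delta; lra.
have delta1 : delta <= 1 by rewrite /delta; rewrite /c0 in ec delta64 *; lra.
have [B [mB PB] hB] := good_event pS d0 n0 N0 u0 indx ellx delta0 delta1.
exists B; first (split=> //; apply: le_trans PB; rewrite lee_fin lerD2l lerN2).
  have n_ge0 : (0 : R) <= n%:R by [].
  have e2 : eps ^+ 2 <= 1 by rewrite expr_le1// ltW.
  have d1 : 1 <= d%:R :> R by rewrite ler1n.
  have netc : #|@in_net R d N|%:R <= expR (L * d%:R) :> R by exact: net_card.
  have t0 : 0 <= eps ^+ 2 * n%:R by rewrite mulr_ge0// sqr_ge0.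
  have tn : eps ^+ 2 * n%:R <= n%:R by rewrite ler_piMl.
  have dt : (2 + 2 * L) * 2 / k1 * d%:R <= eps ^+ 2 * n%:R.
    by rewrite [leRHS]mulrC -ler_pdivrMr ?exprn_gt0// -[leLHS]mulrA.
  have := failure_prob_le k10 k12 L0 d1 (ler0n _ _) netc t0 dt tn.
  rewrite (_ : k1 * (eps ^+ 2 * n%:R) = n%:R * (delta ^+ 2 / (16 * K))); last first.
    by rewrite /k1 /delta; field; rewrite gt_eqF.
  rewrite (_ : k2 * n%:R = n%:R * (c1 ^+ 2 / 16)); last by rewrite mulrC.
  by rewrite (_ : k1 / 2 * (eps ^+ 2 * n%:R) = k1 / 2 * eps ^+ 2 * n%:R) ?mulrA.
move=> w /hB[x0 iso spr].
have iso' := isotropy_of_net d0 N0 N4 iso.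
have Q2 (p : 'cV[R]_d) : d%:R / n%:R * \sum_j dot (direction Sigma (x j w)) p ^+ 2 <= 2 * dot p p.
  have := iso' p; rewrite ler_distl => /andP[_ h].
  have h2 : delta * dot p p <= dot p p by rewrite ler_piMl// dot_ge0.
  by lra.
have spr' := spread_of_net d0 N0 n0 N4 cN Q2 spr.
have c01 : c0 <= 1 by rewrite /c0; lra.
have [Shat est op] := tyler_estimator_close d0 n0 pS trS x0 delta0 c01 delta64 iso' spr'.
exists Shat => //; apply: le_trans op _.
by rewrite /delta (_ : 128 * (eps * (c0 / 128)) / c0 = eps)//; field; rewrite gt_eqF.
Qed.
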